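(* Let $p>1$, $\alpha_0\ge 0$, $\alpha_1\ge 0$, $\theta\ge 0$ be real numbers with $\alpha_1-p+1>0$, $\alpha_0\ge \alpha_1-p$ and $\theta>\alpha_1-p$, and put $p^*=\frac{(\theta+1)p}{\alpha_1-p+1}$. For $\tau,\beta>0$ let $$\mathcal{F}_{\tau,\beta,\theta}=\sup\Big\{\int_0^1 r^\theta|u|^{p^*}\big|\ln(\tau+|u|)\big|^{r^\beta}dr:\ u\in X^{1,p}_1(\alpha_0,\alpha_1),\ \|u\|=1\Big\}$$ and let $$\Sigma_p=\sup\Big\{\int_0^1 r^\theta|u|^{p^*}dr:\ u\in X^{1,p}_1(\alpha_0,\alpha_1),\ \|u\|=1\Big\}.$$ Then for every $\tau>0$: (i) $\mathcal{F}_{\tau,\beta,\theta}\ge\Sigma_p$ for every $\beta>0$; (ii) $\mathcal{F}_{\tau,\beta,\theta}>\Sigma_p$ if $0<\beta<\min\big\{\frac{\theta+1}{p},\frac{\alpha_1-p+1}{p-1}\big\}$; (iii) $\lim_{\beta\to\infty}\mathcal{F}_{\tau,\beta,\theta}=\Sigma_p$.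
   Context: For $\gamma\ge0$ and $q\ge1$, $L^q_\gamma=L^q_\gamma(0,1)$ is the Lebesgue space $L^q$ on $(0,1)$ with respect to the measure $r^\gamma dr$. $AC_{loc}(0,1)$ is the set of locally absolutely continuous functions on $(0,1)$. The weighted Sobolev space is $X^{1,p}_1(\alpha_0,\alpha_1)=\mathrm{cl}\{u\in AC_{loc}(0,1): \lim_{r\to1}u(r)=0,\ u\in L^p_{\alpha_0},\ u'\in L^p_{\alpha_1}\}$, the closure being with respect to the norm $(\|u\|^p_{L^p_{\alpha_0}}+\|u'\|^p_{L^p_{\alpha_1}})^{1/p}$. Under the stated assumptions this norm is equivalent to the gradient norm $\|u\|:=\|u'\|_{L^p_{\alpha_1}}=\big(\int_0^1 r^{\alpha_1}|u'|^p\,dr\big)^{1/p}$, and $\|\cdot\|$ always denotes this gradient norm. *)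

(* Defs.v *)
From HB Require Import structures.
From mathcomp Require Import all_boot all_order all_algebra.
From mathcomp Require Import all_classical all_reals all_analysis.

Set Implicit Arguments.
Unset Strict Implicit.
Unset Printing Implicit Defensive.

Import Order.TTheory GRing.Theory Num.Theory.
Import numFieldNormedType.Exports.

Local Open Scope classical_set_scope.
Local Open Scope ring_scope.

(* Functions on (0,1) are represented by functions R -> R; the spaces
   and norms below do not depend on the values outside (0,1). *)

Section weighted_sobolev.
Context {R : realType}.

Local Notation mu := (@lebesgue_measure R).

Definition I01 : set R := `]0, 1[%classic.

Definition abs_cont (a b : R) (u : R -> R) : Prop :=
  forall e : R, 0 < e -> exists2 d : R, 0 < d &
    forall (n : nat) (s t : 'I_n -> R),
      (forall i, a <= s i /\ s i <= t i /\ t i <= b) ->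
      trivIset setT (fun i => `]s i, t i[%classic) ->
      \sum_(i < n) (t i - s i) < d ->
      \sum_(i < n) `|u (t i) - u (s i)| < e.

Definition AC_loc (u : R -> R) : Prop :=
  forall a b : R, 0 < a -> a < b -> b < 1 -> abs_cont a b u.

Definition wnorm (gam q : R) (u : R -> R) : \bar R :=
  ((\int[mu]_(r in I01) (r `^ gam * `|u r| `^ q)%:E) `^ q^-1)%E.

Definition wL (gam q : R) : set (R -> R) :=
  [set u | measurable_fun I01 u /\ (wnorm gam q u < +oo)%E].

(* For u in AC_loc the pointwise derivative derive1 u exists almost everywhere;
   its (default) values elsewhere in (0,1) are irrelevant. *)
Definition gradnorm (alpha1 p : R) (u : R -> R) : \bar R := wnorm alpha1 p (derive1 u).

Definition sobnorm (alpha0 alpha1 p : R) (u : R -> R) : \bar R :=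
  ((wnorm alpha0 p u `^ p + gradnorm alpha1 p u `^ p) `^ p^-1)%E.

Definition W1p (alpha0 alpha1 p : R) : set (R -> R) :=
  [set u | [/\ AC_loc u, wL alpha0 p u & wL alpha1 p (derive1 u)]].

Definition W1p_right (alpha0 alpha1 p : R) : set (R -> R) :=
  [set u | W1p alpha0 alpha1 p u /\ u r @[r --> 1^'-] --> 0].

(* The closure of W1p_right for sobnorm, taken in the space W1p of all locally
   absolutely continuous functions with finite norm. *)
Definition X1p (alpha0 alpha1 p : R) : set (R -> R) :=
  [set u | W1p alpha0 alpha1 p u /\
     forall e : R, 0 < e -> exists2 w, W1p_right alpha0 alpha1 p w &
       (sobnorm alpha0 alpha1 p (u \- w)%R < e%:E)%E].

Definition X1p_sphere (alpha0 alpha1 p : R) : set (R -> R) :=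
  [set u | X1p alpha0 alpha1 p u /\ gradnorm alpha1 p u = 1%E].

Definition pstar (alpha1 theta p : R) : R := (theta + 1) * p / (alpha1 - p + 1).

Definition Fsup (alpha0 alpha1 theta p tau beta : R) : \bar R :=
  ereal_sup [set (\int[mu]_(r in I01)
      (r `^ theta * `|u r| `^ pstar alpha1 theta p
         * `|ln (tau + `|u r|)| `^ (r `^ beta))%:E)%E
    | u in X1p_sphere alpha0 alpha1 p].

Definition Sigma_p (alpha0 alpha1 theta p : R) : \bar R :=
  ereal_sup [set (\int[mu]_(r in I01)
      (r `^ theta * `|u r| `^ pstar alpha1 theta p)%:E)%E
    | u in X1p_sphere alpha0 alpha1 p].

End weighted_sobolev.

(* Main.v *)
Require Import Defs.
From mathcomp Require Import all_boot all_order all_algebra.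
From mathcomp Require Import all_classical all_reals all_analysis.
From HB Require Import structures.
From mathcomp Require Import measurable_realfun.
From mathcomp Require Import ring lra.

Set Implicit Arguments.
Unset Strict Implicit.
Unset Printing Implicit Defensive.
Import Order.TTheory GRing.Theory Num.Theory.
Import numFieldNormedType.Exports.

Local Open Scope classical_set_scope.
Local Open Scope ring_scope.

(* Put n = theta + 1, d = alpha1 - p + 1 > 0, nu = (n - d) / p > 0, q = n p / d. The constant Sigma_p
   is at most the sharp constant S of the one-dimensional inequality of Bliss
     int_0^1 x^(n-1) |u|^q <= S (int_0^1 x^(d+p-1) |u'|^p)^(q/p),   u(1) = 0,
   which follows by transporting the mass x^(n-1) |u|^q onto that of the extremal
   h(y) = (1 + y^(nu p/(p-1)))^(-d/(nu p)). The inequality is first proved for u' continuous and of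
   constant sign, then for |u'| bounded, then for |u'| in L^p by monotone convergence; elements of
   the closure X^{1,p}_1 satisfy |u(x)| <= int_x^1 |u'|.

   Conversely, the functions u(r) = c (h(rho r) - h(rho)), rho -> oo, give for every beta > 0
     F_beta >= S (1 - O(rho^(-n/p)) - O(rho^(-d/(p-1))) + g rho^(-beta)),   g > 0:
   the first loss comes from the region where u is too small for |ln(tau + u)| to be at least e, the
   second from subtracting h(rho), and the gain from the region r ~ 1/rho. Hence F_beta >= S for every
   beta, and F_beta > S when beta < min(n/p, d/(p-1)), which gives (i) and (ii).

   For (iii), |u(r)| <= r^(-alpha1) + 1 on the unit sphere, so that
   |ln(tau + |u|)|^(r^beta) <= 1 + E r^(beta - alpha1) and F_beta <= Sigma_p + O(1/beta). *)

(** * Absolutely continuous functions *)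

Section absolute_continuity.
Context {R : realType}.
Local Notation mu := (@lebesgue_measure R).
Implicit Types (F u : R -> R) (a b e d : R) (l : seq (R * R)).

(** Neither (i) nor (ii) can be read off function by function: [|ln (tau + |u|)|] is smaller than 1
    where [tau + |u|] lies strictly between 1/e and e, so the logarithmic factor may lower the
    integral of a given [u]. Everything goes through one explicit number S, above Sigma_p and below
    every F_beta. It is the quotient of the extremal on the half-line, approached on (0,1) only by
    concentration at 0, so the upper bound has to be sharp and the losses of concentration have to
    be measured against the gain of order rho^(-beta). The other obstacle is the function space.
    Absolute continuity is an epsilon-delta condition and u' is a pointwise derivative with default
    values, so the fundamental theorem of calculus has to be established for it: the variation
    function of [u] is absolutely continuous, a monotone absolutely continuous function defines a
    Stieltjes measure dominated by Lebesgue measure, and its Radon-Nikodym density is the derivative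
    almost everywhere. *)

Definition nonoverlap (x y : R * R) := (x.2 <= y.1) || (y.2 <= x.1).

Definition subitv a b (x : R * R) := [&& a <= x.1, x.1 <= x.2 & x.2 <= b].

(** Lists replace indexed families so that intervals can be refined one at a time by induction; the
    last inequality is not strict because it has to survive suprema over partitions. *)
Definition ac_list a b F := forall e, 0 < e -> exists2 d, 0 < d &
  forall l, all (subitv a b) l -> pairwise nonoverlap l ->
    \sum_(x <- l) (x.2 - x.1) < d -> \sum_(x <- l) `|F x.2 - F x.1| <= e.

Lemma nonoverlap_sym : symmetric nonoverlap.
Proof. by move=> x y; rewrite /nonoverlap orbC. Qed.

Lemma abs_cont_list a b u : abs_cont a b u -> ac_list a b u.
Proof.
move=> acu e e0; have [d d0 H] := acu e e0; exists d => // l lab lno ltot.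
have := H (size l) (fun i => (nth (0,0) l i).1) (fun i => (nth (0,0) l i).2).
rewrite (big_nth (0,0)) big_mkord => H'; apply/ltW/H'.
- by move=> i; have /and3P[] := (all_nthP (0,0) lab i (ltn_ord i)).
- apply/trivIsetP => i j _ _ ij.
  wlog {ij} ij : i j / (i < j)%N.
    move=> W; have [|ji|/val_inj ij'] := ltngtP i j.
    + exact: W.
    + by rewrite setIC; apply: W.
    + by rewrite ij' eqxx in ij.
  have /= := pairwiseP (0,0) lno i j (ltn_ord i) (ltn_ord j) ij.
  move=> no; rewrite -subset0 => x /= []; rewrite !in_itv/= => /andP[? ?] /andP[? ?].
  by case/orP: no => ?; lra.
- by move: ltot; rewrite (big_nth (0,0)) big_mkord.
Qed.

Lemma itv_partition_pieces a b s : a <= b -> itv_partition a b s ->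
  [/\ all (subitv a b) (zip (a :: s) s), pairwise nonoverlap (zip (a :: s) s) &
      \sum_(x <- zip (a :: s) s) (x.2 - x.1) = b - a].
Proof.
move=> _ []; elim: s a => [|c s IH] a /=.
  by move=> _ /eqP ->; rewrite big_nil subrr.
move=> /andP[ac cs] /[dup] lb /(IH c cs)[h1 h2 h3].
have cb : c <= b.
  move: lb cs => /eqP <-; elim: (s) (c) => //= z t IHt y /andP[yz zt].
  by apply: (le_trans (ltW yz)); exact: IHt.
rewrite big_cons h3/=; split; last by ring.
- rewrite /subitv/= lexx (ltW ac) cb/=; apply: sub_all h1 => -[x y]/=.
  by rewrite /subitv /= => /and3P[? -> ->]; rewrite andbT; lra.
- rewrite h2 andbT; apply: sub_all h1 => -[x y]/=.
  by rewrite /subitv /nonoverlap /= => /and3P[-> _ _].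
Qed.

(** Cutting an interval into the pieces of a partition leaves the total length unchanged, so the
    same [d] controls every refinement, and the supremum over partitions can be taken one interval
    after the other. *)
Lemma ac_list_tv a b u e d :
  (forall l, all (subitv a b) l -> pairwise nonoverlap l ->
    \sum_(x <- l) (x.2 - x.1) < d -> \sum_(x <- l) `|u x.2 - u x.1| <= e) ->
  forall l, all (subitv a b) l -> pairwise nonoverlap l ->
    \sum_(x <- l) (x.2 - x.1) < d ->
    (\sum_(x <- l) total_variation x.1 x.2 u <= e%:E)%E.
Proof.
move=> H.
(* [l1] holds the pieces of the intervals already cut, counted by their increments; [l] holds the
   intervals still to be cut, counted by their variation. *)
suff G l l1 : all (subitv a b) (l1 ++ l) -> pairwise nonoverlap (l1 ++ l) ->
    \sum_(x <- l1 ++ l) (x.2 - x.1) < d ->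
    ((\sum_(x <- l1) `|u x.2 - u x.1|)%:E +
      \sum_(x <- l) total_variation x.1 x.2 u <= e%:E)%E.
  by move=> l h1 h2 h3; have := G l [::] h1 h2 h3; rewrite big_nil add0e.
elim: l l1 => [|[s t] l IH] l1.
  by rewrite cats0 => h1 h2 h3; rewrite big_nil adde0 lee_fin; exact: H.
rewrite all_cat/= => /and3P[al1 /and3P[/= as_ st tb] al].
rewrite pairwise_cat/= => /and4P[ar pl1 xl pl].
rewrite big_cat big_cons/= => tot.
have tvl0 : (0 <= \sum_(x <- l) total_variation x.1 x.2 u)%E.
  rewrite big_seq; apply: sume_ge0 => x /(allP al) /and3P[_ xx _].
  exact: total_variation_ge0.
have st0 : 0 <= t - s by rewrite subr_ge0.
have tvl : (\sum_(x <- l) total_variation x.1 x.2 u)%E \is a fin_num.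
  rewrite ge0_fin_numE//.
  have := IH l1; rewrite all_cat al1 al pairwise_cat pl1 pl.
  move: ar; rewrite allrel_consr => /andP[_ ->]/= /(_ isT isT) IH'.
  have : ((\sum_(x <- l1) `|u x.2 - u x.1|)%:E +
     \sum_(x <- l) total_variation x.1 x.2 u < +oo)%E.
    apply: le_lt_trans (IH' _) (ltry _).
    by apply: le_lt_trans tot; rewrite big_cat/= lerD2l lerDr.
  apply: le_lt_trans; rewrite leeDr// lee_fin; exact: sumr_ge0.
rewrite big_cons/= addeCA -leeBrDr ?fin_numD ?tvl//.
apply: ge_ereal_sup => _ [_ [p pst <-] <-].
rewrite leeBrDr ?fin_numD ?tvl//.
have [h1 h2 h3] := itv_partition_pieces st pst.
rewrite variation_zip//.
have sub (x y : R * R) : subitv s t x -> nonoverlap (s, t) y -> nonoverlap x y.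
  rewrite /subitv /nonoverlap/= => /and3P[? ? ?] /orP[?|?]; apply/orP;
  [left|right]; lra.
have := IH (zip (s :: p) p ++ l1).
move: ar; rewrite allrel_consr => /andP[ar1 ar2].
have hl : allrel nonoverlap (zip (s :: p) p) l.
  apply/allrelP => x y xp yl; apply: sub; first exact: (allP h1).
  exact: (allP xl).
have hl1 : allrel nonoverlap (zip (s :: p) p) l1.
  apply/allrelP => x y xp yl; apply: sub; first exact: (allP h1).
  by rewrite nonoverlap_sym; exact: (allP ar1).
rewrite -catA !all_cat !pairwise_cat allrel_catr hl hl1 h2 al1 al pl1 pl ar2 !andbT/=.
rewrite !big_cat/= h3 => /(_ _ isT) IH'.
rewrite addeA -EFinD.
have -> : \sum_(x <- zip p (s :: p)) `|u x.1 - u x.2| =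
          \sum_(x <- zip (s :: p) p) `|u x.2 - u x.1|.
  elim: (p) (s :: p) => [|c p' IHp] [|c' p'']//=; rewrite ?big_nil// !big_cons.
  by rewrite IHp.
apply: IH'.
  apply: sub_all h1 => -[x y]; rewrite /subitv/= => /and3P[? ? ?].
  by apply/and3P; split; lra.
by rewrite addrCA.
Qed.

(** On an interval shorter than the [d] belonging to e = 1 the variation is at most 1, and finitely
    many such intervals make up [[a, b]]. *)
Lemma ac_tv_fin a b u : a <= b -> ac_list a b u ->
  total_variation a b u \is a fin_num.
Proof.
move=> ab acu; have [d d0 H] := acu 1 ltr01.
have tv_short s t : a <= s -> s <= t -> t <= b -> t - s < d ->
    total_variation s t u \is a fin_num.
  move=> as_ st tb std; rewrite ge0_fin_numE ?total_variation_ge0//.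
  have := ac_list_tv H (l := [:: (s, t)]); rewrite !big_seq1/= /subitv/= as_ st tb.
  by move=> /(_ isT isT std) /le_lt_trans; apply; exact: ltry.
have [N Nd] : exists N : nat, (b - a) / N.+1%:R < d.
  exists (Num.bound ((b - a) / d)); rewrite ltr_pdivrMr ?ltr0n// mulrC.
  rewrite -ltr_pdivrMr//; apply: lt_trans (archi_boundP _) _.
    by rewrite divr_ge0 ?subr_ge0// ltW.
  by rewrite ltr_nat.
pose x k := a + (b - a) / N.+1%:R * k%:R.
have dN0 : 0 <= (b - a) / N.+1%:R by rewrite divr_ge0// subr_ge0.
have xS k : x k.+1 = x k + (b - a) / N.+1%:R by rewrite /x -natr1; ring.
have ax k : a <= x k by rewrite lerDl mulr_ge0.
have xb k : (k <= N.+1)%N -> x k <= b.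
  move=> kN; rewrite /x -lerBrDl -[leRHS](@divfK _ N.+1%:R) ?pnatr_eq0//.
  by rewrite ler_wpM2l// ler_nat.
have tvk k : (k <= N.+1)%N -> total_variation a (x k) u \is a fin_num.
  elim: k => [_|k IH kN]; first by rewrite /x mulr0 addr0 total_variationxx.
  have xk : x k <= x k.+1 by rewrite xS lerDl.
  rewrite (total_variationD u (ax k) xk) fin_numD IH ?(ltnW kN)//=.
  by apply: tv_short => //; [exact: xb | rewrite xS addrAC subrr add0r].
have := tvk N.+1 (leqnn _).
by rewrite /x divfK ?pnatr_eq0// addrC subrK.
Qed.

(** The increment of the variation function over [[x, y]] is the variation of [u] there, so the
    bound of [ac_list_tv] is the one required. *)
Lemma ac_list_tv_fun a b u : a <= b -> ac_list a b u ->
  ac_list a b (fun x => fine (total_variation a x u)).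
Proof.
move=> ab acu e e0; have [d d0 H] := acu e e0; exists d => // l al pl tot.
rewrite -lee_fin; apply: le_trans (ac_list_tv H al pl tot).
have tvfin x : a <= x -> x <= b -> total_variation a x u \is a fin_num.
  move=> ax xb; have := ac_tv_fin ab acu.
  by rewrite (total_variationD u ax xb) fin_numD => /andP[].
rewrite -sumEFin big_seq [leRHS]big_seq; apply: lee_sum => -[x y] /(allP al)/=.
move=> /and3P[/= ax xy yb].
have xb := le_trans xy yb; have ay := le_trans ax xy.
have := tvfin _ ay yb; rewrite (total_variationD u ax xy) fin_numD => /andP[fx fxy].
by rewrite fineD// addrAC subrr add0r ger0_norm ?fine_ge0 ?total_variation_ge0// fineK.
Qed.

Lemma ac_listB a b F u : ac_list a b F -> ac_list a b u -> ac_list a b (F \- u).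
Proof.
move=> acF acu e e0.
have e20 : 0 < e / 2 by rewrite divr_gt0.
have [d1 d10 H1] := acF _ e20; have [d2 d20 H2] := acu _ e20.
exists (Num.min d1 d2) => [|l al pl]; first by rewrite lt_min d10.
rewrite lt_min => /andP[/(H1 l al pl) L1 /(H2 l al pl) L2].
rewrite [leRHS](splitr e); apply: le_trans (lerD L1 L2); rewrite -big_split/=.
apply: ler_sum => -[x y] _/=; rewrite (_ : _ - _ - _ = F y - F x - (u y - u x)).
  exact: ler_normB.
by ring.
Qed.

(** Stieltjes measures are built from functions on the whole line. Composition with [clamp] extends
    a function on [[a, b]] by its end values and keeps absolute continuity, here stated on the
    line. *)
Definition ac_global F := forall e, 0 < e -> exists2 d, 0 < d &
  forall l, all (fun x => x.1 <= x.2) l -> pairwise nonoverlap l ->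
    \sum_(x <- l) (x.2 - x.1) < d -> \sum_(x <- l) `|F x.2 - F x.1| <= e.

Definition clamp a b x : R := Num.max a (Num.min x b).

Lemma clamp_id a b x : a <= x -> x <= b -> clamp a b x = x.
Proof. by move=> ax xb; rewrite /clamp min_l// max_r. Qed.

Lemma clamp_itv a b x : a <= b -> a <= clamp a b x /\ clamp a b x <= b.
Proof. by move=> ab; rewrite /clamp le_max lexx ge_max ab ge_min lexx orbT. Qed.

Lemma clamp_mono a b x y : x <= y -> clamp a b x <= clamp a b y.
Proof.
move=> xy; by rewrite /clamp; case: (leP y b); case: (leP x b);
  case: (leP a y); case: (leP a x); case: (leP a b); lra.
Qed.

Lemma clamp_dist a b x y : a <= b -> x <= y ->
  clamp a b y - clamp a b x <= y - x.
Proof.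
by move=> ab xy; rewrite /clamp; case: (leP y b); case: (leP x b);
  case: (leP a y); case: (leP a x); case: (leP a b); lra.
Qed.

Lemma ac_global_clamp a b F : a <= b -> ac_list a b F ->
  ac_global (F \o clamp a b).
Proof.
move=> ab acF e e0; have [d d0 H] := acF e e0; exists d => // l al pl tot.
pose c (x : R * R) := (clamp a b x.1, clamp a b x.2).
have := H (map c l); rewrite !big_map/=; apply.
- rewrite all_map; apply: sub_all al => -[x y]/= xy; rewrite /subitv/=.
  by rewrite (clamp_itv x ab).1 (clamp_itv y ab).2 clamp_mono.
- rewrite pairwise_map; apply: sub_pairwise pl => -[x1 x2] [y1 y2].
  by rewrite /nonoverlap/= => /orP[?|?]; apply/orP; [left|right];
    exact: clamp_mono.
- apply: le_lt_trans tot; rewrite big_seq [leRHS]big_seq.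
  by apply: ler_sum => -[x y] /(allP al)/= xy; exact: clamp_dist.
Qed.

Lemma ac_global_continuous F : ac_global F -> continuous F.
Proof.
move=> acF x; apply/cvgrPdist_le => /= e e0; have [d d0 H] := acF e e0.
near=> y.
have yx : `|x - y| < d by near: y; exact: cvgr_dist_lt.
have {}H s t : s <= t -> `|t - s| < d -> `|F t - F s| <= e.
  move=> st; rewrite ger0_norm ?subr_ge0// => std.
  by have := H [:: (s, t)]; rewrite !big_seq1/= st; apply.
have [xy|/ltW xy] := leP y x; first exact: H.
by rewrite distrC; apply: H => //; rewrite distrC.
Unshelve. all: by end_near. Qed.

(** The inner open interval bounds the Lebesgue measure of [I] from below; the outer half-open one
    bounds a Stieltjes measure from above, its values being prescribed on intervals []s, t]]. *)
Lemma open_interval_approx (I : set R) : open I -> is_interval I -> I !=set0 ->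
  (mu I < +oo)%E -> exists s t, [/\ s < t, `]s, t[ `<=` I & I `<=` `]s, t]].
Proof.
move=> oI /is_intervalP IE [x Ix].
have IE' : I = [set` Rhull I] by rewrite [LHS]IE; apply/seteqP; split.
have := lebesgue_measure_itv (Rhull I); rewrite -IE' => -> fI.
have opI y : I y -> exists2 e, 0 < e & forall z, `|z - y| <= e -> I z.
  move=> Iy; have /nbhs_ballP[e /= e0 yeI] := open_nbhs_nbhs (conj oI Iy).
  exists (e / 2); first by rewrite divr_gt0.
  move=> z zy; apply: yeI; rewrite /ball/= distrC (le_lt_trans zy)//.
  by rewrite ltr_pdivrMr// ltr_pMr// ltr1n.
have [e e0 xe] := opI x Ix.
have Ixl : I (x - e) by apply: xe; rewrite addrAC subrr add0r normrN gtr0_norm.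
have Ixr : I (x + e) by apply: xe; rewrite addrAC subrr add0r gtr0_norm.
move: (Rhull I) IE' fI => [[bl s|bl] [br t|br]] IE'.
- move=> _; exists s, t.
  have st : s <= x - e /\ x + e <= t.
    move: Ixl Ixr; rewrite IE' /= !itv_boundlr => /andP[+ _] /andP[_].
    by case: (bl) (br) => -[]; rewrite /= !bnd_simp => *; split; lra.
  split; first by lra.
  + rewrite IE'; apply: subset_itv; rewrite bnd_simp; case: (bl) (br) => -[];
      by rewrite ?bnd_simp.
  + move=> y Iy; have [d d0 yd] := opI y Iy.
    have : I (y - d) by apply: yd; rewrite addrAC subrr add0r normrN gtr0_norm.
    move: Iy; rewrite IE' /= !itv_boundlr => /andP[_ +] /andP[+ _].
    by case: (bl) (br) => -[]; rewrite /= !bnd_simp => *; apply/andP; split; lra.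
- by case: br IE' => IE'; [move: Ix; rewrite IE' /= in_itv/= ?andbF|rewrite /= ?ltry].
- by case: bl IE' => IE'; [rewrite /= ?ltNyr|move: Ix; rewrite IE' /= in_itv/= ?andbF].
- by case: bl br IE' => -[] IE' //; move: Ix; rewrite IE' /= in_itv/= ?andbF.
Qed.

(* Outer regularity covers a null set by disjoint intervals of small total length, over which
   an absolutely continuous [F] has small increments. *)
Lemma ac_stieltjes_dominates (F : cumulative R R) : ac_global F ->
  mu.-null_set `<=` (lebesgue_stieltjes_measure F).-null_set.
Proof.
move=> acF; apply/null_content_dominatesP => A mA muA.
set nu := lebesgue_stieltjes_measure F.
have le_nu (X Y : set (measurableTypeR R)) : measurable X -> measurable Y ->
    X `<=` Y -> (nu X <= nu Y)%E.
  by move=> mX mY XY; apply: le_measure; rewrite ?inE.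
have le_mu (X Y : set (measurableTypeR R)) : measurable X -> measurable Y ->
    X `<=` Y -> (mu X <= mu Y)%E.
  by move=> mX mY XY; apply: le_measure; rewrite ?inE.
have sum_nu (J : nat -> set (measurableTypeR R)) : (forall i, measurable (J i)) ->
    trivIset setT J -> nu (\bigcup_i J i) = (\sum_(i <oo) nu (J i))%E.
  by move=> mJ tJ; apply: measure_semi_bigcup => //; exact: bigcup_measurable.
have sum_mu (J : nat -> set (measurableTypeR R)) : (forall i, measurable (J i)) ->
    trivIset setT J -> mu (\bigcup_i J i) = (\sum_(i <oo) mu (J i))%E.
  by move=> mJ tJ; apply: measure_semi_bigcup => //; exact: bigcup_measurable.
suff nuA e : 0 < e -> (nu A <= e%:E)%E.
  apply/eqP; rewrite eq_le measure_ge0 andbT; apply/lee_addgt0Pr => e e0.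
  by rewrite add0e; exact: nuA.
move=> e0; have [d d0 H] := acF e e0.
have [U [oU AU]] : exists U, [/\ open U, A `<=` U & mu (U `\` A) < d%:E]%E.
  by apply: lebesgue_regularity_outer => //; rewrite muA ltry.
move=> UAd.
have Ud : (mu U < d%:E)%E.
  rewrite -(setDUK AU) measureU//; first by rewrite muA add0e.
  - by apply: measurableD => //; exact: open_measurable.
  - by rewrite setDIK.
have mU := open_measurable oU.
apply: (@le_trans _ _ (nu U)); first exact: le_nu.
have oI i := @open_disjoint_itv_open R U oU i.
have iI i := @open_disjoint_itv_is_interval R U oU i.
have tI := @open_disjoint_itv_trivIset R U oU.
set I := open_disjoint_itv oU in oI iI tI.
have UE : U = \bigcup_i I i by exact: open_disjoint_itv_bigcup.
have mI i : measurable (I i) by exact: open_measurable.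
have IU i : I i `<=` U by rewrite UE; exact: bigcup_sup.
have Ifin i : (mu (I i) < +oo)%E.
  apply: le_lt_trans (lt_trans Ud (ltry _)).
  exact: (le_mu _ _ (mI i) mU (IU i)).
pose P i := `[< I i !=set0 >].
have /choice[f fP] i : exists x : R * R, P i ->
    [/\ x.1 < x.2, `]x.1, x.2[ `<=` I i & I i `<=` `]x.1, x.2]].
  have [I0|I0] := pselect (I i !=set0).
    by have [s [t st]] := open_interval_approx (oI i) (iI i) I0 (Ifin i); exists (s, t).
  by exists (0, 0) => /asboolP.
have nuI i : P i -> (nu (I i) <= (F (f i).2 - F (f i).1)%:E)%E.
  move=> /fP[h1 h2 h3]; apply: (@le_trans _ _ (nu `](f i).1, (f i).2]%classic)).
    exact: (le_nu _ _ (mI i) (measurable_itv _) h3).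
  rewrite /nu /lebesgue_stieltjes_measure /measure_extension measurable_mu_extE/=;
    last exact: is_ocitv.
  by rewrite wlength_itv_bnd// ltW.
have muI i : P i -> (((f i).2 - (f i).1)%:E <= mu (I i))%E.
  move=> /fP[h1 h2 h3]; apply: (@le_trans _ _ (mu `](f i).1, (f i).2[%classic)).
    by rewrite lebesgue_measure_itv/= lte_fin h1 EFinB.
  exact: (le_mu _ _ (measurable_itv _) (mI i) h2).
rewrite [in leLHS]UE (sum_nu _ mI tI).
apply: lime_le.
  by apply: is_cvg_nneseries => n _ _; exact: measure_ge0.
apply: nearW => n.
pose l := [seq i <- index_iota 0 n | P i].
have -> : (\sum_(0 <= i < n) nu (I i) = \sum_(i <- l) nu (I i))%E.
  rewrite big_filter [LHS](bigID P)/= [X in (_ + X)%E]big1 ?adde0// => i.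
  by move=> /asboolP/nonemptyPn ->; exact: measure0.
apply: (@le_trans _ _ (\sum_(x <- map f l) `|F x.2 - F x.1|)%:E).
  rewrite big_map -sumEFin big_seq [leRHS]big_seq; apply: lee_sum => i.
  rewrite mem_filter => /andP[Pi _]; apply: le_trans (nuI i Pi) _.
  by rewrite lee_fin ler_norm.
rewrite lee_fin; apply: H.
- rewrite all_map; apply/allP => i; rewrite mem_filter => /andP[/fP[+ _ _] _].
  by move=> /ltW.
- rewrite pairwise_map.
  have : pairwise [rel x y | x != y] l.
    by rewrite -uniq_pairwise filter_uniq// iota_uniq.
  apply: (@sub_in_pairwise _ P); last exact: filter_all.
  move=> i k Pi Pk/= ik; have [+ si _] := fP i Pi; have [+ sk _] := fP k Pk.
  case: (f i) (f k) si sk => [si ti] [sk tk]/= ui uk sk_tk si_ti.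
  apply/negPn/negP => /norP[]; rewrite /= -!ltNge => h1 h2.
  (* If the two intervals overlapped, the midpoint of the overlap would belong to both of the
     disjoint sets [I i] and [I k]. *)
  move/trivIsetP : tI => /(_ i k Logic.I Logic.I ik)/seteqP[+ _] => /(_ ((Num.max si sk + Num.min ti tk)/2)).
  have [? ?] : si <= Num.max si sk /\ sk <= Num.max si sk by rewrite !le_max !lexx orbT.
  have [? ?] : Num.min ti tk <= ti /\ Num.min ti tk <= tk by rewrite !ge_min !lexx orbT.
  have ? : Num.max si sk < Num.min ti tk by rewrite gt_max !lt_min si_ti h1 h2 sk_tk.
  by apply; split; [apply: ui|apply: uk]; rewrite /= in_itv/=; apply/andP; split; lra.
- rewrite big_map -lte_fin; apply: le_lt_trans Ud.
  rewrite [in leRHS]UE (sum_mu _ mI tI) -sumEFin.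
  apply: (@le_trans _ _ (\sum_(i <- l) mu (I i))%E).
    rewrite big_seq [leRHS]big_seq; apply: lee_sum => i.
    by rewrite mem_filter => /andP[Pi _]; exact: muI.
  apply: le_trans (nneseries_lim_ge n _); last by move=> *; exact: measure_ge0.
  rewrite big_filter [leRHS](bigID P)/= leeDl//.
  by apply: sume_ge0 => i _; exact: measure_ge0.
Qed.

(** Restricted to []a, b]] the Stieltjes measure of [F] is finite, and it is dominated by Lebesgue
    measure; [g] is its Radon-Nikodym derivative. *)
Lemma ac_nondecreasing_density F a b : a < b ->
  {homo F : x y / x <= y} -> ac_global F ->
  exists g : R -> R, mu.-integrable setT (EFin \o g) /\
    forall x y, a <= x -> x <= y -> y <= b ->
      (\int[mu]_(t in `]x, y]) (g t)%:E)%E = (F y - F x)%:E.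
Proof.
move=> ab ndF acF.
have rcF : forall x, F z @[z --> x^'+] --> F x.
  by apply: right_continuousW; exact: ac_global_continuous.
pose C := isCumulative.Build R _ R F ndF rcF.
pose Fc : cumulative R R := HB.pack F C.
pose nu := lebesgue_stieltjes_measure Fc.
have nuE x y : x <= y -> nu `]x, y]%classic = (F y - F x)%:E.
  move=> xy; rewrite /nu /lebesgue_stieltjes_measure /measure_extension.
  rewrite measurable_mu_extE/=; last exact: is_ocitv.
  by rewrite wlength_itv_bnd.
have mab : measurable (`]a, b]%classic : set (measurableTypeR R)) by exact: measurable_itv.
have nuab : (nu `]a, b]%classic < +oo)%E by rewrite nuE ?ltW ?ltry.
pose nuf : {finite_measure set _ -> \bar R} := mfrestr mab nuab.
have dom : mu.-null_set `<=` nuf.-null_set.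
  apply/null_content_dominatesP => A mA muA.
  have : mu.-null_set `<=` nu.-null_set by exact: ac_stieltjes_dominates.
  move=> /null_content_dominatesP/(_ A mA muA) nuA.
  apply/eqP; rewrite eq_le measure_ge0 andbT -nuA.
  rewrite /nuf/= /mfrestr /mrestr; apply: le_measure; rewrite ?inE//.
  exact: measurableI.
have [f [f0 ffin intf fE]] := radon_nikodym_sigma_finite dom.
exists (fine \o f); split.
  apply: eq_integrable intf => // x _; by rewrite /= fineK.
move=> x y ax xy yb; rewrite -nuE//.
under eq_integral do rewrite /= fineK//.
rewrite -fE; last exact: measurable_itv.
rewrite /nuf/= /mfrestr /mrestr setIidl//.
by apply: subset_itv; rewrite bnd_simp.
Qed.

(* [u] is the difference of the nondecreasing functions [V] and [V - u], [V] its total variation. *)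
Lemma ac_density a b u : a < b -> abs_cont a b u ->
  exists g : R -> R, mu.-integrable setT (EFin \o g) /\
    forall x y, a <= x -> x <= y -> y <= b ->
      (\int[mu]_(t in `]x, y]) (g t)%:E)%E = (u y - u x)%:E.
Proof.
move=> ab /abs_cont_list acu; have leab := ltW ab.
pose V x := fine (total_variation a x u).
have acV : ac_list a b V by exact: ac_list_tv_fun.
have tvfin x : a <= x -> x <= b -> total_variation a x u \is a fin_num.
  move=> ax xb; have := ac_tv_fin leab acu.
  by rewrite (total_variationD u ax xb) fin_numD => /andP[].
have VD x y : a <= x -> x <= y -> y <= b -> `|u y - u x| <= V y - V x.
  move=> ax xy yb; have ay := le_trans ax xy; have xb := le_trans xy yb.
  have := tvfin _ ay yb.
  rewrite /V (total_variationD u ax xy) fin_numD => /andP[fx fxy].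
  rewrite fineD// addrAC subrr add0r -lee_fin fineK//; exact: total_variation_ge.
have cab x := clamp_itv x leab.
have [g1 [ig1 g1E]] : exists g : R -> R, mu.-integrable setT (EFin \o g) /\
    forall x y, a <= x -> x <= y -> y <= b ->
      (\int[mu]_(t in `]x, y]) (g t)%:E)%E = (V y - V x)%:E.
  have [x y xy||g [ig gE]] := @ac_nondecreasing_density (V \o clamp a b) a b ab.
  - rewrite /= -subr_ge0; apply: le_trans (VD _ _ _ _ _); rewrite ?(cab _).1 ?(cab _).2//.
    exact: clamp_mono.
  - exact: ac_global_clamp.
  - exists g; split => // x y ax xy yb; rewrite gE//= !clamp_id//.
      exact: le_trans xy yb.
    exact: le_trans ax xy.
have [g2 [ig2 g2E]] : exists g : R -> R, mu.-integrable setT (EFin \o g) /\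
    forall x y, a <= x -> x <= y -> y <= b ->
      (\int[mu]_(t in `]x, y]) (g t)%:E)%E = (V y - u y - (V x - u x))%:E.
  have [x y xy||g [ig gE]] := @ac_nondecreasing_density ((V \- u) \o clamp a b) a b ab.
  - rewrite /=; have := VD (clamp a b x) (clamp a b y); rewrite !(cab _).1 !(cab _).2.
    move=> /(_ isT (clamp_mono _ _ xy) isT); rewrite ler_norml => /andP[_ ?]; lra.
  - by apply: ac_global_clamp => //; exact: ac_listB.
  - exists g; split => // x y ax xy yb; rewrite gE//= !clamp_id//.
      exact: le_trans xy yb.
    exact: le_trans ax xy.
exists (g1 \- g2); split.
  by apply: eq_integrable (integrableB _ ig1 ig2).
move=> x y ax xy yb.
under eq_integral do rewrite /= EFinB.
rewrite integralB//.
- by rewrite g1E// g2E// -EFinB; congr EFin; ring.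
- exact: (integrableS measurableT).
- exact: (integrableS measurableT).
Qed.

(** Lebesgue's differentiation theorem identifies the density of [ac_density] with [derive1 u]
    almost everywhere. The measurability hypothesis lets the two be exchanged under the integral,
    whatever the default values on the exceptional null set. *)
Lemma abs_cont_FTC a b u : a < b -> abs_cont a b u ->
  measurable_fun `]a, b[ (derive1 u) ->
  [/\ {ae mu, forall x, a < x < b -> derivable u x 1},
      mu.-integrable `]a, b[ (EFin \o derive1 u) &
      forall x y, a <= x -> x <= y -> y <= b ->
      (\int[mu]_(t in `]x, y[) (derive1 u t)%:E)%E = (u y - u x)%:E].
Proof.
move=> ab acu mu'; have [g [ig gE]] := ac_density ab acu.
have iS (D : set R) : measurable D -> mu.-integrable D (EFin \o g).
  by move=> mD; exact: (integrableS measurableT).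
have := @FTC1 R g (BRight a).
move=> /(_ (fun y => iS _ (measurable_itv _))) /(_ _)/=.
have locg : locally_integrable setT g by apply: open_integrable_locally; [exact: openT|exact: ig].
move=> /(_ locg) H.
have {}H : {ae mu, forall x, a < x < b -> derivable u x 1 /\ derive1 u x = g x}.
  move: H; apply: filterS; first exact: (ae_filter_ringOfSetsType mu).
  move=> x /= H /andP[ax xb].
  have {H} [dG G'] := H ax.
  have uG : \forall y \near x, u y - u a = \int[mu]_(t in `]a, y]) g t.
    near=> y; rewrite /Rintegral gE//; apply/ltW; near: y.
      by apply: lt_nbhsr.
    by apply: lt_nbhsl.
  have uG' : \forall y \near x, u a + \int[mu]_(t in `]a, y]) g t = u y.
    by apply: filterS uG => y <-; rewrite addrC subrK.
  have dG' : is_derive x 1 (cst (u a) + (fun y => \int[mu]_(t in `]a, y]) g t)) (g x).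
    rewrite -[X in is_derive _ _ _ X]add0r -G' derive1E.
    exact: is_deriveD.
  split.
    by apply: near_eq_derivable; last exact: (@ex_derive _ _ _ _ _ _ _ dG').
  rewrite derive1E -(@derive_val _ _ _ _ _ _ _ dG').
  by apply: near_eq_derive => //; apply: filterS uG'.
have eqg D : measurable D -> D `<=` `]a, b[ -> ae_eq mu D (EFin \o g) (EFin \o derive1 u).
  move=> mD Dab; move: H; apply: filterS; first exact: (ae_filter_ringOfSetsType mu).
  by move=> x /= H /Dab; rewrite /= in_itv/= => /H[_ ->].
have mu'D D : measurable D -> D `<=` `]a, b[ -> measurable_fun D (EFin \o derive1 u).
  move=> mD Dab; apply/measurable_EFinP; apply: measurable_funS mu' => //.
split.
- by move: H; apply: filterS; first exact: (ae_filter_ringOfSetsType mu); move=> x /= H /H[].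
- have mD : measurable (`]a, b[%classic : set R) by exact: measurable_itv.
  have /integrableP[mg fg] := iS _ mD.
  apply/integrableP; split; first exact: mu'D.
  rewrite [ltLHS](_ : _ = (\int[mu]_(x in `]a, b[) `|(EFin \o g) x|)%E)//.
  apply: ae_eq_integral => //.
  - by apply: measurableT_comp => //; exact: mu'D.
  - exact: measurableT_comp.
  - have := eqg _ mD (@subset_refl _ _); apply: filterS.
    by move=> x /= + Dx => /(_ Dx)/= [<-].
- move=> x y ax xy yb.
  have mD : measurable (`]x, y[%classic : set R) by exact: measurable_itv.
  have sD : `]x, y[%classic `<=` `]a, b[ by apply: subset_itv; rewrite bnd_simp.
  rewrite -gE// [RHS](_ : _ = (\int[mu]_(t in `]x, y[) (g t)%:E)%E); last first.
    by rewrite integral_itv_bndo_bndc//; have /measurable_int := iS _ mD.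
  apply: ae_eq_integral => //; first exact: mu'D.
    by have /measurable_int := iS _ mD.
  by apply: ae_eq_sym; exact: eqg.
Unshelve. all: by end_near. Qed.

End absolute_continuity.

(** * One-variable calculus *)

Section calculus.
Context {R : realType}.
Local Notation mu := (@lebesgue_measure R).
Implicit Types (f F : R -> R) (a b x y s : R).

Lemma powRE x s : 0 < x -> x `^ s = expR (s * ln x).
Proof. by move=> x0; rewrite /powR gt_eqF. Qed.

Lemma is_derive_continuous f x l : is_derive x 1 f l -> {for x, continuous f}.
Proof.
by move=> fl; apply/differentiable_continuous/derivable1_diffP; exact: ex_derive.
Qed.

Lemma powR_continuous s x : 0 < x -> {for x, continuous (@powR R ^~ s)}.
Proof. by move=> x0; apply: is_derive_continuous; exact: is_derive1_powR. Qed.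

Lemma itv_continuous_measurable f a b : (forall x, a < x < b -> {for x, continuous f}) ->
  measurable_fun `]a, b[ f.
Proof.
move=> cf; apply: open_continuous_measurable_fun => // x.
by rewrite inE/= in_itv/=; exact: cf.
Qed.

(** [F] has only one-sided limits at the ends, so the fundamental theorem is applied on
    [[a + d n, b - d n]], and [n] tends to infinity by monotone convergence. *)
Lemma ge0_FTC_oo f F a b (la lb : R) : a < b ->
  (forall x, a < x < b -> {for x, continuous f}) ->
  (forall x, a < x < b -> 0 <= f x) ->
  (forall x, a < x < b -> is_derive x 1 F (f x)) ->
  F x @[x --> a^'+] --> la -> F x @[x --> b^'-] --> lb ->
  (\int[mu]_(x in `]a, b[) (f x)%:E)%E = (lb - la)%:E.
Proof.
move=> ab cf f0 dF Fa Fb.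
(* The shift by 3 gives [3 * d n <= b - a], so that the interval is nondegenerate already for n =
   0. *)
pose d n : R := (b - a) / n.+3%:R.
have d0 n : 0 < d n by rewrite divr_gt0// subr_gt0.
have d3 n : 3 * d n <= b - a.
  rewrite /d mulrCA ler_piMr ?subr_ge0 ?(ltW ab)// ler_pdivrMr// mul1r.
  by rewrite ler_nat.
have dcvg : d n @[n --> \oo] --> 0.
  rewrite -(mulr0 (b - a)); apply: cvgMr.
  by have := @cvg_harmonic R; rewrite -cvg_shiftS -cvg_shiftS.
pose S n : set R := `[a + d n, b - d n]%classic.
have dn n m : (n <= m)%N -> d m <= d n.
  move=> nm; rewrite /d ler_pM2l ?subr_gt0// lef_pV2 ?posrE// ler_nat.
  by rewrite !ltnS.
have Sab n x : S n x -> a < x < b.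
  rewrite /S/= in_itv/= => /andP[h1 h2]; have dn0 := d0 n; apply/andP; split; lra.
have SE : `]a, b[%classic = \bigcup_n S n.
  apply/seteqP; split => [x|x [n _]]; last exact: Sab.
  rewrite /= in_itv/= => /andP[ax xb].
  have e0 : 0 < Num.min (x - a) (b - x) by rewrite lt_min !subr_gt0 ax xb.
  have /cvgrPdist_lt/(_ _ e0)[N _ /(_ N (leqnn _))/=] := dcvg.
  rewrite sub0r normrN gtr0_norm// lt_min => /andP[h1 h2].
  by exists N => //; rewrite /S/= in_itv/=; apply/andP; split; lra.
have mf n : measurable_fun (S n) (EFin \o f).
  apply/measurable_EFinP; apply: (@measurable_funS _ _ _ _ `]a, b[) => //.
    by move=> x /Sab; rewrite /= in_itv.
  exact: itv_continuous_measurable.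
have intS n : (\int[mu]_(x in S n) (f x)%:E)%E = (F (b - d n) - F (a + d n))%:E.
  have lt : a + d n < b - d n by have := d0 n; have := d3 n; lra.
  have Sab' x : a + d n <= x <= b - d n -> a < x < b.
    by move=> h; apply: (Sab n); rewrite /S/= in_itv.
  rewrite (@continuous_FTC2 _ f F)//.
  - apply: continuous_in_subspaceT => x; rewrite inE/= in_itv/= => /Sab'.
    exact: cf.
  - have Fc x : a + d n <= x <= b - d n -> {for x, continuous F}.
      by move=> /Sab' /dF; exact: is_derive_continuous.
    split.
    + move=> x; rewrite in_itv/= => /andP[h1 h2].
      by apply: (@ex_derive _ _ _ _ _ _ (f x)); apply: dF; apply: Sab'; rewrite !ltW.
    + by apply: cvg_at_right_filter; apply: Fc; rewrite lexx ltW.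
    + by apply: cvg_at_left_filter; apply: Fc; rewrite lexx ltW.
  - move=> x; rewrite in_itv/= => /andP[h1 h2]; rewrite derive1E.
    by apply: derive_val; apply: dF; apply: Sab'; rewrite !ltW.
have H : (\int[mu]_(x in S i) (EFin \o f) x @[i --> \oo] --> \int[mu]_(x in `]a, b[) (f x)%:E)%E.
  rewrite SE; apply: ge0_nondecreasing_set_cvg_integral.
  - move=> n m nm; apply/subsetPset => x; rewrite /S/= !in_itv/=.
    have := dn _ _ nm; move=> dmn /andP[? ?]; apply/andP; split; lra.
  - by move=> n; exact: measurable_itv.
  - exact: mf.
  - by move=> n x /Sab; rewrite /= lee_fin; exact: f0.
apply: cvg_unique H _ => //.
rewrite (_ : (fun _ => _) = (fun n => (F (b - d n) - F (a + d n))%:E)); last first.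
  by apply/funext => n; exact: intS.
apply: cvg_EFin; first exact: nearW.
apply: cvgB.
- move/cvg_at_leftP : Fb; apply; split; first by move=> n; rewrite ltrBlDr ltrDl.
  by rewrite -[X in _ --> X]subr0; apply: cvgB => //; exact: cvg_cst.
- move/cvg_at_rightP : Fa; apply; split; first by move=> n; rewrite ltrDl.
  by rewrite -[X in _ --> X]addr0; apply: cvgD => //; exact: cvg_cst.
Qed.

(** Continuity is available on the positive axis only; the bound on each []0, b[] makes [f]
    integrable up to 0 and forces the primitive to tend to 0 there. *)
Lemma ge0_antiderivative f : (forall x, 0 < x -> 0 <= f x) ->
  (forall x, 0 < x -> {for x, continuous f}) ->
  (forall b, exists M, forall x, 0 < x < b -> f x <= M) ->
  exists G : R -> R, [/\ forall x, 0 < x -> is_derive x 1 G (f x),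
    G x @[x --> 0^'+] --> 0 &
    forall x, 0 < x -> (\int[mu]_(t in `]0%R, x[) (f t)%:E)%E = (G x)%:E].
Proof.
move=> f0 cf bf.
have mf b : measurable_fun `]0, b[ f.
  by apply: itv_continuous_measurable => x /andP[x0 _]; exact: cf.
have fint b : mu.-integrable `]0, b[ (EFin \o f).
  have [M fM] := bf b.
  apply/integrableP; split; first by apply/measurable_EFinP; exact: mf.
  apply: (@le_lt_trans _ _ (\int[mu]_(x in `]0%R, b[) (Num.max M 0)%:E)%E).
    apply: ge0_le_integral => //=.
    - by apply/measurable_EFinP; apply: measurableT_comp => //; exact: mf.
    - move=> x; rewrite /= in_itv/= => x0b; have /andP[x0 _] := x0b.
      by rewrite lee_fin ger0_norm ?f0// le_max fM.
  rewrite integral_cst//= lebesgue_measure_itv/=.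
  by case: ifP => _; rewrite ?mule0 ?ltry// -EFinM ltry.
pose G x : R := \int[mu]_(t in `]0, x]) f t.
have Gcc x : 0 < x -> mu.-integrable `]0, x] (EFin \o f).
  by move=> x0; apply: integrableS (fint (x + 1)) => //; apply: subset_itvl; rewrite bnd_simp ltrDl.
have GE x : 0 < x -> (\int[mu]_(t in `]0%R, x[) (f t)%:E)%E = (G x)%:E.
  move=> x0; rewrite /G/Rintegral fineK; last first.
    by have := integrable_fin_num _ (Gcc _ x0); apply.
  by rewrite integral_itv_bndo_bndc//; exact/measurable_EFinP.
have dG x : 0 < x -> is_derive x 1 G (f x).
  move=> x0; have xx : x < x + 1 by rewrite ltrDl.
  have [|||dG' G'] := @continuous_FTC1 _ f (BRight 0) x _ xx.
  - by apply: Gcc; rewrite addr_gt0.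
  - by rewrite /= lte_fin.
  - exact: cf.
  by apply: DeriveDef; [exact: dG'|rewrite -derive1E; exact: G'].
exists G; split => //.
have [M fM] := bf 1.
apply: (@squeeze_cvgr _ _ _ _ (fun _ => 0) (fun x => Num.max M 0 * x)).
- near=> x.
  have x0 : 0 < x by [].
  rewrite -!lee_fin -GE//; apply/andP; split.
    by apply: integral_ge0 => t; rewrite /= in_itv/= => /andP[t0 _]; rewrite lee_fin f0.
  apply: (@le_trans _ _ (\int[mu]_(t in `]0%R, x[) (Num.max M 0)%:E)%E).
    apply: ge0_le_integral => //=.
    - by move=> t; rewrite /= in_itv/= => /andP[t0 _]; rewrite lee_fin f0.
    - by apply/measurable_EFinP; exact: mf.
    - move=> t; rewrite /= in_itv/= => /andP[t0 tx].
      rewrite lee_fin le_max fM// t0/=; apply: lt_trans tx _.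
      by near: x; apply: nbhs_right_lt.
  by rewrite integral_cst//= lebesgue_measure_itv/= lte_fin x0 oppr0 adde0 EFinM.
- exact: cvg_cst.
- rewrite -[X in _ --> X](mulr0 (Num.max M 0)); apply: cvgMr.
  by apply: cvg_at_right_filter; exact: cvg_id.
Unshelve. all: by end_near. Qed.

Lemma oo_derive_ge0 F f a b : (forall x, a < x < b -> is_derive x 1 F (f x)) ->
  (forall x, a < x < b -> 0 <= f x) ->
  forall x y, a < x -> x <= y -> y < b -> F x <= F y.
Proof.
move=> dF f0 x y ax xy yb.
apply: (@ger0_derive1_le_oo _ F a b) => //; rewrite ?in_itv/=.
- by move=> z; rewrite in_itv/= => zab; apply: (@ex_derive _ _ _ _ _ _ (f z)); exact: dF.
- move=> z; rewrite in_itv/= => zab; rewrite derive1E.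
  by have dz := dF _ zab; rewrite derive_val; exact: f0.
- by move=> z; rewrite inE/= in_itv/= => zab; apply: is_derive_continuous; exact: dF.
- by rewrite ax (le_lt_trans xy).
- by rewrite yb (lt_le_trans ax).
Qed.

Lemma oo_derive_gt0 F f a b : (forall x, a < x < b -> is_derive x 1 F (f x)) ->
  (forall x, a < x < b -> 0 < f x) ->
  forall x y, a < x -> x < y -> y < b -> F x < F y.
Proof.
move=> dF f0 x y ax xy yb.
apply: (@gtr0_derive1_lt_oo _ F a b) => //; rewrite ?in_itv/=.
- by move=> z; rewrite in_itv/= => zab; apply: (@ex_derive _ _ _ _ _ _ (f z)); exact: dF.
- move=> z; rewrite in_itv/= => zab; rewrite derive1E.
  by have dz := dF _ zab; rewrite derive_val; exact: f0.
- by move=> z; rewrite inE/= in_itv/= => zab; apply: is_derive_continuous; exact: dF.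
- by rewrite ax (lt_trans xy).
- by rewrite yb (lt_trans ax).
Qed.

Lemma oo_derive_limits F f a b (la lb : R) : a < b ->
  (forall x, a < x < b -> is_derive x 1 F (f x)) ->
  (forall x, a < x < b -> 0 <= f x) ->
  F x @[x --> a^'+] --> la -> F x @[x --> b^'-] --> lb -> la <= lb.
Proof.
move=> ab dF f0 Fa Fb.
apply: (cvgr_to_le Fa); near=> x; apply: (cvgr_to_ge Fb); near=> y.
apply: (oo_derive_ge0 dF f0) => //.
by near: y; apply: nbhs_left_ge; near: x; exact: nbhs_right_lt.
Unshelve. all: by end_near. Qed.

End calculus.

(** * Bliss's inequality by mass transport *)

Section powers.
Context {R : realType}.
Implicit Types (x y z s t : R).

Lemma expR_powR x s : expR x `^ s = expR (s * x).
Proof. by rewrite powRE ?expR_gt0// expRK. Qed.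

Lemma expR_surj (x : R) : 0 < x -> exists l, x = expR l.
Proof. by move=> x0; exists (ln x); rewrite lnK. Qed.

Lemma gt0_powRD x s t : 0 < x -> x `^ (s + t) = x `^ s * x `^ t.
Proof. by move=> x0; rewrite powRD// (gt_eqF x0) implybT. Qed.

Lemma one_powR s : 1 `^ s = 1 :> R.
Proof. by rewrite powR1. Qed.

Lemma powRN_cvgy s : 0 < s -> y `^ (- s) @[y --> +oo] --> (0 : R).
Proof.
move=> s0; apply/cvgrPdist_lt => /= e e0; near=> y.
have y0 : 0 < y by [].
rewrite sub0r normrN ger0_norm ?powR_ge0// powRN invf_plt ?posrE ?powR_gt0//.
rewrite -[ltLHS](powRr1) ?invr_ge0 ?(ltW e0)// -[X in _ `^ X < _](mulVf (lt0r_neq0 s0)).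
rewrite powRrM; apply: gt0_ltr_powR; rewrite ?nnegrE ?powR_ge0 ?(ltW y0)//.
Unshelve. all: by end_near. Qed.

Lemma weighted_AMGM z t : 0 < z -> 0 < t -> t < 1 -> z `^ t <= t * z + (1 - t).
Proof.
move=> z0 t0 t1.
have t'0 : 0 < 1 - t by lra.
have := @conjugate_powR R (z `^ t) 1 t^-1 (1 - t)^-1.
have -> : (z `^ t) `^ t^-1 = z.
  by rewrite -powRrM divff ?gt_eqF// powRr1// ltW.
have -> : 1 `^ (1 - t)^-1 = 1 :> R by rewrite powR1.
rewrite mulr1 !invrK mul1r mulrC; apply; rewrite ?powR_ge0 ?ltW ?invr_gt0//.
by rewrite addrC subrK.
Qed.

(** Without the absolute value the map would jump at 0, since [powR] of a negative base is 1. *)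
Lemma norm_powR_continuous s : 0 < s -> continuous (fun y : R => `|y| `^ s).
Proof.
move=> s0 y; have [->|y0] := eqVneq y 0.
  rewrite /continuous_at normr0 powR0 ?gt_eqF//.
  apply/cvgrPdist_le => /= e e0; near=> z.
  rewrite sub0r normrN ger0_norm ?powR_ge0//.
  rewrite (_ : e = (e `^ s^-1) `^ s); last first.
    by rewrite -powRrM mulVf ?gt_eqF// powRr1// ltW.
  apply: ge0_ler_powR; rewrite ?nnegrE ?powR_ge0 ?normr_ge0 ?(ltW s0)// ltW//.
  near: z; have := @cvgr_dist_lt _ R^o _ (nbhs (0:R)) _ id 0 cvg_id (e `^ s^-1).
  by rewrite powR_gt0// => /(_ _ isT); apply: filterS => z; rewrite sub0r normrN.
apply: (@continuous_comp _ _ _ (@Num.norm _ R) (fun x => x `^ s)).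
  exact: norm_continuous.
by apply: powR_continuous; rewrite normr_gt0.
Unshelve. all: by end_near. Qed.

Lemma gt0_cvg_powR {S : Type} (F : set_system S) {FF : Filter F} (v : S -> R) s :
  0 < s -> (\forall x \near F, 0 < v x) -> v x @[x --> F] --> 0 ->
  v x `^ s @[x --> F] --> 0.
Proof.
move=> s0 vpos v0; have h0 := @norm_powR_continuous s s0 0.
have h : `|v x| `^ s @[x --> F] --> 0.
  have := @cvg_comp _ _ _ v (fun y => `|y| `^ s) _ _ _ v0 h0.
  by rewrite /= normr0 powR0 ?gt_eqF.
apply: cvg_trans h; apply: near_eq_cvg; apply: filterS vpos => x vx.
by rewrite gtr0_norm.
Qed.

Lemma is_derive_1D_powR (b s y : R) : 0 < y -> is_derive y 1 (fun y => (1 + y `^ b) `^ s)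
  (s * (1 + y `^ b) `^ (s - 1) * (b * y `^ (b - 1))).
Proof.
move=> y0; apply: (@is_derive1_comp _ (@powR R ^~ s) (fun y => 1 + y `^ b)).
  by apply: is_derive1_powR; rewrite ltr_pwDl// powR_ge0.
rewrite -[Z in is_derive _ _ _ Z]add0r.
by apply: is_deriveD; exact: is_derive1_powR.
Qed.

Lemma powR_mono (s a b : R) : 0 <= s -> 0 <= a -> a <= b -> a `^ s <= b `^ s.
Proof.
by move=> s0 a0 ab; apply: ge0_ler_powR; rewrite ?nnegrE//; exact: le_trans ab.
Qed.

Lemma powRN_le1 (a s : R) : 1 <= a -> 0 <= s -> a `^ (- s) <= 1.
Proof.
move=> a1 s0; rewrite powRN invf_le1 ?powR_gt0 ?(lt_le_trans ltr01)//.
by rewrite -[leLHS](powRr0 a) ler_powR.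
Qed.

End powers.

Section bliss.
Context {R : realType} (p d nu : R).
Context (p1 : 1 < p) (d0 : 0 < d) (nu0 : 0 < nu).

Let n := d + nu * p.
Let q := n * p / d.
Let p' := p / (p - 1).
(** [kap] is the decay exponent of the extremal at infinity. The value [a = 1 + q / p'] makes the
    p'-th power of [u^(a-1)] equal to [u^q] in Young's inequality. *)
Let kap := d / (p - 1).
Let a := 1 + (p - 1) * n / d.

Let p0 : 0 < p. Proof. exact: lt_trans ltr01 p1. Qed.
Let pp0 : 0 < p - 1. Proof. by rewrite subr_gt0. Qed.
Let n0 : 0 < n. Proof. by rewrite /n addr_gt0// mulr_gt0. Qed.
Let q0 : 0 < q. Proof. by rewrite /q divr_gt0// mulr_gt0. Qed.
Let p'0 : 0 < p'. Proof. by rewrite /p' divr_gt0. Qed.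
Let nnu : nu < n.
Proof.
rewrite /n; apply: lt_trans (_ : nu * p < _); last by rewrite ltrDr.
by rewrite ltr_pMr.
Qed.

(* Pointwise inequality behind the transport argument, [T] being the value and [T'] the derivative
   of the transport map: Young's inequality for the gradient term, AM-GM for the rest. *)
Lemma transport_pointwise (r u g T X de m T' : R) :
  0 < r -> 0 < u -> 0 < g -> 0 < T -> 0 < X -> 0 < de -> 0 < m ->
  T' = m * (r `^ (n - 1) * u `^ q) / (T `^ (n - 1) * X `^ (- (n / nu))) ->
  m * (r `^ (n - 1) * u `^ q) * X <=
  m `^ (1 - nu / n) / n *
   (a * u `^ (a - 1) * (- g) * (T `^ nu * r `^ (n - nu)) +
    u `^ a * (nu * T `^ (nu - 1) * T' * r `^ (n - nu) +
              T `^ nu * ((n - nu) * r `^ (n - nu - 1))) +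
    a * (de `^ p / p * (r `^ (d + p - 1) * g `^ p) +
         de `^ (- p') / (p' * m) * (T `^ (n - 1 + nu * p') * X `^ (- (n / nu)) * T'))).
Proof.
(* All positive quantities are written as exponentials, so that an identity between products of
   powers becomes a rational identity between exponents. *)
move=> /expR_surj[lr rE] /expR_surj[lu uE] /expR_surj[lg gE].
move=> /expR_surj[lT TE] /expR_surj[lX XE] /expR_surj[ld dE] /expR_surj[lm mE] T'E.
have nn0 : n != 0 by rewrite gt_eqF. have nun0 : nu != 0 by rewrite gt_eqF.
have dn0 : d != 0 by rewrite gt_eqF. have pn0 : p != 0 by rewrite gt_eqF.
have pm0 : p - 1 != 0 by rewrite gt_eqF.
have E (x : R) s : expR x `^ s = expR (s * x) := expR_powR x s.
(* [z] is [r * T' / T], the quantity to which AM-GM is applied. *)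
set z := expR (lm + n * lr + q * lu - n * lT + n / nu * lX).
have zE : T `^ (nu - 1) * T' * r `^ (n - nu) = z * (T `^ nu * r `^ (n - nu - 1)).
  rewrite T'E TE mE rE uE XE /z !E !invfM -!expRN !mulrA -!expRD.
  by congr expR; field.
have WE : m^-1 * (T `^ (n - 1 + nu * p') * X `^ (- (n / nu)) * T') =
    r `^ (n - 1) * u `^ q * T `^ (nu * p').
  rewrite T'E TE mE rE uE XE !E !invfM -!expRN !mulrA -!expRD.
  by congr expR; rewrite /p'; field; rewrite pm0 nun0.
(* The two factors are weighted so that the p-th power of the first is the gradient density and the
   p'-th power of the second is, by [WE], the derivative of [W] along the transport, up to [m]; [de]
   is a free scaling. *)
have young : u `^ (a - 1) * g * (T `^ nu * r `^ (n - nu)) <=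
    de `^ p / p * (r `^ (d + p - 1) * g `^ p) +
    de `^ (- p') / (p' * m) * (T `^ (n - 1 + nu * p') * X `^ (- (n / nu)) * T').
  have pq1 : p^-1 + p'^-1 = 1 by rewrite /p'; field; rewrite pm0 pn0.
  rewrite [leLHS](_ : _ = (de * r `^ ((d + p - 1) / p) * g) *
    (de^-1 * u `^ (q / p') * T `^ nu * r `^ ((n - 1) / p'))); last first.
    rewrite TE rE uE gE dE !E -!expRN !mulrA -!expRD.
    by congr expR; rewrite /a /q /p' /n; field; rewrite dn0 pn0 pm0.
  rewrite [leRHS](_ : _ = (de * r `^ ((d + p - 1) / p) * g) `^ p / p +
    (de^-1 * u `^ (q / p') * T `^ nu * r `^ ((n - 1) / p')) `^ p' / p').
    by apply: conjugate_powR pq1;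
      rewrite ?mulr_ge0 ?powR_ge0 ?invr_ge0 ?expR_ge0 ?rE ?uE ?gE ?dE ?TE ?expR_ge0.
  congr (_ + _).
    rewrite mulrAC; congr (_ / p); rewrite rE gE dE !E !mulrA -!expRD E.
    by congr expR; field.
  move: WE; set w := (X in m^-1 * X = _) => WE.
  rewrite [LHS](_ : _ = de `^ (- p') * (m^-1 * w) / p'); last first.
    by rewrite -/w invfM; ring.
  rewrite WE; congr (_ / _); rewrite TE rE uE dE !E -!expRN !mulrA -!expRD E.
  by congr expR; rewrite /q /p' /n; field; rewrite dn0 pm0 pn0.
have t1 : nu / n < 1 by rewrite ltr_pdivrMr// mul1r.
have amgm : z `^ (nu / n) <= nu / n * z + (1 - nu / n).
  by apply: weighted_AMGM => //; [exact: expR_gt0|exact: divr_gt0].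
(* The power nu/n of [z] contains [X] to the first power and cancels [T^nu]; this recovers the
   left-hand side of the claim. *)
have zn : m `^ (1 - nu / n) * (u `^ a * T `^ nu * r `^ (n - nu - 1)) * z `^ (nu / n)
   = m * (r `^ (n - 1) * u `^ q) * X.
  rewrite TE mE rE uE XE /z !E !mulrA -!expRD.
  by congr expR; rewrite /a /q /n; field; rewrite -/n nn0 nun0 dn0.
set B := m `^ (1 - nu / n) * (u `^ a * T `^ nu * r `^ (n - nu - 1)) in zn.
have B0 : 0 < B by rewrite /B !mulr_gt0 ?powR_gt0 ?mE ?uE ?rE ?TE ?expR_gt0.
rewrite -zn; apply: (@le_trans _ _ (B * (nu / n * z + (1 - nu / n)))).
  by rewrite ler_pM2l.
have zE' : nu * T `^ (nu - 1) * T' * r `^ (n - nu) = nu * (z * (T `^ nu * r `^ (n - nu - 1))).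
  by rewrite -zE !mulrA.
move: young; set K := (X in X <= _); set S := (X in _ <= X) => young.
rewrite zE' -subr_ge0.
rewrite (_ : _ - _ = m `^ (1 - nu / n) / n * (a * (S - K))).
  rewrite mulr_ge0// ?divr_ge0 ?powR_ge0 ?(ltW n0)// mulr_ge0 ?subr_ge0//.
  by rewrite /a addr_ge0// divr_ge0 ?mulr_ge0 ?ltW.
have key (M a' Ua Ub Tn r1 r2 z' S' : R) :
    M / n * (a' * Ub * - g * (Tn * r1) +
      Ua * (nu * (z' * (Tn * r2)) + Tn * ((n - nu) * r2)) + a' * S') -
    M * (Ua * Tn * r2) * (nu / n * z' + (1 - nu / n)) =
    M / n * (a' * (S' - Ub * g * (Tn * r1))) by field.
exact: key.
Qed.

(** With the extremal [h = X^(-d/(nu p))], [f0] is its mass density [y^(n-1) h^q]. If [H] is a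
    primitive of [f0], then [W H] is a primitive of [kap^(-p) y^(d+p-1) |h'|^p]: integration by
    parts expresses the energy of [h] by its mass and a boundary term. *)
Let X (y : R) := 1 + y `^ (nu * p').
Let f0 (y : R) := y `^ (n - 1) * X y `^ (- (n / nu)).
Let W (H : R -> R) (y : R) := (p - 1) / d * (n * H y - y `^ n * X y `^ (1 - n / nu)).

Let X1 (y : R) : 1 <= X y. Proof. by rewrite /X lerDl powR_ge0. Qed.
Let X0 (y : R) : 0 < X y. Proof. exact: lt_le_trans ltr01 (X1 y). Qed.

Let dX (y s : R) : 0 < y -> is_derive y 1 (fun y => X y `^ s)
  (s * X y `^ (s - 1) * (nu * p' * y `^ (nu * p' - 1))).
Proof. exact: is_derive_1D_powR. Qed.

Let f0_gt0 (y : R) : 0 < y -> 0 < f0 y.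
Proof. by move=> y0; rewrite mulr_gt0 ?powR_gt0. Qed.

Lemma bliss_tail_le (y : R) : 0 < y -> f0 y <= y `^ (- (n / (p - 1)) - 1).
Proof.
move=> y0.
apply: (@le_trans _ _ (y `^ (n - 1) * (y `^ (nu * p')) `^ (- (n / nu)))).
  rewrite ler_pM2l ?powR_gt0// powRN [leRHS]powRN lef_pV2 ?posrE ?powR_gt0//.
  apply: ge0_ler_powR; rewrite ?nnegrE ?powR_ge0 ?(ltW (X0 _))//.
    by rewrite divr_ge0 ?ltW.
  by rewrite lerDr.
rewrite -powRrM -gt0_powRD//.
rewrite le_eqVlt; apply/orP; left; apply/eqP; congr (_ `^ _).
by rewrite /p' /n; field; rewrite !gt_eqF.
Qed.

Lemma bliss_weight_le (y : R) : 0 < y ->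
  y `^ n * X y `^ (1 - n / nu) <= y `^ (- (d / (p - 1))).
Proof.
move=> y0.
apply: (@le_trans _ _ (y `^ n * (y `^ (nu * p')) `^ (1 - n / nu))).
  rewrite ler_pM2l ?powR_gt0// -opprB powRN [leRHS]powRN lef_pV2 ?posrE ?powR_gt0//.
  apply: ge0_ler_powR; rewrite ?nnegrE ?powR_ge0 ?(ltW (X0 _))//.
    by rewrite subr_ge0 ler_pdivlMr// mul1r ltW.
  by rewrite lerDr.
rewrite -powRrM -gt0_powRD//.
rewrite le_eqVlt; apply/orP; left; apply/eqP; congr (_ `^ _).
by rewrite /p' /n; field; rewrite !gt_eqF.
Qed.

Lemma bliss_W_derive H (y : R) : 0 < y -> is_derive y 1 H (f0 y) ->
  is_derive y 1 (W H) (y `^ (n - 1 + nu * p') * X y `^ (- (n / nu))).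
Proof.
move=> y0 dH.
have dP : is_derive y 1 (fun y => y `^ n * X y `^ (1 - n / nu))
   (y `^ n * ((1 - n / nu) * X y `^ (1 - n / nu - 1) * (nu * p' * y `^ (nu * p' - 1)))
    + X y `^ (1 - n / nu) * (n * y `^ (n - 1))).
  have := @is_deriveM _ _ (@powR R ^~ n) (fun y => X y `^ (1 - n / nu)) y 1 _ _
    (is_derive1_powR _ y0) (dX _ y0).
  by rewrite /GRing.scale/=.
have dd : is_derive y 1 (W H) ((p - 1) / d * (n * f0 y -
   (y `^ n * ((1 - n / nu) * X y `^ (1 - n / nu - 1) * (nu * p' * y `^ (nu * p' - 1)))
    + X y `^ (1 - n / nu) * (n * y `^ (n - 1))))).
  exact: (is_deriveZ _ (is_deriveB (is_deriveZ _ dH) dP)).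
apply: (is_derive_eq dd).
rewrite /f0.
have -> : X y `^ (1 - n / nu - 1) = X y `^ (- (n / nu)) by congr (_ `^ _); ring.
have -> : X y `^ (1 - n / nu) = X y * X y `^ (- (n / nu)).
  by rewrite gt0_powRD// powRr1// ltW.
have -> : y `^ n = y `^ (n - 1) * y.
  by rewrite -[X in _ * X]powRr1 ?ltW// -gt0_powRD// subrK.
have -> : y `^ (n - 1 + nu * p') = y `^ (n - 1) * y `^ (nu * p').
  exact: gt0_powRD.
have yy : y * y `^ (nu * p' - 1) = y `^ (nu * p').
  by rewrite mulr_powRB1 ?ltW// mulr_gt0.
rewrite [LHS](_ : _ = (p - 1) / d * (n - (y * y `^ (nu * p' - 1)) * ((nu - n) * p') - n * X y)
   * (y `^ (n - 1) * X y `^ (- (n / nu)))); last first.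
  by field; rewrite !gt_eqF.
rewrite yy /X /p' /n.
field.
by rewrite !gt_eqF.
Qed.

(** The total mass [Hoo] is taken as the supremum of [H]. The rate of convergence comes from the
    power bound on [f0]: adding to [H] the integral of that bound over the tail gives a
    nonincreasing function. *)
Lemma bliss_mass_exists : 1 <= n -> exists (H : R -> R) (Hoo : R),
  [/\ forall y : R, 0 < y -> is_derive y 1 H (f0 y),
      H y @[y --> 0^'+] --> 0,
      forall y, 0 < y -> 0 < H y,
      forall y, 0 < y -> H y <= Hoo &
      forall y, 0 < y -> Hoo - H y <= (p - 1) / n * y `^ (- (n / (p - 1)))].
Proof.
move=> n1.
have cf0 (y : R) : 0 < y -> {for y, continuous f0}.
  move=> y0; apply: continuousM; first exact: powR_continuous.
  by apply: is_derive_continuous; exact: dX.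
have [|||H [dH H0 _]] := @ge0_antiderivative R f0.
- by move=> y /f0_gt0/ltW.
- exact: cf0.
- move=> b; exists (b `^ (n - 1)) => x /andP[x0 xb].
  rewrite /f0 -[leRHS]mulr1; apply: ler_pM; rewrite ?powR_ge0//.
    by apply: ge0_ler_powR; rewrite ?nnegrE ?subr_ge0// ltW// (lt_trans x0).
  rewrite powRN invf_le1 ?powR_gt0// -[leLHS](powRr0 (X x)).
  by apply: ler_powR => //; rewrite divr_ge0 ?ltW.
have Hlt (x y : R) : 0 < x -> x < y -> H x < H y.
  move=> x0 xy; apply: (@oo_derive_gt0 _ _ f0 0 (y + 1)) => //; last by rewrite ltrDl.
    by move=> z /andP[z0 _]; exact: dH.
  by move=> z /andP[z0 _]; exact: f0_gt0.
have Hgt0 (y : R) : 0 < y -> 0 < H y.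
  move=> y0; apply: (@le_lt_trans _ _ (H (y / 2))); last first.
    by apply: Hlt; [exact: divr_gt0|rewrite ltr_pdivrMr// ltr_pMr// ltr1n].
  apply: (cvgr_to_le H0); near=> x; apply/ltW/Hlt => //.
  by near: x; apply: nbhs_right_lt; exact: divr_gt0.
pose c := (p - 1) / n; pose s := n / (p - 1).
have s0 : 0 < s by rewrite divr_gt0.
(* As [c * s = 1], [c y^(-s)] is the integral of [t^(-s-1)] over [t > y]; thus [D] is nonincreasing,
   and every value of [D] lies above every value of [H]. *)
pose D (y : R) := c * y `^ (- s) - - H y.
have Dle (x y : R) : 0 < x -> x <= y -> D y <= D x.
  move=> x0 xy.
  have dD (z : R) : 0 < z < y + 1 ->
      is_derive z 1 (fun y => - (c * y `^ (- s)) - H y) (- (c * (- s * z `^ (- s - 1))) - f0 z).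
    move=> /andP[z0 _]; apply: is_deriveB; last exact: dH.
    by apply: is_deriveN; apply: is_deriveZ; exact: is_derive1_powR.
  have D'0 (z : R) : 0 < z < y + 1 -> 0 <= - (c * (- s * z `^ (- s - 1))) - f0 z.
    move=> /andP[z0 _]; have := bliss_tail_le z0; rewrite -/s => h.
    rewrite (_ : c * (- s * z `^ (- s - 1)) = - z `^ (- s - 1)); first by lra.
    by rewrite /c /s; field; rewrite !gt_eqF.
  have yy : y < y + 1 by rewrite ltrDl.
  have := oo_derive_ge0 dD D'0 x0 xy yy; rewrite /D; lra.
have HD (x y : R) : 0 < x -> 0 < y -> H x <= D y.
  move=> x0 y0; have c0 (z : R) : 0 <= c * z `^ (- s) by rewrite mulr_ge0 ?powR_ge0// divr_ge0 ?ltW.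
  have HDx (z : R) : H z <= D z by rewrite /D; have := c0 z; lra.
  have [xy|xy] := leP y x.
    exact: le_trans (HDx x) (Dle _ _ y0 xy).
  by apply: le_trans (HDx y); apply/ltW/Hlt.
pose A := [set H y | y in [set y | 0 < y]].
have supA : has_sup A.
  split; first by exists (H 1), 1 => //=.
  by exists (D 1) => _ [y y0 <-]; exact: HD.
exists H, (sup A); split => //.
- by move=> y y0; apply: sup_upper_bound => //; exists y.
- move=> y y0; rewrite lerBlDr; apply: (@le_trans _ _ (D y)); last by rewrite /D opprK.
  by apply: ge_sup; [exact: supA.1|move=> _ [x x0 <-]; exact: HD].
Unshelve. all: by end_near. Qed.

(* [T] transports the mass [U] of [u] onto the mass [H] of the extremal: [H (T x) = H Y / B * U x].
   The integral of the pointwise inequality telescopes, [E] being a primitive of the difference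
   of its two sides. The truncation at [Y] keeps all limits finite. *)
Lemma transport_le (H u g U G : R -> R) (M A B Y de : R) :
  (forall y : R, 0 < y -> is_derive y 1 H (f0 y)) ->
  H y @[y --> 0^'+] --> 0 -> (forall y : R, 0 < y -> 0 < H y) ->
  (forall x : R, 0 < x < 1 -> [/\ is_derive x 1 u (- g x), 0 < u x, u x <= M & 0 < g x]) ->
  u x @[x --> 1^'-] --> 0 ->
  (forall x : R, 0 < x < 1 -> is_derive x 1 U (x `^ (n - 1) * u x `^ q)) ->
  U x @[x --> 0^'+] --> 0 -> U x @[x --> 1^'-] --> B ->
  (forall x : R, 0 < x < 1 -> is_derive x 1 G (x `^ (d + p - 1) * g x `^ p)) ->
  G x @[x --> 0^'+] --> 0 -> G x @[x --> 1^'-] --> A ->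
  0 < Y -> 0 < de ->
  0 < B /\
  H Y + W H Y <= (H Y / B) `^ (1 - nu / n) / n *
    (a * (de `^ p / p * A + de `^ (- p') / (p' * (H Y / B)) * W H Y)).
Proof.
move=> dH H0 Hgt0 ug u1 dU U0 U1 dG G0 G1 Y0 de0.
have Hlt (x y : R) : 0 < x -> x < y -> H x < H y.
  move=> x0 xy; apply: (@oo_derive_gt0 _ _ f0 0 (y + 1)) => //; last by rewrite ltrDl.
    by move=> z /andP[z0 _]; exact: dH.
  by move=> z /andP[z0 _]; exact: f0_gt0.
have Hle (x y : R) : 0 < x -> x <= y -> H x <= H y.
  by move=> x0; rewrite le_eqVlt => /predU1P[->//|/(Hlt _ _ x0)/ltW].
have Hinj (x y : R) : 0 < x -> 0 < y -> H x = H y -> x = y.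
  move=> x0 y0 Hxy; apply/eqP; rewrite eq_le !leNgt; apply/andP; split; apply/negP.
    by move=> /(Hlt _ _ y0); rewrite Hxy ltxx.
  by move=> /(Hlt _ _ x0); rewrite Hxy ltxx.
have Ult (x y : R) : 0 < x -> x < y -> y < 1 -> U x < U y.
  apply: (oo_derive_gt0 dU) => z z01; have [_ uz _ _] := ug _ z01.
  by have /andP[z0 _] := z01; rewrite mulr_gt0 ?powR_gt0.
have Ugt0 (x : R) : 0 < x -> x < 1 -> 0 < U x.
  move=> x0 x1; apply: (@le_lt_trans _ _ (U (x / 2))); last first.
    by apply: Ult; [exact: divr_gt0|rewrite ltr_pdivrMr// ltr_pMr// ltr1n|].
  apply: (cvgr_to_le U0); near=> z; apply/ltW/Ult => //.
    by near: z; apply: nbhs_right_lt; exact: divr_gt0.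
  by rewrite (lt_trans _ x1)// ltr_pdivrMr// ltr_pMr// ltr1n.
have UltB (x : R) : 0 < x -> x < 1 -> U x < B.
  move=> x0 x1; have xm : x < (x + 1) / 2 by lra.
  have m1 : (x + 1) / 2 < 1 by lra.
  apply: (@lt_le_trans _ _ (U ((x + 1) / 2))); first exact: Ult.
  apply: (cvgr_to_ge U1); near=> z; by apply/ltW/Ult => //; lra.
have B0 : 0 < B.
  have [h1 h2] : 0 < 2^-1 :> R /\ 2^-1 < 1 :> R by split; lra.
  exact: lt_trans (Ugt0 _ h1 h2) (UltB _ h1 h2).
split => //.
set m := H Y / B; have m0 : 0 < m by rewrite divr_gt0// Hgt0.
(* [K] is the inverse of [H] on the positive axis; the default 0 of [xget] is not met, as [m * U x]
   lies strictly between 0 and [H Y] for 0 < x < 1. *)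
pose K (v : R) := xget 0 [set y | 0 < y /\ H y = v].
have KH (y : R) : 0 < y -> K (H y) = y.
  move=> y0; rewrite /K; case: xgetP => [z _ [z0 /(Hinj _ _ z0 y0)]//|].
  by move=> /(_ y)/not_andP[].
have Hc (y : R) : 0 < y -> {for y, continuous H}.
  by move=> /dH; exact: is_derive_continuous.
pose T (x : R) := K (m * U x).
have TP (x : R) : 0 < x < 1 -> [/\ 0 < T x, T x < Y & H (T x) = m * U x].
  move=> /andP[x0 x1].
  have mU0 : 0 < m * U x by rewrite mulr_gt0// Ugt0.
  have mUY : m * U x < H Y.
    by rewrite /m mulrAC ltr_pdivrMr// ltr_pM2l ?Hgt0// UltB.
  have [y0 [y00 y0Y Hy0]] : exists y0 : R, [/\ 0 < y0, y0 < Y & H y0 < m * U x].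
    have := cvgr_lt _ H0 _ mU0 => hH.
    near (0:R)^'+ => z; exists z; split => //; near: z => //.
    exact: hH.
  have [||c] := @IVT _ H y0 Y (m * U x) (ltW y0Y).
  - apply: continuous_in_subspaceT => z; rewrite inE/= in_itv/= => /andP[z0 _].
    by apply: Hc; exact: lt_le_trans z0.
  - by rewrite min_l ?max_r ?(ltW Hy0) ?(ltW mUY)// ltW// Hlt.
  rewrite in_itv/= => /andP[y0c cY] Hc'.
  have c0 : 0 < c by exact: lt_le_trans y0c.
  have Tc : T x = c by rewrite /T -Hc' KH.
  rewrite Tc; split => //; rewrite lt_neqAle cY andbT.
  by apply: contraTneq mUY => cYe; rewrite -Hc' cYe ltxx.
pose T' (x : R) := m * (x `^ (n - 1) * u x `^ q) / (T x `^ (n - 1) * X (T x) `^ (- (n / nu))).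
have dT (x : R) : 0 < x < 1 -> is_derive x 1 T (T' x).
  move=> x01; have [T0 TY HT] := TP _ x01.
  have dK : is_derive (m * U x) 1 K (f0 (T x))^-1.
    rewrite -HT; apply: (is_derive_inverse _ _ (dH _ T0)).
    - near=> z; apply: KH; near: z; exact: lt_nbhsr.
    - near=> z; apply: Hc; near: z; exact: lt_nbhsr.
    - by rewrite gt_eqF// f0_gt0.
  rewrite /T' mulrC.
  by apply: (@is_derive1_comp _ K (fun x => m * U x)) dK _; exact: (is_deriveZ _ (dU _ x01)).
pose c := m `^ (1 - nu / n) / n.
pose e1 := de `^ p / p; pose e2 := de `^ (- p') / (p' * m).
pose E (x : R) := c * (u x `^ a * (T x `^ nu * x `^ (n - nu)) +
  a * (e1 * G x + e2 * W H (T x))) - (H (T x) + W H (T x)).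
pose Wd (y : R) := y `^ (n - 1 + nu * p') * X y `^ (- (n / nu)).
pose E' (x : R) :=
  c * (a * u x `^ (a - 1) * (- g x) * (T x `^ nu * x `^ (n - nu)) +
    u x `^ a * (nu * T x `^ (nu - 1) * T' x * x `^ (n - nu) +
              T x `^ nu * ((n - nu) * x `^ (n - nu - 1))) +
    a * (e1 * (x `^ (d + p - 1) * g x `^ p) + e2 * (Wd (T x) * T' x))) -
   (f0 (T x) * T' x + Wd (T x) * T' x).
have dE (x : R) : 0 < x < 1 -> is_derive x 1 E (E' x).
  move=> x01; have [T0 TY HT] := TP _ x01.
  have [du ux0 _ gx0] := ug _ x01; have /andP[x0 x1] := x01.
  have dua : is_derive x 1 (fun x => u x `^ a) (a * u x `^ (a - 1) * (- g x)).
    by apply: (@is_derive1_comp _ (@powR R ^~ a) u); exact: is_derive1_powR.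
  have dTn : is_derive x 1 (fun x => T x `^ nu) (nu * T x `^ (nu - 1) * T' x).
    by apply: (@is_derive1_comp _ (@powR R ^~ nu) T); [exact: is_derive1_powR|exact: dT].
  have dxn : is_derive x 1 (@powR R ^~ (n - nu)) ((n - nu) * x `^ (n - nu - 1)).
    exact: is_derive1_powR.
  have dHT : is_derive x 1 (fun x => H (T x)) (f0 (T x) * T' x).
    by apply: (@is_derive1_comp _ H T); [exact: dH|exact: dT].
  have dWT : is_derive x 1 (fun x => W H (T x)) (Wd (T x) * T' x).
    exact: (@is_derive1_comp _ (W H) T x (Wd (T x)) (T' x)
      (bliss_W_derive T0 (dH _ T0)) (dT _ x01)).
  have := is_deriveB (is_deriveZ c (is_deriveD (is_deriveM dua (is_deriveM dTn dxn))
    (is_deriveZ a (is_deriveD (is_deriveZ e1 (dG _ x01)) (is_deriveZ e2 dWT)))))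
    (is_deriveD dHT dWT).
  rewrite /GRing.scale/= => dE; apply: (is_derive_eq dE).
  rewrite [X in c * (_ + X * _ + _)](_ : _ = T x `^ nu * x `^ (n - nu))//.
  by rewrite /E'; ring.
have E'0 (x : R) : 0 < x < 1 -> 0 <= E' x.
  move=> x01; have [T0 TY HT] := TP _ x01.
  have [du ux0 _ gx0] := ug _ x01; have /andP[x0 x1] := x01.
  have := @transport_pointwise x (u x) (g x) (T x) (X (T x)) de m (T' x)
    x0 ux0 gx0 T0 (X0 _) de0 m0 erefl.
  rewrite -subr_ge0 /E' -/c -/e1 -/e2 -/(Wd (T x)) => h.
  apply: le_trans h _; rewrite lerB//.
  (* By the choice of [T], [f0 (T x) * T' x] is the transported mass density, and
     [Wd = f0 * y^(nu p')]; the two terms add up to that density times [X (T x)]. *)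
  rewrite le_eqVlt; apply/orP; left; apply/eqP.
  have -> : Wd (T x) = f0 (T x) * T x `^ (nu * p').
    by rewrite /Wd /f0 [T x `^ (_ + nu * p')]gt0_powRD//; ring.
  have -> : T' x = m * (x `^ (n - 1) * u x `^ q) / f0 (T x) by [].
  by rewrite /X; field; rewrite gt_eqF// f0_gt0.
have limT0 : T x @[x --> 0^'+] --> 0.
  apply/cvgrPdist_lt => /= e e0.
  have e'0 : 0 < H e / m by rewrite divr_gt0// Hgt0.
  near=> x.
  have x01 : 0 < x < 1 by apply/andP; split => //; near: x; exact: nbhs_right_lt.
  have [T0 TY HT] := TP _ x01.
  rewrite sub0r normrN gtr0_norm// ltNge; apply/negP => /(Hle _ _ e0).
  rewrite HT leNgt => /negP; apply; rewrite mulrC -ltr_pdivlMr//.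
  by near: x; exact: cvgr_lt U0 _ e'0.
have limT1 : T x @[x --> 1^'-] --> Y.
  apply/cvgrPdist_lt => /= e e0.
  pose e1' := Num.max (Y - e) (Y / 2).
  have [e1Y e10] : e1' < Y /\ 0 < e1'.
    by rewrite gt_max lt_max divr_gt0// orbT ltr_pdivrMr// ltr_pMr// ltr1n ltrBlDr ltrDl e0.
  have e'B : H e1' / m < B by rewrite ltr_pdivrMr// /m mulrC divfK ?gt_eqF// Hlt.
  near=> x.
  have x01 : 0 < x < 1.
    by apply/andP; split => //; near: x; apply: nbhs_left_gt.
  have [T0 TY HT] := TP _ x01.
  rewrite gtr0_norm ?subr_gt0// ltrBlDr -ltrBlDl.
  apply: (@le_lt_trans _ _ e1'); first by rewrite le_max lexx.
  rewrite ltNge; apply/negP => /(Hle _ _ T0).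
  rewrite HT leNgt => /negP; apply; rewrite mulrC -ltr_pdivrMr//.
  by near: x; exact: cvgr_gt U1 _ e'B.
have near01r : \forall x \near (0:R)^'+, 0 < x < 1.
  by near=> x; apply/andP; split => //; near: x; exact: nbhs_right_lt.
have near01l : \forall x \near (1:R)^'-, 0 < x < 1.
  by near=> x; apply/andP; split => //; near: x; exact: nbhs_left_gt.
have limHT0 : H (T x) @[x --> 0^'+] --> 0.
  rewrite -[X in _ --> X](mulr0 m); apply: (@cvg_trans _ (m * U x @[x --> 0^'+])).
    by apply: near_eq_cvg; apply: filterS near01r => x /TP[_ _ ->].
  exact: cvgMr.
have limHT1 : H (T x) @[x --> 1^'-] --> H Y.
  rewrite (_ : H Y = m * B); last by rewrite /m divfK ?gt_eqF.
  apply: (@cvg_trans _ (m * U x @[x --> 1^'-])).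
    by apply: near_eq_cvg; apply: filterS near01l => x /TP[_ _ ->].
  exact: cvgMr.
have limWT0 : W H (T x) @[x --> 0^'+] --> 0.
  rewrite [X in _ --> X](_ : 0 = (p - 1) / d * (n * 0 - 0)); last by ring.
  apply: cvgMr; apply: cvgB; first exact: cvgMr.
  apply: (@squeeze_cvgr _ _ _ _ (fun=> 0) (fun x => T x `^ n)).
  - apply: filterS near01r => x /TP[T0 _ _].
    rewrite mulr_ge0 ?powR_ge0//= ler_piMr ?powR_ge0//.
    rewrite -opprB powRN invf_le1 ?powR_gt0// -[leLHS](powRr0 (X (T x))).
    by apply: ler_powR => //; rewrite subr_ge0 ler_pdivlMr// mul1r ltW.
  - exact: cvg_cst.
  - by apply: gt0_cvg_powR => //; apply: filterS near01r => x /TP[].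
have limWT1 : W H (T x) @[x --> 1^'-] --> W H Y.
  apply: (@cvg_comp _ _ _ T (W H) _ _ _ limT1).
  exact: (is_derive_continuous (bliss_W_derive Y0 (dH _ Y0))).
have Tnu x : 0 < x < 1 -> T x `^ nu <= Y `^ nu.
  move=> /TP[T0 TY _].
  by apply: ge0_ler_powR; rewrite ?nnegrE ?(ltW nu0) ?(ltW T0) ?(ltW Y0) ?(ltW TY).
have a0 : 0 < a by rewrite /a addr_gt0// divr_gt0// mulr_gt0.
(* The boundary term [u^a T^nu x^(n-nu)] vanishes at 0 because [u <= M] and [nu < n], and at 1
   because [u] tends to 0 while [T] stays below [Y]. *)
have limE0 : E x @[x --> 0^'+] --> 0.
  rewrite [X in _ --> X](_ : 0 = c * (0 + a * (e1 * 0 + e2 * 0)) - (0 + 0)); last by ring.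
  apply: cvgB; last exact: cvgD.
  apply: cvgMr; apply: cvgD; last first.
    by apply: cvgMr; apply: cvgD; exact: cvgMr.
  apply: (@squeeze_cvgr _ _ _ _ (fun=> 0) (fun x => M `^ a * (Y `^ nu * x `^ (n - nu)))).
  - apply: filterS near01r => x x01; have [_ ux0 uM _] := ug _ x01.
    rewrite !mulr_ge0 ?powR_ge0//=; apply: ler_pM; rewrite ?mulr_ge0 ?powR_ge0//.
      by apply: ge0_ler_powR; rewrite ?nnegrE ?(ltW a0) ?(ltW ux0)// (le_trans (ltW ux0)).
    by apply: ler_pM; rewrite ?powR_ge0// Tnu.
  - exact: cvg_cst.
  - rewrite [X in _ --> X](_ : 0 = M `^ a * (Y `^ nu * 0)); last by ring.
    by apply: cvgMr; apply: cvgMr; apply: powR_cvg0; rewrite subr_gt0.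
have limE1 : E x @[x --> 1^'-] --> c * (a * (e1 * A + e2 * W H Y)) - (H Y + W H Y).
  rewrite -[a * _ in X in _ --> X]add0r.
  apply: cvgB; last exact: cvgD.
  apply: cvgMr; apply: cvgD; last first.
    by apply: cvgMr; apply: cvgD; exact: cvgMr.
  apply: (@squeeze_cvgr _ _ _ _ (fun=> 0) (fun x => u x `^ a * Y `^ nu)).
  - apply: filterS near01l => x x01; have [_ ux0 uM _] := ug _ x01.
    rewrite !mulr_ge0 ?powR_ge0//=; apply: ler_pM; rewrite ?mulr_ge0 ?powR_ge0//.
    rewrite -[leRHS]mulr1; apply: ler_pM; rewrite ?powR_ge0 ?Tnu//.
    have /andP[x0 x1] := x01; rewrite -[leRHS](one_powR (n - nu)).
    by apply: ge0_ler_powR; rewrite ?nnegrE ?subr_ge0 ?(ltW nnu) ?ltW.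
  - exact: cvg_cst.
  - rewrite -[X in _ --> X](mul0r (Y `^ nu)); apply: cvgMl.
    by apply: gt0_cvg_powR => //; apply: filterS near01l => x /ug[].
rewrite -subr_ge0.
exact: (oo_derive_limits ltr01 dE E'0 limE0 limE1).
Unshelve. all: by end_near.
Qed.

(** As [Y] tends to infinity, [H] and [W H] tend to [Hoo] and [(p-1) n / d * Hoo], and the best [de]
    leaves a power of [A] against a power of [B]. The base of the negative power is the energy of
    the extremal on the half-line, so the constant is the extremal's own quotient, mass over energy
    to the power q/p. *)
Lemma bliss_continuous (H u g U G : R -> R) (Hoo M A B : R) :
  (forall y : R, 0 < y -> is_derive y 1 H (f0 y)) ->
  H y @[y --> 0^'+] --> 0 -> (forall y : R, 0 < y -> 0 < H y) ->
  (forall y : R, 0 < y -> H y <= Hoo) ->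
  (forall y : R, 0 < y -> Hoo - H y <= (p - 1) / n * y `^ (- (n / (p - 1)))) ->
  (forall x : R, 0 < x < 1 -> [/\ is_derive x 1 u (- g x), 0 < u x, u x <= M & 0 < g x]) ->
  u x @[x --> 1^'-] --> 0 ->
  (forall x : R, 0 < x < 1 -> is_derive x 1 U (x `^ (n - 1) * u x `^ q)) ->
  U x @[x --> 0^'+] --> 0 -> U x @[x --> 1^'-] --> B ->
  (forall x : R, 0 < x < 1 -> is_derive x 1 G (x `^ (d + p - 1) * g x `^ p)) ->
  G x @[x --> 0^'+] --> 0 -> G x @[x --> 1^'-] --> A -> 0 < A ->
  B <= Hoo * (kap `^ p * ((p - 1) * n / d * Hoo)) `^ (- (q / p)) * A `^ (q / p).
Proof.
move=> dH H0 Hgt0 HHoo Htail ug u1 dU U0 U1 dG G0 G1 A0.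
have key Y de : 0 < Y -> 0 < de -> 0 < B /\
  H Y + W H Y <= (H Y / B) `^ (1 - nu / n) / n *
    (a * (de `^ p / p * A + de `^ (- p') / (p' * (H Y / B)) * W H Y)).
  exact: (transport_le dH H0 Hgt0 ug u1 dU U0 U1 dG G0 G1).
have [B0 _] := key 1 1 ltr01 ltr01.
have Hoo0 : 0 < Hoo by exact: lt_le_trans (Hgt0 _ ltr01) (HHoo _ ltr01).
set Woo := (p - 1) * n / d * Hoo.
have Woo0 : 0 < Woo by rewrite mulr_gt0// divr_gt0// mulr_gt0.
have limH : H y @[y --> +oo] --> Hoo.
  apply: (@squeeze_cvgr _ _ _ _ (fun y => Hoo - (p - 1) / n * y `^ (- (n / (p - 1)))) (cst Hoo)).
  - near=> y; have y0 : 0 < y by [].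
    by rewrite HHoo// andbT lerBlDr -lerBlDl Htail.
  - rewrite -[X in _ --> X]subr0; apply: cvgB; first exact: cvg_cst.
    rewrite -[X in _ --> X](mulr0 ((p - 1) / n)); apply: cvgMr.
    by apply: powRN_cvgy; rewrite divr_gt0.
  - exact: cvg_cst.
have limW : W H y @[y --> +oo] --> Woo.
  rewrite (_ : Woo = (p - 1) / d * (n * Hoo - 0)); last by rewrite /Woo; ring.
  apply: cvgMr; apply: cvgB; first exact: cvgMr.
  apply: (@squeeze_cvgr _ _ _ _ (cst 0) (fun y => y `^ (- (d / (p - 1))))).
  - near=> y; have y0 : 0 < y by [].
    by rewrite mulr_ge0 ?powR_ge0//= bliss_weight_le.
  - exact: cvg_cst.
  - by apply: powRN_cvgy; rewrite divr_gt0.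
set m := Hoo / B; have m0 : 0 < m by rewrite divr_gt0.
have limm : H y / B @[y --> +oo] --> m by exact: cvgMl.
have [lm mE] := expR_surj m0; have [lA AE] := expR_surj A0.
have [lW WE] := expR_surj Woo0.
(* The value of [de] balancing the two terms on the right-hand side. *)
pose de := expR ((lW - lm - lA) / (p * p')).
have de0 : 0 < de by exact: expR_gt0.
have : Hoo + Woo <= m `^ (1 - nu / n) / n *
    (a * (de `^ p / p * A + de `^ (- p') / (p' * m) * Woo)).
  apply: (@ler_cvg_to _ (+oo : set_system R) _ _ (fun y => H y + W H y)
    (fun y => (H y / B) `^ (1 - nu / n) / n *
    (a * (de `^ p / p * A + de `^ (- p') / (p' * (H y / B)) * W H y)))).
  - exact: cvgD.
  - apply: cvgM.
      apply: cvgMl; apply: (@cvg_comp _ _ _ (fun y => H y / B) (@powR R ^~ (1 - nu / n)) _ _ _ limm).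
      exact: powR_continuous.
    apply: cvgMr; apply: cvgD; first exact: cvg_cst.
    apply: cvgM => //; apply: cvgMr; apply: cvgV; last exact: cvgMr.
    by rewrite mulf_neq0 ?gt_eqF.
  - by near=> y; have y0 : 0 < y by []; have [_] := key y de y0 de0.
have -> : Hoo + Woo = a * Hoo by rewrite /Woo /a; ring.
have dn0 : d != 0 by rewrite gt_eqF. have pn0 : p != 0 by rewrite gt_eqF.
have pm0 : p - 1 != 0 by rewrite gt_eqF. have nn0 : n != 0 by rewrite gt_eqF.
have p'n0 : p' != 0 by rewrite gt_eqF.
have E := @expR_powR R.
set Q := de `^ p * A.
have QE : de `^ (- p') * m^-1 * Woo = Q.
  rewrite /Q mE AE WE /de !E -expRN -!expRD; congr expR.
  by rewrite /p'; field; rewrite pm0 pn0.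
have -> : de `^ (- p') / (p' * m) * Woo = Q / p'.
  by rewrite -QE; field; rewrite p'n0 gt_eqF.
have -> : m `^ (1 - nu / n) / n * (a * (de `^ p / p * A + Q / p')) =
    a * (m `^ (1 - nu / n) / n * Q).
  by rewrite /Q /p'; field; rewrite pn0 pm0 nn0.
rewrite ler_pM2l; last by rewrite /a addr_gt0// divr_gt0// mulr_gt0.
have kap0 : 0 < kap by rewrite /kap divr_gt0.
have [lk kE] := expR_surj kap0; have [lH HE] := expR_surj Hoo0.
have HooE : Hoo = kap * Woo / n by rewrite /Woo /kap; field; rewrite dn0 pm0 nn0.
rewrite [X in X <= _ -> _]HooE [X in _ <= X -> _]mulrAC ler_pM2r ?invr_gt0//.
rewrite /Q kE WE mE AE /de !E -!expRD ler_expR => ineq.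
have -> : B = Hoo / m by rewrite /m; field; rewrite !gt_eqF.
rewrite HE mE !E -expRN -!expRD ler_expR.
rewrite -subr_ge0.
(* Both inequalities are now linear in the logarithms; [q] times the first is the second. *)
move: ineq; rewrite -subr_ge0 => /(mulr_ge0 (ltW q0)).
congr (0 <= _).
by rewrite /q /p' /n; field; rewrite -/n dn0 pn0 pm0 nn0.
Unshelve. all: by end_near.
Qed.

End bliss.

(** * Integral inequalities: comparison, tangent lines, Hoelder *)

Section integrals.
Context {R : realType}.
Local Notation mu := (@lebesgue_measure R).
Implicit Types (f g u v : R -> R) (a b x y s t : R).

(** The integral of a nonnegative function is a supremum over the simple functions below it, and
    every simple function below [f1] is below [f2]. *)
Lemma le_integral_nonmeasurable (D : set R) (f1 f2 : R -> \bar R) :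
  (forall x, D x -> 0 <= f1 x)%E -> (forall x, D x -> f1 x <= f2 x)%E ->
  (\int[mu]_(x in D) f1 x <= \int[mu]_(x in D) f2 x)%E.
Proof.
move=> f10 f12; have f20 x : D x -> (0 <= f2 x)%E.
  by move=> Dx; apply: le_trans (f10 _ Dx) (f12 _ Dx).
rewrite !ge0_integralE//; apply: ereal_sup_le => _ [h hf <-].
exists h => // x; apply: le_trans (hf x) _.
by rewrite /patch; case: ifPn => // /set_mem; exact: f12.
Qed.

(** Convexity of the s-th power: its graph lies above the tangent at [b], which is Young's
    inequality for [b^(s-1)] and [a] with exponents s/(s-1) and s. *)
Lemma powR_tangent_le a b K s : 1 < s -> 0 <= a -> 0 <= b -> b <= K ->
  b `^ s <= a `^ s + s * K `^ (s - 1) * `|b - a|.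
Proof.
move=> s1 a0 b0 bK; have s0 : 0 < s by exact: lt_trans ltr01 s1.
have s10 : 0 < s - 1 by rewrite subr_gt0.
have [ab|ba] := leP a b; last first.
  apply: (@le_trans _ _ (a `^ s)); last first.
    by rewrite lerDl !mulr_ge0 ?powR_ge0 ?(ltW s0).
  by apply: ge0_ler_powR; rewrite ?nnegrE ?(ltW s0)// ltW.
rewrite ger0_norm ?subr_ge0//.
apply: (@le_trans _ _ (a `^ s + s * b `^ (s - 1) * (b - a))); last first.
  rewrite lerD2l; apply: ler_wpM2r; first by rewrite subr_ge0.
  apply: ler_wpM2l; first exact: ltW.
  by apply: ge0_ler_powR; rewrite ?nnegrE ?(ltW s10)// (le_trans b0).
have := @conjugate_powR R (b `^ (s - 1)) a (s / (s - 1)) s (powR_ge0 _ _) a0.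
rewrite -powRrM (_ : (s - 1) * (s / (s - 1)) = s); last by field; rewrite gt_eqF.
move=> /(_ (divr_gt0 s0 s10) s0)/(_ _)/wrap[].
  by field; rewrite !gt_eqF.
have bE : b `^ (s - 1) * b = b `^ s by rewrite mulrC mulr_powRB1.
move=> h; have := ler_wpM2l (ltW s0) h.
rewrite mulrDr [X in _ <= X + _](_ : _ = (s - 1) * b `^ s); last first.
  by field; rewrite !gt_eqF.
rewrite [X in _ <= _ + X](_ : _ = a `^ s); last by field; rewrite !gt_eqF.
by rewrite mulrBr -!mulrA bE; lra.
Qed.

(* Hoelder's inequality, in the form obtained by integrating Young's inequality for [f / e]. *)
Lemma weighted_L1_le (D : set R) f (w p e c : R) : measurable D -> measurable_fun D f ->
  1 < p -> 0 < c -> 0 < e -> (forall x, D x -> 0 <= f x) ->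
  (forall x, D x -> c <= x `^ w) -> (mu D <= 1)%E ->
  (\int[mu]_(x in D) (x `^ w * f x `^ p)%:E <= (e `^ p)%:E)%E ->
  (\int[mu]_(x in D) (f x)%:E <= (e * (c^-1 + 1))%:E)%E.
Proof.
move=> mD mf p1 c0 e0 f0 cw mD1 fe.
have p0 : 0 < p by exact: lt_trans ltr01 p1.
have mw : measurable_fun D (fun x => x `^ w * f x `^ p).
  apply: measurable_funM.
    by apply: measurable_funS (@measurable_powR R w).
  by apply: (measurableT_comp (@measurable_powR R p)).
apply: (@le_trans _ _ (\int[mu]_(x in D)
    ((e * (c^-1 * e `^ (- p)))%:E * (x `^ w * f x `^ p)%:E + e%:E))%E).
  apply: le_integral_nonmeasurable => x Dx; first by rewrite lee_fin f0.
  rewrite -EFinM -EFinD lee_fin.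
  have pp0 : 0 < p - 1 by rewrite subr_gt0.
  have pq1 : p^-1 + (p / (p - 1))^-1 = 1 by field; rewrite !gt_eqF.
  have fe0 : 0 <= f x / e by rewrite divr_ge0 ?f0 ?ltW.
  have := @conjugate_powR R (f x / e) 1 p (p / (p - 1)) fe0 ler01 p0 (divr_gt0 p0 pp0) pq1.
  rewrite mulr1 one_powR powRM ?f0 ?invr_ge0 ?(ltW e0)// => h.
  have {}h : f x / e <= f x `^ p * e^-1 `^ p + 1.
    apply: le_trans h _; apply: lerD.
      rewrite ler_pdivrMr// ler_peMr ?mulr_ge0 ?powR_ge0// ltW//.
    rewrite mul1r invf_le1 ?divr_gt0// ler_pdivlMr// mul1r; lra.
  rewrite ler_pdivrMr// in h; apply: le_trans h _.
  rewrite mulrDl mul1r lerD2r mulrC -!mulrA ler_pM2l//.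
  have -> : e^-1 `^ p = e `^ (- p) by rewrite -powR_inv1 ?(ltW e0)// -powRrM mulN1r.
  rewrite ler_pdivlMl// [leRHS](_ : _ = x `^ w * (f x `^ p * e `^ (- p))); last by ring.
  by apply: ler_wpM2r; [rewrite mulr_ge0 ?powR_ge0|exact: cw].
rewrite ge0_integralD//; last 3 first.
- move=> x Dx; rewrite -EFinM lee_fin; rewrite !mulr_ge0 ?invr_ge0 ?powR_ge0// ltW//.
- by apply/measurable_EFinP; apply: measurable_funM.
- by move=> x _; rewrite lee_fin ltW.
have k0 : 0 <= e * (c^-1 * e `^ (- p)).
  by rewrite !mulr_ge0 ?invr_ge0 ?powR_ge0// ltW//.
rewrite ge0_integralZl_EFin//; last 2 first.
- by move=> x Dx; rewrite lee_fin mulr_ge0 ?powR_ge0.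
- exact/measurable_EFinP.
rewrite integral_cst// mulrDr mulr1 EFinD; apply: leeD.
  apply: (@le_trans _ _ ((e * (c^-1 * e `^ (- p)))%:E * (e `^ p)%:E)%E).
    by apply: lee_wpmul2l; rewrite ?lee_fin.
  rewrite -EFinM lee_fin -!mulrA -gt0_powRD// addNr powRr0 mulr1//.
by rewrite -[leRHS]mule1; apply: lee_wpmul2l => //; rewrite lee_fin ltW.
Qed.

End integrals.

(** * The sharp inequality for continuous positive gradients *)

Section bliss_upper.
Context {R : realType} (p d nu : R).
Context (p1 : 1 < p) (d0 : 0 < d) (nu0 : 0 < nu).
Local Notation mu := (@lebesgue_measure R).

Let n := d + nu * p.
Let q := n * p / d.
Let p' := p / (p - 1).
Let kap := d / (p - 1).
Let X (y : R) := 1 + y `^ (nu * p').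
Let f0 (y : R) := y `^ (n - 1) * X y `^ (- (n / nu)).
Let I : set R := `]0, 1[%classic.

Context (n1 : 1 <= n) (a10 : 0 <= d + p - 1).
Context (H : R -> R) (Hoo : R).
Context (dH : forall y : R, 0 < y -> is_derive y 1 H (f0 y))
  (H0 : H y @[y --> 0^'+] --> 0) (Hgt0 : forall y : R, 0 < y -> 0 < H y)
  (HHoo : forall y : R, 0 < y -> H y <= Hoo)
  (Htail : forall y : R, 0 < y -> Hoo - H y <= (p - 1) / n * y `^ (- (n / (p - 1)))).

Let S := Hoo * (kap `^ p * ((p - 1) * n / d * Hoo)) `^ (- (q / p)).

Let p0 : 0 < p. Proof. exact: lt_trans ltr01 p1. Qed.
Let pp0 : 0 < p - 1. Proof. by rewrite subr_gt0. Qed.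
Let n0 : 0 < n. Proof. by rewrite /n addr_gt0// mulr_gt0. Qed.
Let q0 : 0 < q. Proof. by rewrite /q divr_gt0// mulr_gt0. Qed.
Let Hoo0 : 0 < Hoo. Proof. exact: lt_le_trans (Hgt0 ltr01) (HHoo ltr01). Qed.
Let S0 : 0 < S.
Proof.
rewrite /S mulr_gt0// powR_gt0// mulr_gt0 ?powR_gt0//; first by rewrite /kap divr_gt0.
by rewrite mulr_gt0// divr_gt0// mulr_gt0.
Qed.

(** The base point -1 lies to the left of [[0, 1]], so that [F] has a two-sided derivative at every
    point of that interval, 0 included. *)
Lemma continuous_primitive (g : R -> R) : continuous g ->
  exists F : R -> R, forall x : R, -1 < x -> is_derive x 1 F (g x).
Proof.
move=> cg; pose F y : R := \int[mu]_(t in `[-1, y]) g t.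
exists F => x x1; have xx : x < x + 1 by rewrite ltrDl.
have [||dF F'] := @continuous_FTC1_closed R g (-1) x _ xx _ x1.
- apply: continuous_compact_integrable; first exact: segment_compact.
  exact: continuous_subspaceT.
- exact: cg.
by apply: DeriveDef; [exact: dF|rewrite -derive1E; exact: F'].
Qed.

Lemma bliss_upper_continuous (g : R -> R) : continuous g -> (forall x, 0 < g x) ->
  exists (u : R -> R) (A B : R),
  [/\ forall x : R, 0 < x < 1 -> [/\ (\int[mu]_(t in `]x, 1%R[) (g t)%:E)%E = (u x)%:E,
        0 <= u x & {for x, continuous u}],
      (\int[mu]_(x in I) (x `^ (n - 1) * u x `^ q)%:E)%E = B%:E,
      (\int[mu]_(x in I) (x `^ (d + p - 1) * g x `^ p)%:E)%E = A%:E &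
      B <= S * A `^ (q / p)].
Proof.
move=> cg g0; have [F dF] := continuous_primitive cg.
have Flt (x y : R) : -1 < x -> x < y -> F x < F y.
  move=> x1 xy; apply: (@oo_derive_gt0 _ F g (-1) (y + 1)) => //; last by rewrite ltrDl.
  by move=> z /andP[z1 _]; exact: dF.
have Fle (x y : R) : -1 < x -> x <= y -> F x <= F y.
  by move=> x1; rewrite le_eqVlt => /predU1P[->//|/(Flt _ _ x1)/ltW].
have m11 : -1 < 1 :> R by lra.
have m10 (x : R) : 0 <= x -> -1 < x by move=> x0; lra.
pose u (x : R) := F 1 - F x.
have du (x : R) : -1 < x -> is_derive x 1 u (- g x).
  move=> x1; have dc := @is_derive_cst R R R (F 1) x 1.
  have := is_deriveB dc (dF _ x1); by rewrite sub0r.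
have cu (x : R) : -1 < x -> {for x, continuous u} by move=> /du; exact: is_derive_continuous.
have u0 (x : R) : 0 < x < 1 -> 0 < u x.
  by move=> /andP[x0 x1]; rewrite subr_gt0 Flt// m10 ?ltW.
have uM (x : R) : 0 < x < 1 -> u x <= u 0.
  by move=> /andP[x0 x1]; rewrite lerD2l lerN2 Fle// ?m10// ltW.
have ubound b : exists M, forall x, 0 < x < b -> `|u x| <= M.
  exists (`|F 1| + (`|F 0| + `|F b|)) => x /andP[x0 xb].
  apply: le_trans (ler_normB _ _) _; rewrite lerD2l.
  have h1 : F 0 <= F x by rewrite Fle// ?m10// ltW.
  have h2 : F x <= F b by rewrite Fle// ?m10// ltW.
  rewrite ler_norml; apply/andP; split.
    have := ler_norm (- F 0); rewrite normrN; have := normr_ge0 (F b); lra.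
  have := ler_norm (F b); have := normr_ge0 (F 0); lra.
have pow_le (x b s : R) : 0 <= s -> 0 < x < b -> x `^ s <= b `^ s.
  move=> s0 /andP[x0 xb].
  by apply: ge0_ler_powR => //; rewrite ?nnegrE ltW// (lt_trans x0).
(* The primitive is built on the whole positive axis, and [u] is negative beyond 1; the absolute
   value keeps the integrand continuous and nonnegative there. *)
pose U1 (x : R) := x `^ (n - 1) * `|u x| `^ q.
have [|||U [dU U0 UE]] := @ge0_antiderivative R U1.
- by move=> x x0; rewrite mulr_ge0 ?powR_ge0.
- move=> x x0; apply: continuousM; first exact: powR_continuous.
  apply: (@continuous_comp _ _ _ u (fun y => `|y| `^ q)); first by apply: cu; rewrite m10// ltW.
  exact: norm_powR_continuous.
- move=> b; have [M uM'] := ubound b; exists (b `^ (n - 1) * M `^ q) => x xb.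
  have h := uM' _ xb.
  have q0' := ltW q0; have M0 : 0 <= M by exact: le_trans (normr_ge0 _) h.
  apply: ler_pM; [exact: powR_ge0|exact: powR_ge0|by apply: pow_le; rewrite ?subr_ge0|].
  by apply: ge0_ler_powR; rewrite ?nnegrE ?normr_ge0.
pose G1 (x : R) := x `^ (d + p - 1) * g x `^ p.
have [|||G [dG G0 GE]] := @ge0_antiderivative R G1.
- by move=> x x0; rewrite mulr_ge0 ?powR_ge0.
- move=> x x0; apply: continuousM; first exact: powR_continuous.
  apply: (@continuous_comp _ _ _ g (@powR R ^~ p)); first exact: cg.
  exact: powR_continuous.
- move=> b; have [b0|b0] := leP b 0.
    by exists 0 => x /andP[x0 xb]; lra.
  have [c _ cmax] := @EVT_max R g 0 b (ltW b0) (continuous_subspaceT cg).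
  exists (b `^ (d + p - 1) * g c `^ p) => x xb.
  apply: ler_pM; [exact: powR_ge0|exact: powR_ge0|exact: pow_le|].
  apply: ge0_ler_powR; rewrite ?nnegrE ?(ltW p0) ?(ltW (g0 _))//.
  by apply: cmax; rewrite in_itv/=; have /andP[/ltW -> /ltW ->] := xb.
have absu (x : R) : 0 < x < 1 -> `|u x| = u x by move=> /u0; exact: gtr0_norm.
have dU' (x : R) : 0 < x < 1 -> is_derive x 1 U (x `^ (n - 1) * u x `^ q).
  by move=> x01; rewrite -(absu _ x01); apply: dU; have /andP[] := x01.
have dG' (x : R) : 0 < x < 1 -> is_derive x 1 G (x `^ (d + p - 1) * g x `^ p).
  by move=> /andP[x0 _]; exact: dG.
have U1l : U x @[x --> 1^'-] --> U 1.
  by apply: cvg_at_left_filter; exact: is_derive_continuous (dU _ ltr01).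
have G1l : G x @[x --> 1^'-] --> G 1.
  by apply: cvg_at_left_filter; exact: is_derive_continuous (dG _ ltr01).
have u1l : u x @[x --> 1^'-] --> 0.
  rewrite (_ : 0 = u 1); last by rewrite /u subrr.
  by apply: cvg_at_left_filter; exact: cu.
exists u, (G 1), (U 1); split.
- move=> x x01; have /andP[x0 x1] := x01.
  split; [|exact/ltW/u0|by apply: cu; exact/m10/ltW].
  apply: (@ge0_FTC_oo _ g F x 1) => //.
  + by move=> y _; exact: cg.
  + by move=> y _; exact/ltW/g0.
  + by move=> y /andP[xy _]; apply: dF; apply: m10; exact/ltW/(lt_trans x0).
  + by apply: cvg_at_right_filter; apply: is_derive_continuous (dF x _); exact/m10/ltW.
  + by apply: cvg_at_left_filter; exact: is_derive_continuous (dF _ m11).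
- rewrite -(UE _ ltr01); apply: eq_integral => x /set_mem xI.
  have x01 : 0 < x < 1 by move: xI; rewrite /I /= in_itv.
  by rewrite /U1 absu.
- exact: GE ltr01.
have A0 : 0 < G 1.
  have G12 : G 2^-1 < G 1.
    apply: (@oo_derive_gt0 _ G G1 0 2); try lra.
      by move=> x /andP[x0 _]; exact: dG.
    by move=> x /andP[x0 _]; rewrite mulr_gt0 ?powR_gt0.
  apply: le_lt_trans G12; apply: (cvgr_to_le G0); near=> x.
  apply: (@oo_derive_ge0 _ G G1 0 2) => //; last by lra.
    by move=> y /andP[y0 _]; exact: dG.
    by move=> y /andP[y0 _]; rewrite mulr_ge0 ?powR_ge0.
  by near: x; apply: nbhs_right_le; rewrite invr_gt0.
apply: (bliss_continuous p1 d0 nu0 dH H0 Hgt0 HHoo Htail (M := u 0) (g := g) _ u1l dU' U0 U1l dG' G0 G1l A0).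
move=> x x01; split; [|exact: u0|exact: uM|exact: g0].
by apply: du; have /andP[x0 _] := x01; exact/m10/ltW.
Unshelve. all: by end_near. Qed.

End bliss_upper.

(** * From continuous gradients to the unit sphere *)

Section bliss_upper_general.
Context {R : realType} (p d nu : R).
Context (p1 : 1 < p) (d0 : 0 < d) (nu0 : 0 < nu).
Local Notation mu := (@lebesgue_measure R).

Let n := d + nu * p.
Let q := n * p / d.
Let I : set R := `]0, 1[%classic.

Context (n1 : 1 <= n) (a10 : 0 <= d + p - 1) (S : R) (S0 : 0 <= S).
Context (upper_continuous : forall g : R -> R, continuous g -> (forall x, 0 < g x) ->
  exists (u : R -> R) (A B : R),
  [/\ forall x : R, 0 < x < 1 -> [/\ (\int[mu]_(t in `]x, 1%R[) (g t)%:E)%E = (u x)%:E,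
        0 <= u x & {for x, continuous u}],
      (\int[mu]_(x in I) (x `^ (n - 1) * u x `^ q)%:E)%E = B%:E,
      (\int[mu]_(x in I) (x `^ (d + p - 1) * g x `^ p)%:E)%E = A%:E &
      B <= S * A `^ (q / p)]).

Let p0 : 0 < p. Proof. exact: lt_trans ltr01 p1. Qed.
Let n0 : 0 < n. Proof. by rewrite /n addr_gt0// mulr_gt0. Qed.
Let q1 : 1 < q.
Proof.
rewrite /q ltr_pdivlMr// mul1r; apply: (@lt_trans _ _ n); last by rewrite ltr_pMr.
by rewrite /n ltrDl mulr_gt0.
Qed.
Let q0 : 0 < q. Proof. exact: lt_trans ltr01 q1. Qed.
Let mI : measurable I. Proof. exact: measurable_itv. Qed.
Let I01P (x : R) : I x -> 0 < x < 1. Proof. by rewrite /I /= in_itv. Qed.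
Let muI : (mu I = 1)%E.
Proof. by rewrite /I lebesgue_measure_itv/= lte_fin ltr01 oppr0 adde0. Qed.
Let intI (c : R) : (\int[mu]_(x in I) c%:E)%E = c%:E.
Proof. by rewrite integral_cst/= ?lebesgue_measure_itv/= ?lte_fin ?ltr01 ?oppr0 ?adde0 ?mule1. Qed.

Lemma measurable_powR_prod (D : set R) (v : R -> R) (s t : R) : measurable_fun D v ->
  measurable_fun D (fun x => x `^ s * v x `^ t).
Proof.
move=> mv; apply: measurable_funM.
  by apply: measurable_funS (@measurable_powR R s).
exact: (measurableT_comp (@measurable_powR R t)).
Qed.

Lemma powR_le1 (x s : R) : I x -> 0 <= s -> x `^ s <= 1.
Proof.
move=> /I01P/andP[x0 x1] s0; rewrite -[leRHS](one_powR s).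
by apply: ge0_ler_powR; rewrite ?nnegrE// ltW.
Qed.

Let sub1 (x : R) : I x -> `]x, 1[ `<=` I.
Proof. by move=> /I01P/andP[x0 _]; apply: subset_itvr; rewrite bnd_simp ltW. Qed.

(** Continuous functions approximate [f] in L^1. For functions bounded by [M], an L^1 error [de]
    becomes a uniform error of the primitives and, by the tangent inequality, an error of order [de]
    in both integrals. *)
Lemma upper_bounded (f v : R -> R) (M A : R) : measurable_fun I f ->
  (forall x, I x -> 0 <= f x <= M) -> 0 <= M ->
  (forall x, I x -> (\int[mu]_(t in `]x, 1%R[) (f t)%:E)%E = (v x)%:E) ->
  (\int[mu]_(x in I) (x `^ (d + p - 1) * f x `^ p)%:E)%E = A%:E ->
  (\int[mu]_(x in I) (x `^ (n - 1) * v x `^ q)%:E <= (S * A `^ (q / p))%:E)%E.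
Proof.
move=> mf fM M0 vE AE.
have f0 x : I x -> 0 <= f x by move=> /fM/andP[].
have v0 x : I x -> 0 <= v x.
  move=> Ix; rewrite -lee_fin -vE//; apply: integral_ge0 => y /(sub1 Ix) Iy.
  by rewrite lee_fin f0.
have intf : mu.-integrable I (EFin \o f).
  apply/integrableP; split; first exact/measurable_EFinP.
  apply: (@le_lt_trans _ _ (\int[mu]_(x in I) M%:E)%E).
    apply: le_integral_nonmeasurable => x Ix; first exact: abse_ge0.
    by rewrite /= lee_fin ger0_norm ?f0//; have /andP[] := fM _ Ix.
  by rewrite intI ltry.
have muIy : (mu I < +oo)%E by rewrite muI ltry.
have [h [ch ih /fine_cvgP[hfin hcvg]]] := approximation_continuous_integrable mI muIy intf.
(* Lipschitz constants of the p-th power on [[0, M + 1]], which contains the values of [g], and of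
   the q-th power on [[0, M + 2]], which contains those of [u + de]. *)
pose C1 := p * (M + 1) `^ (p - 1); pose C2 := q * (M + 2) `^ (q - 1).
have C10 : 0 <= C1 by rewrite mulr_ge0 ?powR_ge0 ?ltW.
have C20 : 0 <= C2 by rewrite mulr_ge0 ?powR_ge0 ?ltW.
have key de : 0 < de -> de <= 1 ->
    (\int[mu]_(x in I) (x `^ (n - 1) * v x `^ q)%:E <=
     (S * `|A + C1 * de| `^ (q / p) + C2 * de)%:E)%E.
  move=> de0 de1; have de20 : 0 < de / 2 by rewrite divr_gt0.
  have [k [kfin kde]] : exists k, (\int[mu]_(z in I) `|(f z - h k z)%:E| \is a fin_num)%E /\
      fine (\int[mu]_(z in I) `|(f z - h k z)%:E|)%E < de / 2.
    have [N _ hN] := hfin; have [N' _ hN'] := cvgr_lt _ hcvg _ de20.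
    by exists (maxn N N'); split; [apply: hN|apply: hN']; rewrite /= leq_maxl || rewrite /= leq_maxr.
  (* Truncation to [[0, M]] does not increase the distance to [f]; the added [de / 2] makes [g]
     positive, as the continuous case requires. *)
  pose g x := Num.min (Num.max (h k x) 0) M + de / 2.
  have cg : continuous g.
    have cm : continuous ((h k \max cst 0) \min cst M).
      move=> x; apply: continuous_min; last exact: cvg_cst.
      by apply: continuous_max; [exact: ch|exact: cvg_cst].
    by move=> x; apply: cvgD; [exact: cm|exact: cvg_cst].
  have g0 x : 0 < g x.
    by rewrite /g; apply: ltr_wpDl => //; rewrite le_min le_max lexx orbT.
  have gM x : g x <= M + 1.
    by rewrite /g; apply: lerD; [rewrite ge_min lexx orbT|lra].
  pose e x := `|f x - h k x| + de / 2.
  have fge x : I x -> `|f x - g x| <= e x.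
    move=> /fM/andP[fx0 fxM].
    have ft : `|f x - Num.min (Num.max (h k x) 0) M| <= `|f x - h k x|.
      have [hn|hp] := leP (h k x) 0; first by rewrite min_l// subr0 !ger0_norm; lra.
      have [hM|hM] := leP (h k x) M; first by [].
      by rewrite !ler0_norm; lra.
    by apply: le_trans (lerD ft (lexx (de / 2))); rewrite /g opprD addrA;
      apply: le_trans (ler_normB _ _) _; rewrite (gtr0_norm de20).
  have me : measurable_fun I e.
    apply: measurable_funD => //; apply: measurableT_comp => //.
    apply: measurable_funB => //.
    by have /integrableP[/measurable_EFinP] := ih k.
  have e0 x : 0 <= e x by rewrite addr_ge0// ltW.
  have inte : (\int[mu]_(x in I) (e x)%:E <= de%:E)%E.
    under eq_integral do rewrite EFinD.
    rewrite ge0_integralD//; last 2 first.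
    - apply/measurable_EFinP; apply: measurableT_comp => //.
      apply: measurable_funB => //.
      by have /integrableP[/measurable_EFinP] := ih k.
    - by move=> x _; rewrite lee_fin ltW.
    rewrite intI [in leRHS](splitr de) EFinD; apply: leeD => //.
    by rewrite -(fineK kfin) lee_fin ltW.
  have [u [A' [B [uE BE A'E BS]]]] := upper_continuous cg g0.
  have uE0 x : I x -> (\int[mu]_(t in `]x, 1%R[) (g t)%:E)%E = (u x)%:E by move=> /I01P/uE[].
  have u0 x : I x -> 0 <= u x by move=> /I01P/uE[].
  have mg (D : set R) : measurable D -> measurable_fun D g.
    by move=> mD; apply: measurable_funTS; exact: continuous_measurable_fun.
  have vu x : I x -> v x <= u x + de.
    move=> Ix; have mx : measurable (`]x, 1[%classic : set R) by exact: measurable_itv.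
    rewrite -lee_fin -vE// EFinD -uE0//.
    apply: (@le_trans _ _ (\int[mu]_(t in `]x, 1%R[) ((g t)%:E + (e t)%:E))%E).
      apply: le_integral_nonmeasurable => t /(sub1 Ix) It; first by rewrite lee_fin f0.
      by rewrite -EFinD lee_fin; have := fge _ It; rewrite ler_norml; lra.
    rewrite ge0_integralD//; last 4 first.
    - by move=> t _; rewrite lee_fin ltW.
    - by apply/measurable_EFinP; exact: mg.
    - by move=> t _; rewrite lee_fin.
    - by apply/measurable_EFinP; exact: (measurable_funS mI (sub1 Ix)).
    rewrite leeD2l//; apply: le_trans inte.
    apply: ge0_subset_integral => //; first exact/measurable_EFinP.
    + by move=> t _; rewrite lee_fin.
    + exact: sub1.
  have uM x : I x -> u x <= M + 1.
    move=> Ix; have [x0 x1] := andP (I01P Ix).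
    rewrite -lee_fin -uE0//.
    apply: (@le_trans _ _ (\int[mu]_(t in `]x, 1%R[) (M + 1)%:E)%E).
      apply: le_integral_nonmeasurable => t _; first by rewrite lee_fin ltW.
      by rewrite lee_fin.
    rewrite integral_cst/=; last exact: measurable_itv.
    rewrite lebesgue_measure_itv/= lte_fin x1 -EFinB -EFinM lee_fin.
    by rewrite ler_piMr ?addr_ge0//; lra.
  have AA : A' <= A + C1 * de.
    rewrite -lee_fin -A'E EFinD -AE EFinM.
    apply: (@le_trans _ _ (\int[mu]_(x in I) ((x `^ (d + p - 1) * f x `^ p)%:E + C1%:E * (e x)%:E))%E).
      apply: le_integral_nonmeasurable => x Ix; first by rewrite lee_fin mulr_ge0 ?powR_ge0.
      rewrite -EFinM -EFinD lee_fin.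
      have := @powR_tangent_le R (f x) (g x) (M + 1) p p1 (f0 _ Ix) (ltW (g0 x)) (gM x).
      rewrite distrC -/C1 => ht.
      apply: (@le_trans _ _ (x `^ (d + p - 1) * (f x `^ p + C1 * e x))).
        apply: ler_wpM2l; first exact: powR_ge0.
        by apply: le_trans ht _; rewrite lerD2l ler_wpM2l// fge.
      by rewrite mulrDr lerD2l; apply: ler_piMl; [rewrite mulr_ge0|exact: powR_le1].
    rewrite ge0_integralD//; last 4 first.
    - by move=> x _; rewrite lee_fin mulr_ge0 ?powR_ge0.
    - by apply/measurable_EFinP; exact: measurable_powR_prod.
    - by move=> x _; rewrite -EFinM lee_fin mulr_ge0.
    - by apply/measurable_EFinP; apply: measurable_funM.
    rewrite leeD2l// ge0_integralZl_EFin//; [|by move=> x _; rewrite lee_fin|exact/measurable_EFinP].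
    by apply: lee_wpmul2l; rewrite ?lee_fin.
  have A'0 : 0 <= A'.
    rewrite -lee_fin -A'E; apply: integral_ge0 => x _.
    by rewrite lee_fin mulr_ge0 ?powR_ge0.
  have AC0 : 0 <= A + C1 * de by exact: le_trans AA.
  apply: (@le_trans _ _ (B + C2 * de)%:E); last first.
    rewrite lee_fin lerD2r; apply: le_trans BS _; apply: ler_wpM2l => //.
    rewrite ger0_norm//; apply: ge0_ler_powR; rewrite ?nnegrE//.
    by rewrite divr_ge0// ltW.
  have mu_ : measurable_fun I u by apply: itv_continuous_measurable => x /uE[].
  apply: (@le_trans _ _ (\int[mu]_(x in I) ((x `^ (n - 1) * u x `^ q)%:E + (C2 * de)%:E))%E).
    apply: le_integral_nonmeasurable => x Ix.
      by rewrite lee_fin mulr_ge0 ?powR_ge0.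
    rewrite -EFinD lee_fin; have u0x := u0 _ Ix.
    have ude : u x + de <= M + 2 by have := uM _ Ix; lra.
    have ude0 : 0 <= u x + de by rewrite addr_ge0// ltW.
    have := @powR_tangent_le R (u x) (u x + de) (M + 2) q q1 u0x ude0 ude.
    rewrite addrAC subrr add0r gtr0_norm// -/C2 => ht.
    apply: (@le_trans _ _ (x `^ (n - 1) * (u x `^ q + C2 * de))).
      apply: ler_wpM2l; first exact: powR_ge0.
      apply: le_trans ht; apply: ge0_ler_powR; rewrite ?nnegrE ?(ltW q0)//.
      - exact: v0.
      - exact: vu.
    rewrite mulrDr lerD2l; apply: ler_piMl; first by rewrite mulr_ge0 ?(ltW de0).
    by apply: powR_le1 => //; rewrite subr_ge0.
  rewrite ge0_integralD//; last 3 first.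
  - by move=> x _; rewrite lee_fin mulr_ge0 ?powR_ge0.
  - by apply/measurable_EFinP; exact: measurable_powR_prod.
  - by move=> x _; rewrite lee_fin mulr_ge0// ltW.
  by rewrite BE intI EFinD.
have A0 : 0 <= A.
  rewrite -lee_fin -AE; apply: integral_ge0 => x _.
  by rewrite lee_fin mulr_ge0 ?powR_ge0.
have qp0 : 0 < q / p by rewrite divr_gt0.
have lim : S * `|A + C1 * de| `^ (q / p) + C2 * de @[de --> 0^'+] --> S * A `^ (q / p).
  rewrite [X in _ --> X](_ : _ = S * `|A + C1 * 0| `^ (q / p) + C2 * 0); last first.
    by rewrite !mulr0 !addr0 ger0_norm.
  apply: cvg_at_right_filter.
  have c2 (c : R) : c * de @[de --> 0] --> c * 0 by apply: cvgMr; exact: cvg_id.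
  apply: cvgD; last exact: c2.
  apply: cvgMr.
  apply: (cvg_comp (fun x => A + C1 * x) (fun y : R => `|y| `^ (q / p))); last first.
    exact: norm_powR_continuous.
  by apply: cvgD; [exact: cvg_cst|exact: c2].
have [y yE] : exists y, (\int[mu]_(x in I) (x `^ (n - 1) * v x `^ q)%:E)%E = y%:E.
  have := key 1 ltr01 (lexx 1).
  have : (0 <= \int[mu]_(x in I) (x `^ (n - 1) * v x `^ q)%:E)%E.
    by apply: integral_ge0 => x _; rewrite lee_fin mulr_ge0 ?powR_ge0.
  by case: (integral _ _ _) => // y _ _; exists y.
rewrite yE lee_fin; apply: (cvgr_to_ge lim); near=> de.
rewrite -lee_fin -yE; apply: key; near: de; [exact: nbhs_right_gt|exact: nbhs_right_le].
Unshelve. all: by end_near. Qed.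

Lemma upper_measurable (f v : R -> R) (A : R) : measurable_fun I f ->
  (forall x, I x -> 0 <= f x) ->
  (forall x, I x -> (\int[mu]_(t in `]x, 1%R[) (f t)%:E)%E = (v x)%:E) ->
  (\int[mu]_(x in I) (x `^ (d + p - 1) * f x `^ p)%:E)%E = A%:E ->
  (\int[mu]_(x in I) (x `^ (n - 1) * v x `^ q)%:E <= (S * A `^ (q / p))%:E)%E.
Proof.
move=> mf f0 vE AE.
have v0 x : I x -> 0 <= v x.
  move=> Ix; rewrite -lee_fin -vE//; apply: integral_ge0 => y /(sub1 Ix) Iy.
  by rewrite lee_fin f0.
pose fk k x := Num.min (f x) k%:R.
have mfk k : measurable_fun I (fk k) by apply: measurable_minr.
have fk0 k x : I x -> 0 <= fk k x by move=> Ix; rewrite le_min f0//=.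
have fkM k x : fk k x <= k%:R by rewrite ge_min lexx orbT.
have fkf k x : fk k x <= f x by rewrite ge_min lexx.
have fkmono k m x : (k <= m)%N -> fk k x <= fk m x.
  by move=> km; rewrite le_min fkf/= (le_trans (fkM _ _))// ler_nat.
have fkcvg x : fk k x @[k --> \oo] --> f x.
  apply: cvg_near_cst; near=> k; rewrite /fk min_l//.
  by near: k; exact: nbhs_infty_ger.
(* The lower limit [max x 0] makes [V k] nonincreasing on the whole line, from which its
   measurability follows. *)
pose V k (x : R) := fine (\int[mu]_(t in `](Num.max x 0)%R, 1%R[) (fk k t)%:E)%E.
have subm x : `]Num.max x 0, 1[ `<=` I.
  by apply: subset_itvr; rewrite bnd_simp le_max lexx orbT.
have Vfin k x : ((\int[mu]_(t in `](Num.max x 0)%R, 1%R[) (fk k t)%:E) \is a fin_num)%E.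
  rewrite ge0_fin_numE; last first.
    by apply: integral_ge0 => t /subm It; rewrite lee_fin fk0.
  apply: (@le_lt_trans _ _ (\int[mu]_(t in I) k%:R%:E)%E); last by rewrite intI ltry.
  apply: (@le_trans _ _ (\int[mu]_(t in I) (fk k t)%:E)%E).
    apply: ge0_subset_integral => //; first by apply/measurable_EFinP; exact: mfk.
    by move=> t It; rewrite lee_fin fk0.
  by apply: le_integral_nonmeasurable => t It; rewrite lee_fin ?fk0.
have V0 k x : 0 <= V k x.
  by apply: fine_ge0; apply: integral_ge0 => t /subm It; rewrite lee_fin fk0.
have maxI x : I x -> Num.max x 0 = x by move=> /I01P/andP[x0 _]; rewrite max_l// ltW.
have VE k x : I x -> (\int[mu]_(t in `]x, 1%R[) (fk k t)%:E)%E = (V k x)%:E.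
  by move=> Ix; rewrite /V fineK// maxI.
have Vmono k m x : (k <= m)%N -> V k x <= V m x.
  move=> km; rewrite fine_le//; apply: le_integral_nonmeasurable => t /subm It.
    by rewrite lee_fin fk0.
  by rewrite lee_fin fkmono.
have mV k : measurable_fun I (V k).
  apply: nonincreasing_measurable => // x y xy; rewrite fine_le//.
  apply: ge0_subset_integral => //.
  - by apply/measurable_EFinP; apply: (measurable_funS mI (@subm x)).
  - by move=> t /subm It; rewrite lee_fin fk0.
  - apply: subset_itvr; rewrite bnd_simp.
    by rewrite ge_max !le_max xy lexx orbT.
have Vcvg x : I x -> V k x @[k --> \oo] --> v x.
  move=> Ix.
  have := @cvg_monotone_convergence _ _ _ mu `]x, 1%R[%classic (measurable_itv _)
    (fun k t => (fk k t)%:E).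
  move=> /(_ _)/wrap[].
    by move=> k; apply/measurable_EFinP; exact: (measurable_funS mI (sub1 Ix)).
  move=> /(_ _)/wrap[].
    by move=> k t /(sub1 Ix) It; rewrite lee_fin fk0.
  move=> /(_ _)/wrap[].
    by move=> t _ k m km; rewrite lee_fin fkmono.
  rewrite (_ : (\int[mu]_(t in `]x, 1%R[) limn (fun k => (fk k t)%:E))%E = (v x)%:E); last first.
    rewrite -vE//; apply: eq_integral => t _; apply/cvg_lim => //.
    by apply: cvg_EFin; [exact: nearW|exact: fkcvg].
  rewrite (_ : (fun k => _) = (fun k => (V k x)%:E)); last by apply/funext => k; exact: VE.
  by move=> /fine_cvgP[].
have Gcvg x : I x -> limn (fun k => (x `^ (n - 1) * V k x `^ q)%:E) = (x `^ (n - 1) * v x `^ q)%:E.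
  move=> Ix; apply/cvg_lim => //; apply: cvg_EFin; first exact: nearW.
  apply: cvgMr; rewrite -[in X in _ --> X](ger0_norm (v0 _ Ix)).
  rewrite (_ : (fun _ => _) = (fun k => `|V k x| `^ q)); last first.
    by apply/funext => k; rewrite ger0_norm.
  apply: (cvg_comp (V^~ x) (fun y : R => `|y| `^ q)); first exact: Vcvg.
  exact: norm_powR_continuous.
have A0 : 0 <= A.
  rewrite -lee_fin -AE; apply: integral_ge0 => x _.
  by rewrite lee_fin mulr_ge0 ?powR_ge0.
have bound k : (\int[mu]_(x in I) (x `^ (n - 1) * V k x `^ q)%:E <= (S * A `^ (q / p))%:E)%E.
  have Ak_le : (\int[mu]_(x in I) (x `^ (d + p - 1) * fk k x `^ p)%:E <= A%:E)%E.
    rewrite -AE; apply: le_integral_nonmeasurable => x Ix.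
      by rewrite lee_fin mulr_ge0 ?powR_ge0.
    rewrite lee_fin; apply: ler_wpM2l; first exact: powR_ge0.
    by apply: ge0_ler_powR; rewrite ?nnegrE ?fk0 ?f0// ltW.
  have Ak_ge : (0 <= \int[mu]_(x in I) (x `^ (d + p - 1) * fk k x `^ p)%:E)%E.
    by apply: integral_ge0 => x _; rewrite lee_fin mulr_ge0 ?powR_ge0.
  have [Ak AkE] : exists Ak, (\int[mu]_(x in I) (x `^ (d + p - 1) * fk k x `^ p)%:E)%E = Ak%:E.
    by move: Ak_le Ak_ge; case: (integral _ _ _) => // y _ _; exists y.
  rewrite AkE !lee_fin in Ak_le Ak_ge.
  apply: (le_trans (@upper_bounded (fk k) (V k) k%:R Ak (mfk k) _ _ (VE k) AkE)) => //.
    by move=> x Ix; rewrite fk0//=.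
  rewrite lee_fin; apply: ler_wpM2l => //; apply: ge0_ler_powR; rewrite ?nnegrE//.
  by rewrite divr_ge0// ltW.
have := @cvg_monotone_convergence _ _ _ mu I mI (fun k x => (x `^ (n - 1) * V k x `^ q)%:E).
move=> /(_ _)/wrap[].
  by move=> k; apply/measurable_EFinP; exact: measurable_powR_prod.
move=> /(_ _)/wrap[].
  by move=> k x Ix; rewrite lee_fin mulr_ge0 ?powR_ge0.
move=> /(_ _)/wrap[].
  move=> x Ix k m km; rewrite lee_fin; apply: ler_wpM2l; first exact: powR_ge0.
  by apply: ge0_ler_powR; rewrite ?nnegrE ?(ltW q0)//; exact: Vmono.
rewrite (_ : (\int[mu]_(x in I) limn _)%E = (\int[mu]_(x in I) (x `^ (n - 1) * v x `^ q)%:E)%E); last first.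
  by apply: eq_integral => x /set_mem; exact: Gcvg.
by move=> h; apply: (cvge_to_le h); exact: nearW.
Unshelve. all: by end_near. Qed.

End bliss_upper_general.

(** * Functions of the weighted Sobolev space and their boundary value *)

Section sobolev_functions.
Context {R : realType}.
Local Notation mu := (@lebesgue_measure R).
Implicit Types (f u v w : R -> R) (a b x y e : R).
Let I : set R := `]0, 1[%classic.

Let mI : measurable I. Proof. exact: measurable_itv. Qed.
Let I01P x : I x <-> 0 < x < 1. Proof. by rewrite /I /= in_itv. Qed.

Lemma subset_integral_nonmeasurable (D E : set R) (f : R -> \bar R) :
  measurable D -> measurable E -> D `<=` E -> (forall x, E x -> 0 <= f x)%E ->
  (\int[mu]_(x in D) f x <= \int[mu]_(x in E) f x)%E.
Proof.
move=> mD mE DE f0; rewrite integral_mkcond [leRHS]integral_mkcond.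
apply: le_integral_nonmeasurable => x _; rewrite /patch; case: ifPn => //.
- by move=> /set_mem/DE; exact: f0.
- by move=> /set_mem/DE Ex; rewrite mem_set.
- by move=> _; case: ifPn => // /set_mem; exact: f0.
Qed.

(* The integral of a nonnegative function is a supremum over simple functions below it, so that
   [g], in practice the derivative of a difference, need not be measurable. *)
Lemma ae_le_integral_nonmeasurable (D : set R) (f g : R -> \bar R) : measurable D ->
  measurable_fun D f -> (forall x, D x -> 0 <= f x)%E -> (forall x, D x -> 0 <= g x)%E ->
  {ae mu, forall x, D x -> (f x <= g x)%E} ->
  (\int[mu]_(x in D) f x <= \int[mu]_(x in D) g x)%E.
Proof.
move=> mD mf f0 g0 [N [mN N0 hN]].
rewrite (@ge0_negligible_integral _ _ _ mu D N)//.
apply: (@le_trans _ _ (\int[mu]_(x in D `\` N) g x)%E).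
  apply: le_integral_nonmeasurable => x [Dx Nx]; first exact: f0.
  by apply: contrapT => h; apply: Nx; apply: hN => /= /(_ Dx).
by apply: subset_integral_nonmeasurable => //; exact: measurableD.
Qed.

Lemma AC_loc_derivable u : AC_loc u -> measurable_fun I (derive1 u) ->
  {ae mu, forall x, I x -> derivable u x 1}.
Proof.
move=> acu mu'.
have [z [k0 k1 zc]] : exists z : nat -> R, [/\ forall k, 0 < z k, forall k, z k < 1 - z k &
    z k @[k --> \oo] --> (0 : R)].
  exists (fun k => (k.+3%:R)^-1); split => [k|k|].
  - by rewrite invr_gt0.
  - rewrite ltrBrDr; have : (k.+3%:R)^-1 <= 3^-1 :> R by rewrite lef_pV2 ?posrE// ler_nat.
    by move: (_^-1) => y; lra.
  - by have := @cvg_harmonic R; rewrite -cvg_shiftS -cvg_shiftS.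
have h k : {ae mu, forall x, z k < x < 1 - z k -> derivable u x 1}.
  have k2 : 1 - z k < 1 by have := k0 k; lra.
  have [] := @abs_cont_FTC R _ _ u (k1 k) (acu _ _ (k0 k) (k1 k) k2) _ => //.
  apply: (measurable_funS mI) mu' => x; rewrite /I /= !in_itv/= => /andP[xk kx].
  by rewrite (lt_trans (k0 k))// (lt_trans kx).
move/ae_foralln : h; apply: filterS => x h /I01P/andP[x0 x1].
have e0 : 0 < Num.min x (1 - x) by rewrite lt_min x0 subr_gt0.
have /cvgrPdist_lt/(_ _ e0)[N _ /(_ N (leqnn _))/=] := zc.
rewrite sub0r normrN gtr0_norm// lt_min => /andP[h1 h2].
by apply: (h N); apply/andP; split; [exact: h1|lra].
Qed.

Lemma AC_loc_FTC u x y : AC_loc u -> measurable_fun I (derive1 u) -> 0 < x -> x < y -> y < 1 ->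
  mu.-integrable `]x, y[ (EFin \o derive1 u) /\
  (\int[mu]_(t in `]x, y[) (derive1 u t)%:E)%E = (u y - u x)%:E.
Proof.
move=> acu mu' x0 xy y1.
have [] := @abs_cont_FTC R _ _ u xy (acu _ _ x0 xy y1) _.
  apply: (measurable_funS mI) mu' => t; rewrite /I /= !in_itv/= => /andP[xt ty].
  by rewrite (lt_trans x0)// (lt_trans ty).
by move=> _ iu E; split => //; rewrite E ?lexx ?(ltW xy).
Qed.

Lemma AC_loc_dist_le u x y : AC_loc u -> measurable_fun I (derive1 u) -> 0 < x -> x < y -> y < 1 ->
  (`|u y - u x|%:E <= \int[mu]_(t in `]x, y[) `|derive1 u t|%:E)%E.
Proof.
move=> acu mu' x0 xy y1; have [iu uE] := AC_loc_FTC acu mu' x0 xy y1.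
have := @le_abse_integral _ _ _ mu `]x, y[%classic (EFin \o derive1 u) (measurable_itv _)
  (measurable_int _ iu).
by rewrite uE.
Qed.

Lemma AC_loc_dist2_le u w x y : AC_loc u -> AC_loc w -> measurable_fun I (derive1 u) ->
  measurable_fun I (derive1 w) -> 0 < x -> x < y -> y < 1 ->
  (`|(u y - w y) - (u x - w x)|%:E <= \int[mu]_(t in `]x, y[) `|derive1 u t - derive1 w t|%:E)%E.
Proof.
move=> acu acw mu' mw' x0 xy y1; have [iu uE] := AC_loc_FTC acu mu' x0 xy y1.
have [iw wE] := AC_loc_FTC acw mw' x0 xy y1.
have iuw : mu.-integrable `]x, y[ ((EFin \o derive1 u) \- (EFin \o derive1 w))%E.
  by apply: integrableB.
have := @le_abse_integral _ _ _ mu `]x, y[%classic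
  ((EFin \o derive1 u) \- (EFin \o derive1 w))%E (measurable_itv _) (measurable_int _ iuw).
rewrite integralB// uE wE -EFinB/=.
by rewrite (_ : u y - u x - (w y - w x) = u y - w y - (u x - w x)); last by ring.
Qed.

(** [sobnorm] of [u - w] contains the derivative of the difference, of which measurability is not
    given and which is known to equal the difference of the derivatives only almost everywhere. The
    estimates use the latter, which is measurable. *)
Lemma derive1_diff_integral_le u w a p : AC_loc u -> AC_loc w -> measurable_fun I (derive1 u) ->
  measurable_fun I (derive1 w) ->
  (\int[mu]_(x in I) (x `^ a * `|derive1 u x - derive1 w x| `^ p)%:E <=
   \int[mu]_(x in I) (x `^ a * `|derive1 (u \- w) x| `^ p)%:E)%E.
Proof.
move=> acu acw mu' mw'; apply: ae_le_integral_nonmeasurable => //.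
- apply/measurable_EFinP; apply: measurable_powR_prod.
  by apply: measurableT_comp => //; exact: measurable_funB.
- by move=> x _; rewrite lee_fin mulr_ge0 ?powR_ge0.
- by move=> x _; rewrite lee_fin mulr_ge0 ?powR_ge0.
- have au := AC_loc_derivable acu mu'; have aw := AC_loc_derivable acw mw'.
  apply: (@filterS2 _ _ (ae_filter_ringOfSetsType mu) _ _ _ _ au aw) => x du dw Ix; rewrite lee_fin !derive1E.
  by rewrite (deriveB (du Ix) (dw Ix)).
Qed.

Lemma wnorm_powR a p f : 0 < p ->
  (wnorm a p f `^ p)%E = (\int[mu]_(x in I) (x `^ a * `|f x| `^ p)%:E)%E.
Proof.
move=> p0; rewrite /wnorm -poweRrM mulVf ?gt_eqF// poweRe1//.
by apply: integral_ge0 => x _; rewrite lee_fin mulr_ge0 ?powR_ge0.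
Qed.

Lemma poweR_root_lt p e (A : \bar R) : 0 < p -> 0 < e -> (0 <= A)%E ->
  (A `^ p^-1 < e%:E)%E -> (A <= (e `^ p)%:E)%E.
Proof.
move=> p0 e0 A0 /ltW; move=> /(gt0_ler_poweR (ltW p0)).
rewrite !in_itv/= !leey !andbT !poweR_ge0 lee_fin (ltW e0) => /(_ isT isT).
by rewrite -poweRrM mulVf ?gt_eqF// poweRe1.
Qed.

Lemma sobnorm_lt a0 a1 p f e : 0 < p -> 0 < e -> (sobnorm a0 a1 p f < e%:E)%E ->
  (\int[mu]_(x in I) (x `^ a0 * `|f x| `^ p)%:E <= (e `^ p)%:E)%E /\
  (\int[mu]_(x in I) (x `^ a1 * `|derive1 f x| `^ p)%:E <= (e `^ p)%:E)%E.
Proof.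
move=> p0 e0; rewrite /sobnorm (wnorm_powR a0 f p0) (wnorm_powR a1 (derive1 f) p0).
have int0 a (g : R -> R) : (0 <= \int[mu]_(x in I) (x `^ a * `|g x| `^ p)%:E)%E.
  by apply: integral_ge0 => x _; rewrite lee_fin mulr_ge0 ?powR_ge0.
move: (integral _ _ _) (integral _ _ _) (int0 a0 f) (int0 a1 (derive1 f)) => A B A0 B0 h.
have AB := poweR_root_lt p0 e0 (adde_ge0 A0 B0) h.
by split; apply: le_trans AB; [exact: leeDl|exact: leeDr].
Qed.

Lemma gradient_tail_le f a p e x : 1 < p -> 0 <= a -> 0 < e -> measurable_fun I f ->
  (\int[mu]_(t in I) (t `^ a * `|f t| `^ p)%:E <= (e `^ p)%:E)%E -> 0 < x < 1 ->
  (\int[mu]_(t in `]x, 1%R[) `|f t|%:E <= (e * ((x `^ a)^-1 + 1))%:E)%E.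
Proof.
move=> p1 a0 e0 mf fe /andP[x0 x1].
have sub : `]x, 1[ `<=` I by apply: subset_itvr; rewrite bnd_simp ltW.
apply: (@weighted_L1_le R `]x, 1[%classic (fun t => `|f t|) a p e (x `^ a)) => //.
- by apply: measurableT_comp => //; apply: (measurable_funS mI sub).
- exact: powR_gt0.
- move=> t; rewrite /= in_itv/= => /andP[xt _].
  by apply: ge0_ler_powR; rewrite // ?nnegrE ?(ltW x0) ?(ltW xt)// (ltW (lt_trans x0 xt)).
- have := @lebesgue_measure_itv R `]x, 1[; rewrite /= lte_fin x1 -EFinB => ->.
  by rewrite lee_fin; lra.
- apply: le_trans fe; apply: subset_integral_nonmeasurable => // t _.
  by rewrite lee_fin mulr_ge0 ?powR_ge0.
Qed.

(** The gradient bound limits the oscillation of [u - w] on []r, 1[], and the bound on the function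
    provides one point where [|u - w|] is small; together they control the difference uniformly up
    to 1. [K] depends neither on the functions nor on [e]. *)
Lemma sobolev_uniform_bound a0 a1 p r : 1 < p -> 0 <= a0 -> 0 <= a1 -> 0 < r < 1 ->
  exists K : R, forall u w e, AC_loc u -> AC_loc w ->
  measurable_fun I u -> measurable_fun I w ->
  measurable_fun I (derive1 u) -> measurable_fun I (derive1 w) -> 0 < e ->
  (\int[mu]_(x in I) (x `^ a0 * `|u x - w x| `^ p)%:E <= (e `^ p)%:E)%E ->
  (\int[mu]_(x in I) (x `^ a1 * `|derive1 u x - derive1 w x| `^ p)%:E <= (e `^ p)%:E)%E ->
  forall x, r < x < 1 -> `|u x - w x| <= K * e.
Proof.
move=> p1 a00 a10 r01; have /andP[r0 r1] := r01.
have p0 : 0 < p by exact: lt_trans ltr01 p1.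
pose c0 := r `^ a0; have c00 : 0 < c0 by exact: powR_gt0.
(* If [|u - w|] exceeded [C * e] on all of []r, 1[], its weighted integral would be at least
   [c0 * (C e)^p * (1 - r) = 2 e^p]. *)
pose C := (2 / (c0 * (1 - r))) `^ p^-1.
have c1r : 0 < c0 * (1 - r) by rewrite mulr_gt0// subr_gt0.
have CE : C `^ p = 2 / (c0 * (1 - r)).
  by rewrite /C -powRrM mulVf ?gt_eqF// powRr1// divr_ge0// ltW.
exists (C + ((r `^ a1)^-1 + 1)) => u w e acu acw mu0 mw0 mu' mw' e0 h0 h1.
pose v x := u x - w x; pose L := e * ((r `^ a1)^-1 + 1).
have sub : `]r, 1[ `<=` I by apply: subset_itvr; rewrite bnd_simp ltW.
have dist x y : r < x -> x < y -> y < 1 -> `|v y - v x| <= L.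
  move=> rx xy y1; rewrite -lee_fin.
  apply: (le_trans (AC_loc_dist2_le acu acw mu' mw' (lt_trans r0 rx) xy y1)).
  apply: le_trans (gradient_tail_le p1 a10 e0 (measurable_funB mu' mw') h1 r01).
  apply: subset_integral_nonmeasurable => //.
  by move=> t; rewrite /= !in_itv/= => /andP[xt ty]; rewrite (lt_trans rx)//= (lt_trans ty).
have [s [rs s1 vs]] : exists s, [/\ r < s, s < 1 & `|v s| <= C * e].
  apply: contrapT => hs.
  have vC s : r < s -> s < 1 -> C * e < `|v s|.
    by move=> rs s1; rewrite ltNge; apply/negP => vs; apply: hs; exists s.
  have : (\int[mu]_(x in `]r, 1%R[) (c0 * (C * e) `^ p)%:E <= (e `^ p)%:E)%E.
    apply: le_trans h0; apply: (@le_trans _ _ (\int[mu]_(x in `]r, 1%R[) (x `^ a0 * `|v x| `^ p)%:E)%E).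
      apply: le_integral_nonmeasurable => x; rewrite /= in_itv/= => /andP[rx x1].
        by rewrite lee_fin mulr_ge0 ?powR_ge0.
      have Ce0 : 0 <= C * e by rewrite mulr_ge0 ?powR_ge0// ltW.
      rewrite lee_fin; apply: ler_pM; rewrite ?powR_ge0//.
        by apply: ge0_ler_powR; rewrite ?nnegrE ?(ltW r0) ?(ltW rx)// ltW// (lt_trans r0).
      by apply: ge0_ler_powR; rewrite ?nnegrE ?(ltW p0)// ltW// vC.
    by apply: subset_integral_nonmeasurable => // t _; rewrite lee_fin mulr_ge0 ?powR_ge0.
  rewrite integral_cst/=; last exact: measurable_itv.
  rewrite lebesgue_measure_itv/= lte_fin r1 -EFinB -EFinM lee_fin.
  rewrite powRM ?powR_ge0 ?(ltW e0)// CE.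
  have -> : c0 * (2 / (c0 * (1 - r)) * e `^ p) * (1 - r) = 2 * e `^ p.
    by field; rewrite !gt_eqF// subr_gt0.
  by have := powR_gt0 p e0; lra.
move=> x /andP[rx x1].
have : `|v x - v s| <= L.
  case: (ltgtP x s) => [xs|sx|->]; first by rewrite distrC dist.
    exact: dist.
  by rewrite subrr normr0 mulr_ge0 ?(ltW e0)// addr_ge0// invr_ge0 powR_ge0.
have := ler_normD (v x - v s) (v s); rewrite subrK -/(v x) /L; lra.
Qed.

(** An approximant [w] vanishes at 1 and stays within [K e] of [u] on all of []x, 1[], so [|u y|] is
    at most [K e + |w y|]. The increment of [u] from [x] to [y] is bounded by the gradient; [y]
    tends to 1, then [e] to 0. *)
Lemma X1p_le_gradient a0 a1 p u x : 1 < p -> 0 <= a0 -> 0 <= a1 -> X1p a0 a1 p u ->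
  0 < x < 1 -> (`|u x|%:E <= \int[mu]_(t in `]x, 1%R[) `|derive1 u t|%:E)%E.
Proof.
move=> p1 a00 a10 [[acu [mu0 _] [mu' _]] ucl] x01; have /andP[x0 x1] := x01.
have p0 : 0 < p by exact: lt_trans ltr01 p1.
have [K hK] := sobolev_uniform_bound p1 a00 a10 x01.
set V := (\int[mu]_(t in _) _)%E.
have V0 : (0 <= V)%E by apply: integral_ge0 => t _; rewrite lee_fin.
have step e : 0 < e -> (`|u x|%:E <= V + (K * e)%:E)%E.
  move=> e0; have [w [[acw [mw0 _] [mw' _]] w1] uw] := ucl e e0.
  have [h0 h1] := sobnorm_lt p0 e0 uw.
  have {}h1 := le_trans (derive1_diff_integral_le a1 p acu acw mu' mw') h1.
  have bound := hK u w e acu acw mu0 mw0 mu' mw' e0 h0 h1.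
  have [Vy|Vfin] := eqVneq V +oo%E; first by rewrite Vy addye// leey.
  have {Vfin} VE : V = (fine V)%:E by rewrite fineK// ge0_fin_numE// lt_neqAle Vfin leey.
  rewrite VE -EFinD lee_fin.
  have lim : fine V + K * e + `|w y| @[y --> 1^'-] --> fine V + K * e.
    rewrite -[X in _ --> X]addr0 -[in X in _ --> X](normr0 R); apply: cvgD; first exact: cvg_cst.
    exact: cvg_norm.
  apply: (cvgr_to_ge lim); near=> y.
  have xy : x < y by near: y; exact: nbhs_left_gt.
  have y1 : y < 1 by near: y; exact: nbhs_left_lt.
  have d1 : `|u y - u x| <= fine V.
    rewrite -lee_fin -VE; apply: (le_trans (AC_loc_dist_le acu mu' x0 xy y1)).
    apply: subset_integral_nonmeasurable => //.
    by apply: subset_itvl; rewrite bnd_simp ltW.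
  have d2 : `|u y - w y| <= K * e by apply: bound; rewrite xy.
  have := ler_normD (u y - u x) (- u y); have := ler_normD (u y - w y) (w y).
  rewrite subrK addrAC subrr add0r !normrN; lra.
apply/lee_addgt0Pr => e e0.
have k0 : 0 < e / (`|K| + 1) by rewrite divr_gt0// ltr_pwDr.
apply: (le_trans (step _ k0)); rewrite leeD2l// lee_fin mulrCA.
rewrite -[leRHS]mulr1 ler_pM2l// ler_pdivrMr ?ltr_pwDr// mul1r.
by have := ler_norm K; lra.
Unshelve. all: by end_near. Qed.

End sobolev_functions.

Section sphere.
Context {R : realType} (p a0 a1 : R) (p1 : 1 < p) (a00 : 0 <= a0) (a10 : 0 <= a1).
Local Notation mu := (@lebesgue_measure R).
Let I : set R := `]0, 1[%classic.
Let p0 : 0 < p. Proof. exact: lt_trans ltr01 p1. Qed.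

Lemma sphere_gradient (u : R -> R) : X1p_sphere a0 a1 p u ->
  (\int[mu]_(x in I) (x `^ a1 * `|derive1 u x| `^ p)%:E)%E = 1%E.
Proof. by move=> [_]; rewrite /gradnorm => u1; rewrite -wnorm_powR// u1 poweR1r. Qed.

(** [v] is the nonincreasing majorant of [|u|] with gradient [-|u'|], hence of the same gradient
    norm; the sharp inequality is applied to [v], since u' may change sign. Its finiteness is
    Hoelder's inequality on []x, 1[], where the weight is at least [x^a1]. *)
Lemma sphere_tail (u : R -> R) : X1p_sphere a0 a1 p u ->
  exists v : R -> R, forall x, 0 < x < 1 ->
  [/\ (\int[mu]_(t in `]x, 1%R[) `|derive1 u t|%:E)%E = (v x)%:E, v x <= (x `^ a1)^-1 + 1 &
    `|u x| <= v x].
Proof.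
move=> us; have [uX _] := us; have [[_ _ [mu' _]] _] := uX.
exists (fun x => fine (\int[mu]_(t in `]x, 1%R[) `|derive1 u t|%:E)%E) => x x01.
have h : (\int[mu]_(t in `]x, 1%R[) `|derive1 u t|%:E <= ((x `^ a1)^-1 + 1)%:E)%E.
  rewrite -[X in X%:E]mul1r; apply: (gradient_tail_le p1 a10 ltr01 mu') => //.
  by rewrite one_powR sphere_gradient.
have h0 : (0 <= \int[mu]_(t in `]x, 1%R[) `|derive1 u t|%:E)%E.
  by apply: integral_ge0 => t _; rewrite lee_fin.
have hfin : (\int[mu]_(t in `]x, 1%R[) `|derive1 u t|%:E)%E \is a fin_num.
  by rewrite ge0_fin_numE// (le_lt_trans h)// ltry.
have hE := fineK hfin; split; first by rewrite hE.
- by rewrite -lee_fin hE.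
- by rewrite -lee_fin hE; exact: (X1p_le_gradient p1 a00 a10 uX x01).
Qed.

Lemma sphere_pointwise (u : R -> R) x : X1p_sphere a0 a1 p u -> 0 < x < 1 ->
  `|u x| <= (x `^ a1)^-1 + 1.
Proof. by move=> /sphere_tail[v hv] /hv[_ vx /le_trans]; apply. Qed.

End sphere.

Section bliss_sphere.
Context {R : realType} (p d nu a0 : R).
Context (p1 : 1 < p) (d0 : 0 < d) (nu0 : 0 < nu) (a00 : 0 <= a0).
Local Notation mu := (@lebesgue_measure R).

Let n := d + nu * p.
Let q := n * p / d.
Let p' := p / (p - 1).
Let kap := d / (p - 1).
Let X (y : R) := 1 + y `^ (nu * p').
Let f0 (y : R) := y `^ (n - 1) * X y `^ (- (n / nu)).
Let I : set R := `]0, 1[%classic.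

Context (n1 : 1 <= n) (a10 : 0 <= d + p - 1).
Context (H : R -> R) (Hoo : R).
Context (dH : forall y : R, 0 < y -> is_derive y 1 H (f0 y))
  (H0 : H y @[y --> 0^'+] --> 0) (Hgt0 : forall y : R, 0 < y -> 0 < H y)
  (HHoo : forall y : R, 0 < y -> H y <= Hoo)
  (Htail : forall y : R, 0 < y -> Hoo - H y <= (p - 1) / n * y `^ (- (n / (p - 1)))).

Let S := Hoo * (kap `^ p * ((p - 1) * n / d * Hoo)) `^ (- (q / p)).

Lemma sphere_functional_le (u : R -> R) : X1p_sphere a0 (d + p - 1) p u ->
  (\int[mu]_(x in I) (x `^ (n - 1) * `|u x| `^ q)%:E <= S%:E)%E.
Proof.
move=> us; have [v hv] := sphere_tail p1 a00 a10 us.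
have [[[_ _ [mu' _]] _] _] := us.
have I01P x : I x -> 0 < x < 1 by rewrite /I /= in_itv.
have p0 : 0 < p by exact: lt_trans ltr01 p1.
have q0 : 0 < q by rewrite divr_gt0// mulr_gt0// (lt_le_trans ltr01 n1).
have Hoo0 : 0 <= Hoo by apply: ltW; exact: lt_le_trans (Hgt0 ltr01) (HHoo ltr01).
have S0 : 0 <= S by rewrite mulr_ge0 ?powR_ge0.
have := @upper_measurable R p d nu p1 d0 nu0 n1 a10 S S0
  (bliss_upper_continuous p1 d0 nu0 n1 a10 dH H0 Hgt0 HHoo Htail) (fun t => `|derive1 u t|) v 1.
move=> /(_ _ _ _ (sphere_gradient p1 us))/wrap[].
- by apply: measurableT_comp.
- by [].
- by move=> x /I01P/hv[].
rewrite one_powR mulr1; apply: le_trans.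
apply: le_integral_nonmeasurable => x Ix.
  by rewrite lee_fin mulr_ge0 ?powR_ge0.
have [_ _ uv] := hv _ (I01P _ Ix).
rewrite lee_fin; apply: ler_wpM2l; first exact: powR_ge0.
by apply: ge0_ler_powR; rewrite ?nnegrE ?(ltW q0)// (le_trans (normr_ge0 (u x))).
Qed.

End bliss_sphere.

(** * Concentrating test functions *)

Section c1_functions.
Context {R : realType}.
Local Notation mu := (@lebesgue_measure R).
Implicit Types (f F : R -> R) (a b x y e : R).

(** The bound [C / x] makes [F] Lipschitz away from 0: with [L] a bound for [|f|], both [L x + F]
    and [L x - F] are nondecreasing. *)
Lemma is_derive_AC_loc F f (C : R) : (forall x, 0 < x < 1 -> is_derive x 1 F (f x)) ->
  (forall x, 0 < x < 1 -> `|f x| <= C / x) -> AC_loc F.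
Proof.
move=> dF fC a b a0 ab b1 e e0.
have C0 : 0 <= C.
  have h : 0 < (2^-1 : R) < 1 by lra.
  have := le_trans (normr_ge0 _) (fC _ h); rewrite invrK; lra.
(* The bound is taken on []a / 2, 1[], an open interval containing the endpoint [a]. *)
pose L := C / (a / 2); have a20 : 0 < a / 2 by lra.
have L0 : 0 <= L by rewrite divr_ge0// ltW.
have fL x : a / 2 < x < 1 -> `|f x| <= L.
  move=> /andP[ax x1]; have x0 : 0 < x by lra.
  apply: le_trans (fC x _) _; first by rewrite x0.
  by apply: ler_wpM2l => //; rewrite lef_pV2 ?posrE// ltW.
have dlin x : is_derive x 1 (fun x => L * x) L.
  by rewrite -[X in is_derive _ _ _ X]mulr1; exact: (is_deriveZ L (is_derive_id x (1 : R))).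
have lip s t : a <= s -> s <= t -> t <= b -> `|F t - F s| <= L * (t - s).
  move=> sa st tb; have a2s : a / 2 < s by lra.
  have t1 : t < 1 by lra.
  have p1 : L * s + F s <= L * t + F t.
    apply: (@oo_derive_ge0 _ (fun x => L * x + F x) (fun x => L + f x) (a / 2) 1) => //.
      move=> x /andP[ax x1]; apply: is_deriveD (dlin x) (dF x _).
      by rewrite x1 (lt_trans a20).
    by move=> x /fL; rewrite ler_norml => /andP[h1 h2]; lra.
  have p2 : L * s - F s <= L * t - F t.
    apply: (@oo_derive_ge0 _ (fun x => L * x - F x) (fun x => L - f x) (a / 2) 1) => //.
      move=> x /andP[ax x1]; apply: is_deriveB (dlin x) (dF x _).
      by rewrite x1 (lt_trans a20).
    by move=> x /fL; rewrite ler_norml => /andP[h1 h2]; lra.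
  by rewrite ler_norml; apply/andP; split; lra.
exists (e / (L + 1)); first by rewrite divr_gt0// ltr_wpDl.
move=> n s t st _ h.
apply: (@le_lt_trans _ _ (\sum_(i < n) L * (t i - s i))).
  by apply: ler_sum => i _; have [sa [sti tb]] := st i; exact: lip.
rewrite -mulr_sumr; apply: (@le_lt_trans _ _ (L * (e / (L + 1)))).
  by apply: ler_wpM2l => //; exact: ltW.
by rewrite mulrCA gtr_pMr// ltr_pdivrMr ?ltr_wpDl// mul1r ltrDl.
Qed.

Lemma is_derive_scale f (l c x : R) : is_derive (c * x) 1 f l ->
  is_derive x 1 (fun x => f (c * x)) (c * l).
Proof.
move=> df; have dc : is_derive x 1 (fun x => c * x) c.
  by rewrite -[X in is_derive _ _ _ X]mulr1; exact: (is_deriveZ c (is_derive_id x (1 : R))).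
by have := @is_derive1_comp _ f (fun x => c * x) x l c df dc; rewrite mulrC.
Qed.

Lemma continuous_scale f (c x : R) : {for (c * x), continuous f} ->
  {for x, continuous (fun x => f (c * x))}.
Proof.
move=> cf; apply: (@continuous_comp _ _ _ (fun x => c * x) f) => //.
by apply: continuousM; [exact: cvg_cst|exact: cvg_id].
Qed.

(** The substitution y = rho r is carried out on the primitive, [k * F (rho * r)] having the
    integrand as derivative; mass and energy of the rescaled extremal are computed in this way. *)
Lemma ge0_FTC_scale f F (k rho b : R) : 0 <= k -> 0 < rho -> 0 < b ->
  (forall y, 0 < y -> {for y, continuous f}) -> (forall y, 0 < y -> 0 <= f y) ->
  (forall y : R, 0 < y -> is_derive y 1 F (f y)) -> F y @[y --> 0^'+] --> 0 ->
  (\int[mu]_(r in `]0%R, b[) (k * (rho * f (rho * r)))%:E)%E = (k * F (rho * b))%:E.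
Proof.
move=> k0 rho0 b0 cf f0 dF F0.
have dFs (r : R) : 0 < r -> is_derive r 1 (fun r => k * F (rho * r)) (k * (rho * f (rho * r))).
  by move=> r0; exact: (is_deriveZ k (is_derive_scale (dF _ (mulr_gt0 rho0 r0)))).
rewrite -[in RHS](subr0 (k * F (rho * b))).
apply: (@ge0_FTC_oo R (fun r => k * (rho * f (rho * r))) (fun r => k * F (rho * r)) 0 b 0
  (k * F (rho * b)) b0).
- move=> r /andP[r0 _]; apply: continuousM; first exact: cvg_cst.
  apply: continuousM; first exact: cvg_cst.
  by apply: continuous_scale; apply: cf; exact: mulr_gt0.
- by move=> r /andP[r0 _]; rewrite !mulr_ge0 ?(ltW rho0)// f0// mulr_gt0.
- by move=> r /andP[r0 _]; exact: dFs.
- rewrite -[Z in _ --> Z](mulr0 k); apply: cvgMr.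
  apply/cvg_at_rightP => z [z0 zc].
  have /cvg_at_rightP := F0; apply; split; first by move=> m; rewrite mulr_gt0.
  by rewrite -(mulr0 rho); apply: cvgMr.
- by apply: cvg_at_left_filter; exact: is_derive_continuous (dFs _ b0).
Qed.

(** The threshold [exp e] makes the logarithm at least e, and [e^t >= 1 + t]. *)
Lemma ln_powR_ge (tau v t : R) : 0 < tau -> expR (expR 1) <= v -> 0 <= t ->
  1 + t <= `|ln (tau + v)| `^ t.
Proof.
move=> tau0 ub t0; have v0 : 0 < v := lt_le_trans (expR_gt0 _) ub.
have ln1 : expR 1 <= ln (tau + v).
  rewrite -[leLHS](@expRK R) ler_ln ?posrE ?expR_gt0 ?addr_gt0//.
  by apply: le_trans ub _; rewrite lerDr ltW.
have ln0 : 0 <= ln (tau + v) := le_trans (expR_ge0 _) ln1.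
apply: (@le_trans _ _ (expR 1 `^ t)).
  by rewrite expR_powR mulr1 expR_ge1Dx.
by rewrite ger0_norm//; apply: ge0_ler_powR; rewrite ?nnegrE ?expR_ge0.
Qed.

End c1_functions.

(** * Energy and mass of the rescaled extremal *)

Section bliss_test.
Context {R : realType} (p d nu a0 : R).
Context (p1 : 1 < p) (d0 : 0 < d) (nu0 : 0 < nu) (a00 : 0 <= a0).
Local Notation mu := (@lebesgue_measure R).

Let n := d + nu * p.
Let q := n * p / d.
Let p' := p / (p - 1).
Let kap := d / (p - 1).
Let X (y : R) := 1 + y `^ (nu * p').
Let f0 (y : R) := y `^ (n - 1) * X y `^ (- (n / nu)).
Let I : set R := `]0, 1[%classic.
Let h (y : R) := X y `^ (- (d / (nu * p))).
Let dh (y : R) := - (kap * y `^ (nu * p' - 1) * X y `^ (- (d / (nu * p)) - 1)).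
(** Up to the factor [kap^p], this is the energy density [y^(d+p-1) |dh|^p] of the extremal; its
    primitive is [W]. *)
Let f1 (y : R) := y `^ (n - 1 + nu * p') * X y `^ (- (n / nu)).

Context (n1 : 1 <= n).
Context (H : R -> R) (Hoo : R).
Context (dH : forall y : R, 0 < y -> is_derive y 1 H (f0 y))
  (H0 : H y @[y --> 0^'+] --> 0) (Hgt0 : forall y : R, 0 < y -> 0 < H y)
  (HHoo : forall y : R, 0 < y -> H y <= Hoo)
  (Htail : forall y : R, 0 < y -> Hoo - H y <= (p - 1) / n * y `^ (- (n / (p - 1)))).

Let W (y : R) := (p - 1) / d * (n * H y - y `^ n * X y `^ (1 - n / nu)).
(** The energy of the extremal on the half-line, so that [Hoo * K^(-(q/p))] is the constant of the
    upper bound. *)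
Let K := kap `^ p * ((p - 1) * n / d * Hoo).

Let p0 : 0 < p. Proof. exact: lt_trans ltr01 p1. Qed.
Let pp0 : 0 < p - 1. Proof. by rewrite subr_gt0. Qed.
Let p'0 : 0 < p'. Proof. exact: divr_gt0. Qed.
Let kap0 : 0 < kap. Proof. exact: divr_gt0. Qed.
Let n0 : 0 < n. Proof. exact: lt_le_trans ltr01 n1. Qed.
Let q1 : 1 < q.
Proof.
rewrite /q ltr_pdivlMr// mul1r; apply: (@lt_trans _ _ n); last by rewrite ltr_pMr.
by rewrite /n ltrDl mulr_gt0.
Qed.
Let q0 : 0 < q. Proof. exact: lt_trans ltr01 q1. Qed.
Let Hoo0 : 0 < Hoo. Proof. exact: lt_le_trans (Hgt0 ltr01) (HHoo ltr01). Qed.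
Let K0 : 0 < K.
Proof. by rewrite mulr_gt0 ?powR_gt0// mulr_gt0// divr_gt0// mulr_gt0. Qed.
Let X1 (y : R) : 1 <= X y. Proof. by rewrite /X lerDl powR_ge0. Qed.
Let X0 (y : R) : 0 < X y. Proof. exact: lt_le_trans ltr01 (X1 y). Qed.
Let e0 : 0 < d / (nu * p). Proof. by rewrite divr_gt0// mulr_gt0. Qed.
Let np'0 : 0 < nu * p'. Proof. exact: mulr_gt0. Qed.

Let bliss_power_derive (y s : R) : 0 < y -> is_derive y 1 (fun y => X y `^ s)
  (s * X y `^ (s - 1) * (nu * p' * y `^ (nu * p' - 1))).
Proof. exact: is_derive_1D_powR. Qed.

Lemma bliss_h_derive (y : R) : 0 < y -> is_derive y 1 h (dh y).
Proof.
move=> y0; apply: (is_derive_eq (bliss_power_derive _ y0)).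
rewrite /dh /kap /p'; move: (_ `^ _) (_ `^ _) => A B.
by field; rewrite !gt_eqF.
Qed.

Lemma bliss_dh_continuous (y : R) : 0 < y -> {for y, continuous dh}.
Proof.
move=> y0; apply: continuousN; apply: continuousM.
  by apply: continuousM; [exact: cvg_cst|exact: powR_continuous].
exact: is_derive_continuous (bliss_power_derive _ y0).
Qed.

Lemma bliss_h_gt0 (y : R) : 0 < h y. Proof. exact: powR_gt0. Qed.

Lemma bliss_h_lt (x y : R) : 0 < x -> x < y -> h y < h x.
Proof.
move=> x0 xy; rewrite /h !powRN ltf_pV2 ?posrE ?powR_gt0//.
apply: gt0_ltr_powR => //; rewrite ?nnegrE ?(ltW (X0 _))//.
by rewrite ltrD2l; apply: gt0_ltr_powR; rewrite ?nnegrE// ltW// (lt_trans x0).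
Qed.

Lemma bliss_h_le (x y : R) : 0 < x -> x <= y -> h y <= h x.
Proof. by move=> x0; rewrite le_eqVlt => /predU1P[->//|/(bliss_h_lt x0)/ltW]. Qed.

Lemma bliss_h_le1 (y : R) : h y <= 1.
Proof. by rewrite /h powRN invf_le1 ?powR_gt0// -[leLHS](powRr0 (X y)) ler_powR// ltW. Qed.

Lemma bliss_h_upper (y : R) : 0 < y -> h y <= y `^ (- kap).
Proof.
move=> y0; apply: (@le_trans _ _ ((y `^ (nu * p')) `^ (- (d / (nu * p))))).
  rewrite /h !powRN lef_pV2 ?posrE ?powR_gt0//.
  by apply: ge0_ler_powR; rewrite ?nnegrE ?powR_ge0 ?(ltW (X0 _)) ?(ltW e0)// lerDr.
rewrite -powRrM (_ : nu * p' * _ = - kap)//.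
by rewrite /p' /kap; field; rewrite !gt_eqF.
Qed.

Lemma bliss_h_lower (y : R) : 1 <= y -> 2 `^ (- (d / (nu * p))) * y `^ (- kap) <= h y.
Proof.
move=> y1; have y0 : 0 < y by exact: lt_le_trans ltr01 y1.
have yy : 1 <= y `^ (nu * p') by rewrite -[leLHS](powRr0 y) ler_powR// ltW.
rewrite (_ : - kap = nu * p' * - (d / (nu * p))); last first.
  by rewrite /p' /kap; field; rewrite !gt_eqF.
rewrite powRrM -powRM ?powR_ge0// /h !powRN lef_pV2 ?posrE ?powR_gt0 ?mulr_gt0 ?powR_gt0//.
apply: ge0_ler_powR; rewrite ?nnegrE ?(ltW e0) ?mulr_ge0 ?powR_ge0 ?(ltW (X0 _))//.
by rewrite /X; lra.
Qed.

Lemma bliss_dh_le (y : R) : 0 < y -> `|dh y| <= kap / y.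
Proof.
move=> y0; rewrite /dh normrN ger0_norm; last first.
  by apply: mulr_ge0 (powR_ge0 _ _); apply: mulr_ge0 (powR_ge0 _ _); exact: ltW.
rewrite -mulrA; apply: ler_wpM2l; first exact: ltW.
rewrite -[leRHS](mulr1 y^-1) gt0_powRD// -(powR_inv1 (ltW y0)) mulrAC mulrC.
apply: ler_pM; rewrite ?mulr_ge0 ?powR_ge0//.
apply: (@le_trans _ _ (X y * X y `^ (- (d / (nu * p)) - 1))).
  by apply: ler_wpM2r; rewrite ?powR_ge0// lerDr.
rewrite -[Z in Z * _](powRr1 (ltW (X0 y))) -gt0_powRD//.
rewrite [Z in _ `^ Z](_ : _ = - (d / (nu * p))); last by ring.
exact: bliss_h_le1.
Qed.

Lemma bliss_W_limits : W y @[y --> 0^'+] --> 0.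
Proof.
rewrite [Z in _ --> Z](_ : _ = (p - 1) / d * (n * 0 - 0 * 1 `^ (1 - n / nu))); last first.
  by rewrite mulr0 mul0r subr0 mulr0.
apply: cvgMr; apply: cvgB; first exact: cvgMr.
apply: cvgM.
  apply: gt0_cvg_powR => //; last by apply: cvg_at_right_filter; exact: cvg_id.
  by near=> x.
apply: (cvg_comp X (@powR R ^~ (1 - n / nu))); last exact: powR_continuous.
have : X x @[x --> 0^'+] --> (1 + 0 : R); last by rewrite addr0.
apply: cvgD; first exact: cvg_cst.
apply: gt0_cvg_powR => //; last by apply: cvg_at_right_filter; exact: cvg_id.
by near=> x.
Unshelve. all: by end_near. Qed.

Lemma bliss_W_gt0 (y : R) : 0 < y -> 0 < W y.
Proof.
move=> y0.
have dW z : 0 < z < y + 1 -> is_derive z 1 W (f1 z).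
  by move=> /andP[z0 _]; exact: (bliss_W_derive p1 d0 nu0 z0 (dH z0)).
have f1gt0 z : 0 < z < y + 1 -> 0 < f1 z.
  by move=> /andP[z0 _]; rewrite mulr_gt0 ?powR_gt0.
have y2 : 0 < y / 2 by rewrite divr_gt0.
have y2y : y / 2 < y by lra.
apply: (@le_lt_trans _ _ (W (y / 2))); last first.
  by apply: (oo_derive_gt0 dW f1gt0) => //; rewrite ltrDl.
apply: (cvgr_to_le bliss_W_limits); near=> x.
by apply/ltW/(oo_derive_gt0 dW f1gt0) => //; lra.
Unshelve. all: by end_near. Qed.

Lemma bliss_W_le (y : R) : 0 < y -> W y <= (p - 1) * n / d * Hoo.
Proof.
move=> y0; rewrite /W [leRHS](_ : _ = (p - 1) / d * (n * Hoo)); last by ring.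
have : n * H y - y `^ n * X y `^ (1 - n / nu) <= n * Hoo.
  have := ler_wpM2l (ltW n0) (HHoo y0).
  have : 0 <= y `^ n * X y `^ (1 - n / nu) by rewrite mulr_ge0 ?powR_ge0.
  lra.
exact: (ler_wpM2l (ltW (divr_gt0 pp0 d0))).
Qed.

(* [y^n X(y)^(-n/(nu p'))] is a bounded primitive of [n y^(n-1) h^(q-1)]. *)
Lemma bliss_q1_derive (y : R) : 0 < y ->
  is_derive y 1 (fun y => y `^ n * X y `^ (- (n / (nu * p')))) (n * (y `^ (n - 1) * h y `^ (q - 1))).
Proof.
move=> y0.
have dd : is_derive y 1 (fun y => y `^ n * X y `^ (- (n / (nu * p'))))
   (y `^ n * (- (n / (nu * p')) * X y `^ (- (n / (nu * p')) - 1) * (nu * p' * y `^ (nu * p' - 1)))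
    + X y `^ (- (n / (nu * p'))) * (n * y `^ (n - 1))).
  have := @is_deriveM _ _ (@powR R ^~ n) (fun y => X y `^ (- (n / (nu * p')))) y 1 _ _
    (is_derive1_powR _ y0) (bliss_power_derive _ y0).
  by rewrite /GRing.scale/=.
apply: (is_derive_eq dd).
have -> : h y `^ (q - 1) = X y `^ (- (n / (nu * p')) - 1).
  rewrite /h -powRrM; congr (_ `^ _); rewrite /q /p' /n; field.
  by rewrite !gt_eqF// -/n.
have -> : X y `^ (- (n / (nu * p'))) = X y * X y `^ (- (n / (nu * p')) - 1).
  rewrite -[Z in _ = Z * _](powRr1 (ltW (X0 y))) -gt0_powRD//; congr (_ `^ _); ring.
have -> : y `^ n = y `^ (n - 1) * y.
  by rewrite -[Z in _ * Z]powRr1 ?ltW// -gt0_powRD// subrK.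
have yy : y * y `^ (nu * p' - 1) = y `^ (nu * p').
  by rewrite mulr_powRB1 ?ltW.
rewrite [LHS](_ : _ = n * (X y - y * y `^ (nu * p' - 1)) * (y `^ (n - 1) * X y `^ (- (n / (nu * p')) - 1))).
  by rewrite yy /X addrK mulr1.
by field; rewrite !gt_eqF.
Qed.

Lemma bliss_q1_le (y : R) : 0 < y -> y `^ n * X y `^ (- (n / (nu * p'))) <= 1.
Proof.
move=> y0; rewrite powRN ler_pdivrMr ?powR_gt0// mul1r.
rewrite (_ : y `^ n = (y `^ (nu * p')) `^ (n / (nu * p'))).
  by apply: ge0_ler_powR; rewrite ?nnegrE ?powR_ge0 ?(ltW (X0 _)) ?lerDr// ltW// divr_gt0.
by rewrite -powRrM mulrCA divff ?mulr1// gt_eqF.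
Qed.

Let u (rho c r : R) := c * (h (rho * r) - h rho).
Let du (rho c r : R) := c * (rho * dh (rho * r)).

Lemma test_derive (rho c r : R) : 0 < rho -> 0 < r -> is_derive r 1 (u rho c) (du rho c r).
Proof.
move=> rho0 r0; have dhr := is_derive_scale (bliss_h_derive (mulr_gt0 rho0 r0)).
have := is_deriveZ c (is_deriveB dhr (@is_derive_cst R R R (h rho) r 1)).
by rewrite subr0.
Qed.

Lemma test_bounds (rho c r : R) : 0 < rho -> 0 < c -> 0 < r -> r <= 1 -> 0 <= u rho c r <= c.
Proof.
move=> rho0 c0 r0 r1; have rr : rho * r <= rho by rewrite ger_pMr.
rewrite mulr_ge0 ?(ltW c0)/= ?subr_ge0 ?bliss_h_le ?mulr_gt0// ger_pMr//.
by rewrite lerBlDr; apply: le_trans (bliss_h_le1 _) _; rewrite lerDl ltW// bliss_h_gt0.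
Qed.

Lemma test_gradient (rho c : R) : 0 < rho -> 0 < c ->
  (\int[mu]_(r in I) (r `^ (d + p - 1) * `|du rho c r| `^ p)%:E)%E =
  (c `^ p * (kap `^ p * rho `^ (- d) * W rho))%:E.
Proof.
move=> rho0 c0; pose k := c `^ p * (kap `^ p * rho `^ (- d)).
have k0 : 0 <= k by rewrite !mulr_ge0 ?powR_ge0.
have pointwise r : 0 < r -> r `^ (d + p - 1) * `|du rho c r| `^ p = k * (rho * f1 (rho * r)).
  move=> r0; have y0 : 0 < rho * r by exact: mulr_gt0.
  rewrite /du /dh /f1 /k; have Xy0 := X0 (rho * r).
  move: (X (rho * r)) Xy0 => Y Y0.
  have absE (A B C D E : R) : 0 < A -> 0 < B -> 0 < C -> 0 < D -> 0 < E ->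
      `|A * (B * - (C * D * E))| = A * (B * (C * D * E)).
    by move=> *; rewrite !mulrN normrN gtr0_norm// !mulr_gt0.
  rewrite absE ?powR_gt0//.
  have [la laE] := expR_surj rho0; have [lb lbE] := expR_surj r0.
  have [lc lcE] := expR_surj c0; have [ly lyE] := expR_surj Y0.
  have [lk lkE] := expR_surj kap0.
  rewrite lkE laE lbE lcE lyE.
  do ! rewrite -expRD || rewrite expR_powR.
  congr expR; rewrite /p' /n; field.
  by rewrite !gt_eqF.
transitivity (\int[mu]_(r in I) (k * (rho * f1 (rho * r)))%:E)%E.
  by apply: eq_integral => r /set_mem; rewrite /I /= in_itv/= => /andP[r0 _]; rewrite pointwise.
have dW (z : R) : 0 < z -> is_derive z 1 W (f1 z).
  by move=> z0; exact: (bliss_W_derive p1 d0 nu0 z0 (dH z0)).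
rewrite (ge0_FTC_scale k0 rho0 ltr01 (f := f1) (F := W)) ?mulr1.
- by rewrite /k -!mulrA.
- move=> y y0; apply: continuousM; first exact: powR_continuous.
  exact: is_derive_continuous (bliss_power_derive _ y0).
- by move=> y _; rewrite mulr_ge0 ?powR_ge0.
- exact: bliss_W_limits.
Qed.

Lemma test_derive1 (rho c r : R) : 0 < rho -> 0 < r -> derive1 (u rho c) r = du rho c r.
Proof. by move=> rho0 r0; rewrite derive1E; apply: derive_val; exact: test_derive. Qed.

Lemma test_sphere (rho c : R) : 0 < rho -> 0 < c ->
  c `^ p * (kap `^ p * rho `^ (- d) * W rho) = 1 -> X1p_sphere a0 (d + p - 1) p (u rho c).
Proof.
move=> rho0 c0 cE.
have I01P r : I r -> 0 < r < 1 by rewrite /I /= in_itv.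
have mI : measurable I by exact: measurable_itv.
have acu : AC_loc (u rho c).
  apply: (@is_derive_AC_loc _ _ (du rho c) (c * kap)).
    by move=> r /andP[r0 _]; exact: test_derive.
  move=> r /andP[r0 _]; rewrite /du !normrM (gtr0_norm c0) (gtr0_norm rho0) -mulrA.
  rewrite ler_pM2l//; have := ler_wpM2l (ltW rho0) (bliss_dh_le (mulr_gt0 rho0 r0)).
  by rewrite (_ : rho * (kap / (rho * r)) = kap / r)//; field; rewrite !gt_eqF.
have mu0 : measurable_fun I (u rho c).
  apply: itv_continuous_measurable => r /andP[r0 _].
  exact: is_derive_continuous (test_derive c rho0 r0).
have mu' : measurable_fun I (derive1 (u rho c)).
  apply: (eq_measurable_fun (du rho c)) => [r /set_mem/I01P/andP[r0 _]|].
    by rewrite test_derive1.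
  apply: itv_continuous_measurable => r /andP[r0 _].
  apply: continuousM; first exact: cvg_cst.
  apply: continuousM; first exact: cvg_cst.
  by apply: continuous_scale; apply: bliss_dh_continuous; exact: mulr_gt0.
have grad : (\int[mu]_(r in I) (r `^ (d + p - 1) * `|derive1 (u rho c) r| `^ p)%:E)%E = 1%E.
  rewrite -[RHS](congr1 EFin cE) -(test_gradient rho0 c0).
  by apply: eq_integral => r /set_mem/I01P/andP[r0 _]; rewrite test_derive1.
have W1u : W1p a0 (d + p - 1) p (u rho c).
  split => //; split => //; rewrite /wnorm; last by rewrite grad poweR1r ltry.
  apply: poweR_lty; apply: (@le_lt_trans _ _ (\int[mu]_(r in I) (c `^ p)%:E)%E).
    apply: le_integral_nonmeasurable => r /I01P/andP[r0 r1].
      by rewrite lee_fin mulr_ge0 ?powR_ge0.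
    have /andP[u0 uc] := test_bounds rho0 c0 r0 (ltW r1).
    rewrite lee_fin -[leRHS]mul1r; apply: ler_pM; rewrite ?powR_ge0//.
      by apply: powR_le1 => //; rewrite /= in_itv/= r0.
    by apply: ge0_ler_powR; rewrite ?nnegrE ?(ltW p0) ?(ltW c0)// ger0_norm.
  rewrite integral_cst/=; last exact: measurable_itv.
  by rewrite lebesgue_measure_itv/= lte_fin ltr01 oppr0 adde0 mule1 ltry.
split; last by rewrite /gradnorm /wnorm grad poweR1r.
(* The test function vanishes at 1 and is its own approximant in the closure. *)
split => // e e0'; exists (u rho c).
  have u1 : u rho c 1 = 0 by rewrite /u mulr1 subrr mulr0.
  split => //; have : u rho c r @[r --> 1^'-] --> u rho c 1; last by rewrite u1.
  apply: cvg_at_left_filter; exact: is_derive_continuous (test_derive c rho0 ltr01).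
rewrite (_ : u rho c \- u rho c = cst 0); last by apply/funext => r; exact: subrr.
rewrite /sobnorm !wnorm_powR//.
rewrite integral0_eq; last by move=> r _; rewrite /= normr0 powR0 ?mulr0// gt_eqF.
rewrite integral0_eq; last by move=> r _; rewrite derive1_cst normr0 powR0 ?mulr0// gt_eqF.
by rewrite adde0 poweR0r ?lte_fin// invr_neq0// gt_eqF.
Qed.

(* Where [rho r < M], [u >= exp e] makes the logarithmic factor at least [1 + r^beta]: the [1]
   contributes the mass [H M] up to a multiple of [h rho], and [r^beta] contributes the last term
   through the interval [1 / rho < r < 2 / rho]. *)
Lemma test_functional (rho M c tau beta : R) : 0 < rho -> 0 < c -> 0 < tau -> 0 < beta ->
  2 <= M -> M < rho -> h rho <= h M / 2 -> expR (expR 1) <= c * (h M - h rho) ->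
  ((c `^ q * rho `^ (- n) * (H M - q / n * h rho + (h 2 / 2) `^ q * rho `^ (- beta)))%:E <=
   \int[mu]_(r in I) (r `^ (n - 1) * `|u rho c r| `^ q
     * `|ln (tau + `|u rho c r|)| `^ (r `^ beta))%:E)%E.
Proof.
move=> rho0 c0 tau0 beta0 M2 Mrho hrho.
have [T TE] : exists T : R, T = expR (expR 1) by eexists.
rewrite -TE => hc; have T0 : 0 < T by rewrite TE expR_gt0.
have M0 : 0 < M by exact: lt_le_trans M2.
pose b := M / rho; have b0 : 0 < b by exact: divr_gt0.
have b1 : b < 1 by rewrite ltr_pdivrMr// mul1r.
have rhob : rho * b = M by rewrite /b mulrC divfK// gt_eqF.
have rM (r : R) : r < b -> rho * r < M by rewrite /b ltr_pdivlMr// mulrC.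
have uM (r : R) : 0 < r < b -> T <= u rho c r.
  move=> /andP[r0 rb]; apply: (le_trans hc); apply: ler_wpM2l; first exact: ltW.
  apply: lerB; last exact: lexx.
  by apply: bliss_h_le; [exact: mulr_gt0|exact/ltW/rM].
have u0 (r : R) : 0 < r < b -> 0 <= u rho c r.
  by move=> /uM; apply: le_trans; exact: ltW.
pose A1 (r : R) := r `^ (n - 1) * u rho c r `^ q.
pose A2 (r : R) := A1 r * r `^ beta.
have A10 (r : R) : 0 <= A1 r by rewrite mulr_ge0 ?powR_ge0.
have A20 (r : R) : 0 <= A2 r by rewrite mulr_ge0 ?powR_ge0.
have mA1 : measurable_fun `]0, b[ A1.
  apply: measurable_powR_prod; apply: itv_continuous_measurable => r /andP[r0 _].
  exact: is_derive_continuous (test_derive c rho0 r0).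
have mA2 : measurable_fun `]0, b[ A2.
  apply: measurable_funM => //.
  by apply: measurable_funS (@measurable_powR R beta).
apply: (@le_trans _ _ (\int[mu]_(r in `]0%R, b[) ((A1 r)%:E + (A2 r)%:E))%E); last first.
  apply: (@le_trans _ _ (\int[mu]_(r in `]0%R, b[) (r `^ (n - 1) * `|u rho c r| `^ q
     * `|ln (tau + `|u rho c r|)| `^ (r `^ beta))%:E)%E); last first.
    apply: subset_integral_nonmeasurable => //; first exact: measurable_itv.
      by apply: subset_itvl; rewrite bnd_simp ltW.
    by move=> r _; rewrite lee_fin !mulr_ge0 ?powR_ge0.
  apply: le_integral_nonmeasurable => r; rewrite /= in_itv/= => rb.
    by rewrite -EFinD lee_fin addr_ge0.
  rewrite -EFinD lee_fin (ger0_norm (u0 _ rb)) -[leLHS]mulr1 -/(A1 r).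
  rewrite /A2 -{1}(mulr1 (A1 r)) -mulrDr mulr1; apply: ler_wpM2l => //.
  by have := uM _ rb; rewrite TE => ub; exact: ln_powR_ge tau0 ub (powR_ge0 _ _).
rewrite ge0_integralD//; last 4 first.
- by move=> r _; rewrite lee_fin.
- exact/measurable_EFinP.
- by move=> r _; rewrite lee_fin.
- exact/measurable_EFinP.
rewrite mulrDr EFinD; apply: leeD; last first.
  have rho2 : rho^-1 < 2 / rho by rewrite -[ltLHS]mul1r ltr_pM2r ?invr_gt0// ltr1n.
  (* On []1 / rho, 2 / rho[] one has [u >= c * (h 2 - h rho) >= c * h 2 / 2], because
     [h rho <= h M / 2 <= h 2 / 2]; the powers of [r] are bounded below at the left end. *)
  pose k := (rho^-1) `^ (n - 1) * (c * (h 2 / 2)) `^ q * (rho^-1) `^ beta.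
  apply: (@le_trans _ _ (\int[mu]_(r in `]rho^-1%R, (2 / rho)%R[) k%:E)%E).
    rewrite integral_cst/=; last exact: measurable_itv.
    rewrite lebesgue_measure_itv/= lte_fin rho2 -EFinB -EFinM lee_fin /k.
    have h2 := bliss_h_gt0 2.
    have hh2 : 0 <= h 2 / 2 by rewrite divr_ge0 ?(ltW h2).
    rewrite (powRM _ (ltW c0) hh2).
    have irho s : (rho^-1) `^ s = rho `^ (- s) by rewrite -powR_inv1 ?(ltW rho0)// -powRrM mulN1r.
    rewrite !irho (_ : 2 / rho - rho^-1 = rho `^ (- 1)); last first.
      by rewrite powR_inv1 ?(ltW rho0)//; field; rewrite gt_eqF.
    rewrite (_ : rho `^ (- n) = rho `^ (- (n - 1)) * rho `^ (- 1)); last first.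
      by rewrite -gt0_powRD//; congr (_ `^ _); ring.
    by rewrite le_eqVlt; apply/orP; left; apply/eqP; ring.
  apply: (@le_trans _ _ (\int[mu]_(r in `]rho^-1%R, (2 / rho)%R[) (A2 r)%:E)%E); last first.
    apply: subset_integral_nonmeasurable => //; last by move=> r _; rewrite lee_fin.
    move=> r; rewrite /= !in_itv/= => /andP[r1 r2].
    rewrite (lt_trans _ r1) ?invr_gt0//= (lt_le_trans r2)//.
    by rewrite ler_pM2r// invr_gt0.
  apply: le_integral_nonmeasurable => r; rewrite /= in_itv/= => /andP[r1 r2].
    by rewrite lee_fin !mulr_ge0 ?powR_ge0.
  have ir0 : 0 < rho^-1 by rewrite invr_gt0.
  have r0 : 0 < r by exact: lt_trans r1.
  have r12 : rho * r <= 2 by move: r2; rewrite ltr_pdivlMr// mulrC => /ltW.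
  rewrite lee_fin /A2 /A1 /k; apply: ler_pM; rewrite ?mulr_ge0 ?powR_ge0//; last first.
    by apply: ge0_ler_powR; rewrite ?nnegrE ?(ltW ir0) ?(ltW r0) ?(ltW beta0)// ltW.
  apply: ler_pM; rewrite ?powR_ge0//.
    by apply: ge0_ler_powR; rewrite ?nnegrE ?(ltW ir0) ?(ltW r0) ?subr_ge0// ltW.
  have h2 := bliss_h_gt0 2.
  have hM2 : h M <= h 2 by exact: bliss_h_le.
  have hr2 : h 2 <= h (rho * r) by apply: bliss_h_le; rewrite ?mulr_gt0.
  have uu : c * (h 2 / 2) <= u rho c r.
    apply: ler_wpM2l; first exact: ltW.
    rewrite lerBrDr; apply: le_trans hr2; rewrite [leRHS]splitr lerD2l.
    by apply: (le_trans hrho); rewrite ler_pM2r.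
  have cc : 0 <= c * (h 2 / 2) :=  (mulr_ge0 (ltW c0) (divr_ge0 (ltW h2) (ler0n _ 2))).
  exact: (powR_mono (ltW q0) cc uu).
have hrho0 := bliss_h_gt0 rho.
pose k1 := c `^ q * rho `^ (- n).
have k10 : 0 <= k1 by rewrite mulr_ge0 ?powR_ge0.
pose k2 := k1 * (q / n * h rho).
have k20 : 0 <= k2 by exact: (mulr_ge0 k10 (mulr_ge0 (divr_ge0 (ltW q0) (ltW n0)) (ltW hrho0))).
(* The tangent inequality bounds [h^q - (h - h rho)^q] by [q h^(q-1) h rho], whose weighted integral
   is controlled by the primitive of [bliss_q1_derive], at most 1; the loss is therefore
   [q / n * h rho] times [k1]. *)
have main : ((k1 * H M)%:E <= \int[mu]_(r in `]0%R, b[) (A1 r)%:E + k2%:E)%E.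
  have E1 := ge0_FTC_scale k10 rho0 b0 (f := f0) (F := H).
  rewrite rhob in E1; rewrite -E1 //; last 2 first.
  - move=> y y0; apply: continuousM; first exact: powR_continuous.
    exact: is_derive_continuous (bliss_power_derive _ y0).
  - by move=> y _; rewrite mulr_ge0 ?powR_ge0.
  pose g y := n * (y `^ (n - 1) * h y `^ (q - 1)).
  have g0 y : 0 <= g y by rewrite !mulr_ge0 ?powR_ge0 ?(ltW n0).
  have cg (y : R) : 0 < y -> {for y, continuous g}.
    move=> y0; apply: continuousM; first exact: cvg_cst.
    apply: continuousM; first exact: powR_continuous.
    apply: (@continuous_comp _ _ _ h (@powR R ^~ (q - 1))).
      exact: is_derive_continuous (bliss_h_derive y0).
    by apply: powR_continuous; exact: bliss_h_gt0.
  pose G y := y `^ n * X y `^ (- (n / (nu * p'))).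
  have G0 : G y @[y --> 0^'+] --> 0.
    apply: (@squeeze_cvgr _ _ _ _ (fun=> 0) (@powR R ^~ n)).
    - near=> y; rewrite mulr_ge0 ?powR_ge0//= /G -[leRHS]mulr1.
      apply: ler_wpM2l; first exact: powR_ge0.
      exact: (powRN_le1 (X1 y) (ltW (divr_gt0 n0 np'0))).
    - exact: cvg_cst.
    - apply: gt0_cvg_powR => //; last by apply: cvg_at_right_filter; exact: cvg_id.
      by near=> y.
  have E2 := ge0_FTC_scale k20 rho0 b0 cg (fun y _ => g0 y) bliss_q1_derive G0.
  rewrite rhob in E2.
  apply: (@le_trans _ _ (\int[mu]_(r in `]0%R, b[) ((A1 r)%:E + (k2 * (rho * g (rho * r)))%:E))%E).
    apply: le_integral_nonmeasurable => r; rewrite /= in_itv/= => rb.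
      by rewrite lee_fin !mulr_ge0 ?powR_ge0// ltW.
    have /andP[r0 _] := rb; have y0 : 0 < rho * r by exact: mulr_gt0.
    rewrite -EFinD lee_fin.
    have hh : h rho <= h (rho * r).
      by apply: bliss_h_le => //; rewrite ger_pMr// ltW// (lt_trans _ b1)//; case/andP: rb.
    have hq : h (rho * r) `^ q = X (rho * r) `^ (- (n / nu)).
      rewrite /h -powRrM; congr (_ `^ _); rewrite /q; field; by rewrite !gt_eqF.
    have hy0 := bliss_h_gt0 (rho * r).
    have := @powR_tangent_le R (h (rho * r) - h rho) (h (rho * r)) (h (rho * r)) q q1.
    rewrite subr_ge0 => /(_ hh (ltW hy0) (lexx _)).
    rewrite subKr (gtr0_norm hrho0) => tg.
    have rE : rho `^ (- n) * (rho * (rho * r) `^ (n - 1)) = r `^ (n - 1).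
      rewrite powRM ?(ltW rho0) ?(ltW r0)// mulrA mulrA -{2}(powRr1 (ltW rho0)) -!gt0_powRD//.
      by rewrite (_ : - n + 1 + (n - 1) = 0) ?powRr0 ?mul1r//; ring.
    have dd : 0 <= h (rho * r) - h rho by rewrite subr_ge0.
    rewrite /f0 -hq /k2 /g /A1 /u (powRM _ (ltW c0) dd) /k1.
    have -> : c `^ q * rho `^ (- n) * (rho * ((rho * r) `^ (n - 1) * h (rho * r) `^ q)) =
        c `^ q * r `^ (n - 1) * h (rho * r) `^ q by rewrite -rE; ring.
    have -> : c `^ q * rho `^ (- n) * (q / n * h rho) *
       (rho * (n * ((rho * r) `^ (n - 1) * h (rho * r) `^ (q - 1)))) =
       c `^ q * r `^ (n - 1) * (q * h (rho * r) `^ (q - 1) * h rho).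
      by rewrite -rE; field; rewrite !gt_eqF.
    rewrite (mulrCA (r `^ _)) mulrA -mulrDr; apply: ler_wpM2l => //.
    by rewrite mulr_ge0 ?powR_ge0.
  rewrite ge0_integralD//; last 4 first.
  - by move=> r _; rewrite lee_fin.
  - exact/measurable_EFinP.
  - by move=> r _; rewrite lee_fin; exact: (mulr_ge0 k20 (mulr_ge0 (ltW rho0) (g0 _))).
  - apply/measurable_EFinP; apply: itv_continuous_measurable => r /andP[r0 _].
    apply: continuousM; first exact: cvg_cst.
    apply: continuousM; first exact: cvg_cst.
    by apply: continuous_scale; apply: cg; exact: mulr_gt0.
  rewrite leeD2l// E2 lee_fin -[leRHS]mulr1; apply: ler_wpM2l => //.
  exact: bliss_q1_le.
rewrite mulrBr -/k1 -/k2 EFinB leeBlDr//.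
Unshelve. all: by end_near. Qed.

(* The cutoff is [M = cM rho^((p-1)/p)], with [cM] so small that [u >= exp e] below it. *)
Lemma test_lower (tau : R) : 0 < tau -> exists C1 g0 : R, 0 < g0 /\
  \forall rho \near +oo, exists2 v, X1p_sphere a0 (d + p - 1) p v & forall beta : R, 0 < beta ->
    ((K `^ (- (q / p)) * (Hoo - C1 * rho `^ (- (n / p)) - q / n * rho `^ (- kap)
        + g0 * rho `^ (- beta)))%:E <=
     \int[mu]_(r in I) (r `^ (n - 1) * `|v r| `^ q * `|ln (tau + `|v r|)| `^ (r `^ beta))%:E)%E.
Proof.
move=> tau0.
have [T TE] : exists T : R, T = expR (expR 1) by eexists.
have T0 : 0 < T by rewrite TE expR_gt0.
pose e2 : R := 2 `^ (- (d / (nu * p))); have e20 : 0 < e2 by exact: powR_gt0.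
pose Kp := K `^ (- p^-1); have Kp0 : 0 < Kp by exact: powR_gt0.
(* Normalisation gives [c >= Kp * rho^(d/p)], and [cM^(-kap) = z] gives
   [h M >= e2 * z * rho^(-d/p)]; the value of [z] makes [c * h M / 2] at least [T]. *)
pose z := 2 * T / (Kp * e2).
have z0 : 0 < z by exact: divr_gt0 (mulr_gt0 (ltr0Sn _ 1) T0) (mulr_gt0 Kp0 e20).
pose cM := z `^ (- kap^-1); have cM0 : 0 < cM by exact: powR_gt0.
have cMkap : cM `^ (- kap) = z.
  by rewrite /cM -powRrM mulrNN mulVf ?gt_eqF// powRr1// ltW.
exists ((p - 1) / n * cM `^ (- (n / (p - 1)))), ((h 2 / 2) `^ q); split.
  by apply: powR_gt0; exact: divr_gt0 (bliss_h_gt0 2) (ltr0Sn _ 1).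
have s0 : 0 < (p - 1) / p by exact: divr_gt0.
have s10 : 0 < d / (p * (p - 1)) by exact: divr_gt0 d0 (mulr_gt0 p0 pp0).
(* The first condition says [2 <= M]; the second gives [h rho <= h M / 2] through the power bounds
   on [h]. *)
have nearM : \forall rho \near +oo, rho `^ (- ((p - 1) / p)) <= cM / 2.
  have := cvgr_le _ (powRN_cvgy s0); apply; exact: divr_gt0.
have nearh : \forall rho \near +oo, rho `^ (- (d / (p * (p - 1)))) <= e2 * z / 2.
  have := cvgr_le _ (powRN_cvgy s10); apply; apply: divr_gt0 => //; exact: mulr_gt0.
near=> rho.
have rho0 : 0 < rho by [].
have hM : rho `^ (- ((p - 1) / p)) <= cM / 2 by near: rho.
have hh : rho `^ (- (d / (p * (p - 1)))) <= e2 * z / 2 by near: rho.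
pose M := cM * rho `^ ((p - 1) / p).
have M2 : 2 <= M.
  rewrite powRN in hM; rewrite /M -ler_pdivrMr ?powR_gt0// mulrC.
  by move: hM; rewrite ler_pdivlMr.
have M0 : 0 < M by exact: lt_le_trans M2.
have Mpow (s : R) : M `^ s = cM `^ s * rho `^ ((p - 1) / p * s).
  by rewrite /M (powRM _ (ltW cM0) (powR_ge0 _ _)) -powRrM.
have M1 : 1 <= M by apply: le_trans M2; rewrite ler1n.
have hMlow : e2 * (z * rho `^ (- (d / p))) <= h M.
  have := bliss_h_lower M1; rewrite Mpow cMkap.
  by rewrite (_ : (p - 1) / p * - kap = - (d / p))//; rewrite /kap; field; rewrite !gt_eqF.
have hrho : h rho <= h M / 2.
  apply: (le_trans (bliss_h_upper rho0)).
  apply: (@le_trans _ _ (e2 * (z * rho `^ (- (d / p))) / 2)); last by rewrite ler_pM2r ?invr_gt0.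
  rewrite (_ : - kap = - (d / (p * (p - 1))) + - (d / p)); last first.
    by rewrite /kap; field; rewrite !gt_eqF.
  rewrite gt0_powRD// mulrA mulrAC; apply: ler_wpM2r => //; exact: powR_ge0.
have hM0 := bliss_h_gt0 M.
have Mrho : M < rho.
  rewrite ltNge; apply/negP => /(bliss_h_le rho0) hle.
  have := le_trans hle hrho; rewrite leNgt => /negP; apply.
  by rewrite [ltRHS]splitr ltrDl; exact: divr_gt0 hM0 (ltr0Sn _ 1).
have W0 := bliss_W_gt0 rho0.
pose g := kap `^ p * rho `^ (- d) * W rho.
have g0 : 0 < g by exact: mulr_gt0 (mulr_gt0 (powR_gt0 _ kap0) (powR_gt0 _ rho0)) W0.
have gK : g <= K * rho `^ (- d).
  rewrite /g /K mulrAC; apply: ler_wpM2r; first exact: powR_ge0.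
  by apply: ler_wpM2l; [exact: powR_ge0|exact: bliss_W_le].
have Kr0 : 0 < K * rho `^ (- d) by exact: mulr_gt0 K0 (powR_gt0 _ rho0).
have gpow (s : R) : 0 <= s -> (K * rho `^ (- d)) `^ (- s) <= g `^ (- s).
  move=> s00; rewrite (powRN g) (powRN (K * _)) lef_pV2 ?posrE; last 2 first.
  - exact: powR_gt0.
  - exact: powR_gt0.
  exact: powR_mono s00 (ltW g0) gK.
have Kpow (s : R) : (K * rho `^ (- d)) `^ (- s) = K `^ (- s) * rho `^ (d * s).
  by rewrite powRM ?(ltW K0) ?powR_ge0// -[in Z in _ * Z = _]powRrM mulrNN.
pose c := g `^ (- p^-1); have c0 : 0 < c by exact: powR_gt0.
have cp : c `^ p * g = 1.
  rewrite /c -powRrM mulNr mulVf ?gt_eqF// powRN powRr1 ?(ltW g0)//.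
  by rewrite mulVf// gt_eqF.
have clow : Kp * rho `^ (d / p) <= c.
  by have := gpow p^-1; rewrite Kpow invr_ge0 (ltW p0) => /(_ isT).
have cq : K `^ (- (q / p)) <= c `^ q * rho `^ (- n).
  have := gpow (q / p) (ltW (divr_gt0 q0 p0)); rewrite Kpow => hq.
  have -> : c `^ q = g `^ (- (q / p)) by rewrite /c -powRrM mulNr mulrC.
  rewrite (powRN rho n) ler_pdivlMr ?powR_gt0//; apply: le_trans hq.
  by rewrite (_ : d * (q / p) = n)// /q; field; rewrite !gt_eqF.
have hc : expR (expR 1) <= c * (h M - h rho).
  rewrite -TE; apply: (@le_trans _ _ ((Kp * rho `^ (d / p)) * (e2 * (z * rho `^ (- (d / p))) / 2))).
    have rr : rho `^ (d / p) * rho `^ (- (d / p)) = 1 by rewrite -gt0_powRD// subrr powRr0.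
    rewrite (_ : _ * _ = Kp * e2 * z / 2 * (rho `^ (d / p) * rho `^ (- (d / p)))); last by ring.
    rewrite rr mulr1 /z le_eqVlt; apply/orP; left; apply/eqP; field.
    by rewrite !gt_eqF.
  apply: ler_pM clow _; first exact: mulr_ge0 (ltW Kp0) (powR_ge0 _ _).
    apply: divr_ge0 => //; apply: mulr_ge0 (ltW e20) (mulr_ge0 (ltW z0) (powR_ge0 _ _)).
  rewrite lerBrDr; apply: (@le_trans _ _ (h M / 2 + h M / 2)); last by rewrite -splitr.
  by apply: lerD => //; rewrite ler_pM2r ?invr_gt0.
exists (u rho c); first exact: test_sphere rho0 c0 cp.
move=> beta beta0.
have F := test_functional rho0 c0 tau0 beta0 M2 Mrho hrho hc.
set B := H M - q / n * h rho + (h 2 / 2) `^ q * rho `^ (- beta) in F.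
have BB : Hoo - (p - 1) / n * cM `^ (- (n / (p - 1))) * rho `^ (- (n / p)) -
    q / n * rho `^ (- kap) + (h 2 / 2) `^ q * rho `^ (- beta) <= B.
  apply: lerD (lexx _); apply: lerB.
    rewrite lerBlDr -lerBlDl -mulrA (_ : - (n / p) = (p - 1) / p * - (n / (p - 1))).
      by rewrite -Mpow; exact: Htail.
    by field; rewrite !gt_eqF.
  by apply: ler_wpM2l; [exact: ltW (divr_gt0 q0 n0)|exact: bliss_h_upper].
(* The lower bound for [c^q * rho^(-n)] can be multiplied by [B] only if [B] is nonnegative;
   otherwise the claimed bound is nonpositive and the integral is not negative. *)
have [B0|B0] := leP 0 B.
  apply: le_trans F; rewrite lee_fin.
  apply: (@le_trans _ _ (K `^ (- (q / p)) * B)); first by apply: ler_wpM2l BB; exact: powR_ge0.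
  exact: ler_wpM2r B0 _ _ cq.
apply: (@le_trans _ _ 0%:E).
  rewrite lee_fin; apply: mulr_ge0_le0; first exact: powR_ge0.
  exact: le_trans BB (ltW B0).
apply: integral_ge0 => r _; rewrite lee_fin.
exact: mulr_ge0 (mulr_ge0 (powR_ge0 _ _) (powR_ge0 _ _)) (powR_ge0 _ _).
Unshelve. all: by end_near. Qed.

End bliss_test.

(** * Large exponents *)

Section large_beta.
Context {R : realType} (p a0 a1 theta q tau : R).
Context (p1 : 1 < p) (a00 : 0 <= a0) (a10 : 0 <= a1) (theta0 : 0 <= theta) (q0 : 0 < q)
  (tau0 : 0 < tau).
Local Notation mu := (@lebesgue_measure R).
Let I : set R := `]0, 1[%classic.

Lemma powR_integral (s : R) : 0 < s ->
  (\int[mu]_(r in I) (r `^ (s - 1))%:E)%E = (s^-1)%:E.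
Proof.
move=> s0; rewrite -[RHS]/((s^-1)%:E) -[in RHS](subr0 s^-1).
apply: (@ge0_FTC_oo R _ (fun r => s^-1 * r `^ s) 0 1 0 s^-1 ltr01).
- by move=> r /andP[r0 _]; exact: powR_continuous.
- by move=> r _; exact: powR_ge0.
- move=> r /andP[r0 _]; have := is_deriveZ s^-1 (is_derive1_powR s r0).
  by rewrite /GRing.scale/= mulrA mulVf ?gt_eqF// mul1r.
- rewrite -[Z in _ --> Z](mulr0 s^-1); apply: cvgMr.
  apply: gt0_cvg_powR => //; first by near=> r.
  by apply: cvg_at_right_filter; exact: cvg_id.
- rewrite -[Z in _ --> Z]mulr1; apply: cvgMr; apply: cvg_at_left_filter.
  by have := @powR_continuous R s 1 ltr01; rewrite /prop_for /continuous_at one_powR.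
Unshelve. all: by end_near. Qed.

(* With [B := D r^-a1 >= 1], [B^(r^beta) = exp (r^beta ln B) <= exp (D r^(beta-a1))]. *)
Lemma ln_powR_le : exists E : R, 0 <= E /\ forall r v beta : R, 0 < r < 1 -> 0 <= v ->
  v <= (r `^ a1)^-1 + 1 -> a1 <= beta -> `|ln (tau + v)| `^ (r `^ beta) <= 1 + E * r `^ (beta - a1).
Proof.
have [L LE] : exists L : R, L = ln tau by eexists.
have t0 := tau0; have L0 := normr_ge0 L.
pose D : R := tau + 2 + `|L|.
have D0 : 0 < D by rewrite /D; lra.
exists ((D + 1) * expR (D + 1)); split; first by rewrite mulr_ge0 ?expR_ge0//; lra.
move=> r v beta /andP[r0 r1] v0 vr ab.
set rm := (r `^ a1)^-1 in vr.
have rm1 : 1 <= rm.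
  rewrite /rm invf_ge1 ?powR_gt0// -(one_powR a1).
  exact: powR_mono a10 (ltW r0) (ltW r1).
(* [B] dominates both [tau + v] and [|ln tau|], hence [ln (tau + v)] from above and from below. *)
pose B := (D + 1) * rm.
have B1 : 1 <= B by rewrite /B -[leLHS]mulr1; apply: ler_pM => //; lra.
have BE : B = D * (rm - 1) + D + rm by rewrite /B; ring.
have lnB : `|ln (tau + v)| <= B.
  have tv : 0 < tau + v by lra.
  have h1 : ln (tau + v) <= tau + v by apply: ltW; exact: ln_sublinear.
  have h2 : ln tau <= ln (tau + v) by rewrite ler_ln ?posrE//; lra.
  have h3 : tau + v <= B.
    have : 0 <= D * (rm - 1) by rewrite mulr_ge0//; lra.
    by rewrite BE; move: (D * (rm - 1)) => w w0; rewrite /D; lra.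
  have h4 : `|L| <= B.
    have : 0 <= D * (rm - 1) by rewrite mulr_ge0//; lra.
    by rewrite BE; move: (D * (rm - 1)) => w w0; rewrite /D; lra.
  rewrite -LE in h2; have := ler_norm (- L); rewrite normrN ler_norml => h5.
  by apply/andP; split; lra.
have s0 : 0 <= r `^ beta by exact: powR_ge0.
apply: (le_trans (powR_mono s0 (normr_ge0 _) lnB)).
have B0 : 0 < B by exact: lt_le_trans B1.
rewrite powRE//.
set y := (D + 1) * r `^ (beta - a1).
have y0 : 0 <= y by rewrite mulr_ge0 ?powR_ge0//; lra.
have rb1 : r `^ (beta - a1) <= 1.
  by apply: powR_le1; rewrite ?subr_ge0//= in_itv/= r0.
have yD : y <= D + 1 by rewrite /y -[leRHS]mulr1; apply: ler_wpM2l => //; lra.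
have yE : r `^ beta * B = y.
  rewrite /y /B /rm gt0_powRD// powRN; ring.
have e1 : r `^ beta * ln B <= y.
  by rewrite -yE; apply: ler_wpM2l => //; apply: ltW; exact: ln_sublinear.
apply: (@le_trans _ _ (expR y)); first by rewrite ler_expR.
(* This gives [expR y <= 1 + y * expR y], and [y <= D + 1] makes the right-hand side linear in
   [y]. *)
have e2 : 1 - y <= expR (- y) by exact: expR_ge1Dx.
have e3 : expR y * (1 - y) <= 1.
  by have := ler_wpM2l (expR_ge0 y) e2; rewrite -expRD subrr expR0.
have e4 : y * expR y <= y * expR (D + 1) by apply: ler_wpM2l => //; rewrite ler_expR.
have -> : (D + 1) * expR (D + 1) * r `^ (beta - a1) = y * expR (D + 1) by rewrite /y; ring.
lra.
Qed.

Lemma sphere_functional_large_beta : exists C m : R, forall beta : R, m < beta -> forall u : R -> R,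
  X1p_sphere a0 a1 p u ->
  (\int[mu]_(r in I) (r `^ theta * `|u r| `^ q * `|ln (tau + `|u r|)| `^ (r `^ beta))%:E <=
   \int[mu]_(r in I) (r `^ theta * `|u r| `^ q)%:E + (C / (beta - m))%:E)%E.
Proof.
have [E [E0 hE]] := ln_powR_le.
(* On the sphere [|u|^q <= 2^q r^(-a1 q)], and the logarithmic factor exceeds 1 by at most
   [E * r^(beta - a1)]; the excess of the integrand is thus at most [C * r^(beta - m)]. It is
   enlarged to [C * r^(beta - m - 1)], which integrates to [C / (beta - m)]. *)
pose m := a1 + a1 * q; pose C := E * 2 `^ q.
have m0 : 0 <= m by rewrite addr_ge0// mulr_ge0// ltW.
exists C, m => beta mb u us.
have ab : a1 <= beta by apply: ltW; apply: le_lt_trans mb; rewrite lerDl mulr_ge0// ltW.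
have I01P r : I r -> 0 < r < 1 by rewrite /I /= in_itv.
have mI : measurable I by exact: measurable_itv.
have [[[acu [mu0 _] _] _] _] := us.
have bm : 0 < beta - m by rewrite subr_gt0.
apply: (@le_trans _ _ (\int[mu]_(r in I)
    ((r `^ theta * `|u r| `^ q)%:E + (C * r `^ (beta - m - 1))%:E))%E).
  apply: le_integral_nonmeasurable => r Ir.
    by rewrite lee_fin !mulr_ge0 ?powR_ge0.
  have r01 := I01P _ Ir; have /andP[r0 r1] := r01.
  have ur := sphere_pointwise p1 a00 a10 us r01.
  have fac := hE r _ beta r01 (normr_ge0 (u r)) ur ab.
  rewrite -EFinD lee_fin.
  apply: (le_trans (ler_wpM2l (mulr_ge0 (powR_ge0 _ _) (powR_ge0 _ _)) fac)).
  rewrite mulrDr mulr1 lerD2l.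
  set rm := (r `^ a1)^-1 in ur.
  have rm1 : 1 <= rm.
    rewrite /rm invf_ge1 ?powR_gt0// -(one_powR a1).
    exact: powR_mono a10 (ltW r0) (ltW r1).
  have u2 : `|u r| <= 2 * rm by lra.
  have uq := powR_mono (ltW q0) (normr_ge0 _) u2.
  have rmq : (2 * rm) `^ q = 2 `^ q * r `^ (- (a1 * q)).
    rewrite powRM// ?(le_trans ler01)// /rm -powRN -powRrM; congr (_ * _ `^ _); ring.
  have rth : r `^ theta <= 1 by exact: powR_le1.
  apply: (@le_trans _ _ (1 * (2 `^ q * r `^ (- (a1 * q))) * (E * r `^ (beta - a1)))).
    apply: ler_wpM2r; first by rewrite mulr_ge0 ?powR_ge0.
    by apply: ler_pM; rewrite ?powR_ge0// -rmq.
  have rr : r `^ (- (a1 * q)) * r `^ (beta - a1) = r `^ (beta - m).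
    by rewrite -gt0_powRD//; congr (_ `^ _); rewrite /m; ring.
  rewrite (_ : _ * _ = C * r `^ (beta - m)); last by rewrite -rr /C; ring.
  apply: ler_wpM2l; first by rewrite mulr_ge0 ?powR_ge0.
  rewrite [leRHS](_ : _ = r `^ (beta - m) * r `^ (- 1)); last by rewrite -gt0_powRD.
  rewrite -[leLHS]mulr1; apply: ler_wpM2l; first exact: powR_ge0.
  by rewrite powR_inv1 ?(ltW r0)// invf_ge1// ltW.
rewrite ge0_integralD//; last 4 first.
- by move=> r _; rewrite lee_fin !mulr_ge0 ?powR_ge0.
- apply/measurable_EFinP; apply: measurable_powR_prod.
  exact: measurableT_comp.
- by move=> r _; rewrite lee_fin !mulr_ge0 ?powR_ge0.
- apply/measurable_EFinP; apply: measurable_funM => //.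
  by apply: measurable_funS (@measurable_powR R _).
rewrite leeD2l//; under eq_integral do rewrite EFinM.
rewrite ge0_integralZl_EFin//; last 3 first.
- by move=> r _; rewrite lee_fin powR_ge0.
- by apply/measurable_EFinP; apply: measurable_funS (@measurable_powR R _).
- by rewrite mulr_ge0 ?powR_ge0.
by rewrite powR_integral// -EFinM.
Qed.

End large_beta.

(** * Comparison of the two suprema *)

Theorem theorem1p3 (R : realType) (p alpha0 alpha1 theta : R)
  (hp : 1 < p) (ha0 : 0 <= alpha0) (ha1 : 0 <= alpha1) (hth : 0 <= theta)
  (hsub : 0 < alpha1 - p + 1) (ha01 : alpha1 - p <= alpha0)
  (hth1 : alpha1 - p < theta) (tau : R) (htau : 0 < tau) :
  [/\ forall beta : R, 0 < beta ->
        (Sigma_p alpha0 alpha1 theta p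
           <= Fsup alpha0 alpha1 theta p tau beta)%E,
      forall beta : R, 0 < beta ->
        beta < Num.min ((theta + 1) / p) ((alpha1 - p + 1) / (p - 1)) ->
        (Sigma_p alpha0 alpha1 theta p
           < Fsup alpha0 alpha1 theta p tau beta)%E
    & Fsup alpha0 alpha1 theta p tau beta @[beta --> +oo]
        --> Sigma_p alpha0 alpha1 theta p].
Proof.
have p0 : 0 < p by exact: lt_trans ltr01 hp.
have pp0 : 0 < p - 1 by rewrite subr_gt0.
(* [nu] is chosen so that [d + nu p = theta + 1]; [alpha1 - p < theta] is its positivity, and
   [theta >= 0] becomes [1 <= n]. *)
pose d := alpha1 - p + 1; pose nu := (theta - (alpha1 - p)) / p.
have d0 : 0 < d by [].
have nu0 : 0 < nu by rewrite divr_gt0// subr_gt0.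
have nE : d + nu * p = theta + 1 by rewrite /nu /d; field; rewrite gt_eqF.
have thE : d + nu * p - 1 = theta by rewrite nE addrK.
have a1E : d + p - 1 = alpha1 by rewrite /d; ring.
have qE : (d + nu * p) * p / d = pstar alpha1 theta p by rewrite nE.
have n0 : 0 < d + nu * p by rewrite nE ltr_wpDl.
have n1 : 1 <= d + nu * p by rewrite nE lerDr.
have a10 : 0 <= d + p - 1 by rewrite a1E.
set q := pstar alpha1 theta p in qE *.
have q0 : 0 < q by rewrite -qE divr_gt0// mulr_gt0.
have [H [Hoo [dH H0 Hgt0 HHoo Htail]]] := bliss_mass_exists hp d0 nu0 n1.
pose K := (d / (p - 1)) `^ p * ((p - 1) * (d + nu * p) / d * Hoo).
have K0 : 0 < K.
  rewrite mulr_gt0 ?powR_gt0 ?divr_gt0// mulr_gt0 ?divr_gt0 ?mulr_gt0//.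
  exact: lt_le_trans (Hgt0 _ ltr01) (HHoo _ ltr01).
pose S := Hoo * K `^ (- (q / p)).
have SigS : (Sigma_p alpha0 alpha1 theta p <= S%:E)%E.
  apply: ge_ereal_sup => _ [u us <-]; rewrite -a1E in us.
  have := sphere_functional_le hp d0 nu0 ha0 n1 a10 dH H0 Hgt0 HHoo Htail us.
  by rewrite thE qE.
have [C1 [g0 [g00 low]]] := test_lower hp d0 nu0 ha0 n1 dH H0 Hgt0 HHoo Htail htau.
rewrite thE qE a1E -/K nE in low.
set kap := (alpha1 - p + 1) / (p - 1).
have kap0 : 0 < kap by exact: divr_gt0.
pose val beta rho := K `^ (- (q / p)) * (Hoo - C1 * rho `^ (- ((theta + 1) / p)) -
  q / (theta + 1) * rho `^ (- kap) + g0 * rho `^ (- beta)).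
have lowF beta : 0 < beta -> \forall rho \near +oo,
    ((val beta rho)%:E <= Fsup alpha0 alpha1 theta p tau beta)%E.
  move=> beta0; apply: filterS low => rho [v vs /(_ _ beta0) h].
  by apply: le_trans h _; apply: ereal_sup_ubound; exists v.
have np0 : 0 < (theta + 1) / p by rewrite divr_gt0// ltr_wpDl.
have SF beta : 0 < beta -> (S%:E <= Fsup alpha0 alpha1 theta p tau beta)%E.
  move=> beta0; have lim : (val beta rho)%:E @[rho --> +oo] --> S%:E.
    apply: cvg_EFin; first exact: nearW.
    have : val beta rho @[rho --> +oo] -->
        K `^ (- (q / p)) * (Hoo - C1 * 0 - q / (theta + 1) * 0 + g0 * 0).
      apply: cvgMr; apply: cvgD; last by apply: cvgMr; exact: powRN_cvgy.
      apply: cvgB; last by apply: cvgMr; exact: powRN_cvgy.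
      by apply: cvgB; [exact: cvg_cst|apply: cvgMr; exact: powRN_cvgy].
    by rewrite !mulr0 !subr0 addr0 mulrC.
  by apply: (cvge_to_le lim); exact: lowF.
have SigF beta : 0 < beta -> (Sigma_p alpha0 alpha1 theta p <= Fsup alpha0 alpha1 theta p tau beta)%E.
  by move=> /SF; exact: le_trans.
split => //.
- move=> beta beta0; rewrite lt_min => /andP[bn bk].
  apply: (le_lt_trans SigS).
  (* The two conditions on [beta] say that both losses, divided by [rho^(-beta)], are still negative
     powers of [rho]; eventually they add up to less than [g0]. *)
  have s1 : 0 < (theta + 1) / p - beta by rewrite subr_gt0.
  have s2 : 0 < kap - beta by rewrite subr_gt0.
  have lim : C1 * rho `^ (- ((theta + 1) / p - beta)) + q / (theta + 1) * rho `^ (- (kap - beta))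
      @[rho --> +oo] --> (0 : R).
    rewrite [Z in _ --> Z](_ : _ = C1 * 0 + q / (theta + 1) * 0); last by rewrite !mulr0 addr0.
    by apply: cvgD; apply: cvgMr; exact: powRN_cvgy.
  have gain : \forall rho \near +oo, C1 * rho `^ (- ((theta + 1) / p - beta)) +
      q / (theta + 1) * rho `^ (- (kap - beta)) < g0.
    by have := cvgr_lt _ lim; apply.
  near (pinfty_nbhs R) => rho.
  have rho0 : 0 < rho by near: rho; exact: nbhs_pinfty_gt.
  apply: (@lt_le_trans _ _ (val beta rho)%:E); last by near: rho; exact: lowF.
  have := near gain rho; move=> /(_ _)/wrap[//|].
  move=> h; rewrite lte_fin /S /val mulrC ltr_pM2l ?powR_gt0//.
  have rb : 0 < rho `^ (- beta) by exact: powR_gt0.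
  have e1 : rho `^ (- ((theta + 1) / p)) = rho `^ (- ((theta + 1) / p - beta)) * rho `^ (- beta).
    by rewrite -gt0_powRD//; congr (_ `^ _); ring.
  have e2 : rho `^ (- kap) = rho `^ (- (kap - beta)) * rho `^ (- beta).
    by rewrite -gt0_powRD//; congr (_ `^ _); ring.
  rewrite e1 e2; have {h} := h; rewrite -[X in is_true X -> _](ltr_pM2r rb).
  move: (rho `^ _) (rho `^ _) (rho `^ _) (q / _) => x y z w; lra.
(* The squeeze takes place between finite values: [Sigma_p] is at most S, and it is not the supremum
   of an empty set because the sphere contains a test function. *)
- have Sig0 : (0 <= Sigma_p alpha0 alpha1 theta p)%E.
    have [rho [v vs _]] := filter_ex low.
    apply: (@le_trans _ _ (\int[lebesgue_measure]_(r in I01) (r `^ theta * `|v r| `^ q)%:E)%E).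
      by apply: integral_ge0 => r _; rewrite lee_fin mulr_ge0 ?powR_ge0.
    by apply: ereal_sup_ubound; exists v.
  have [s sE] : exists s : R, Sigma_p alpha0 alpha1 theta p = s%:E.
    by move: SigS Sig0; case: (Sigma_p _ _ _ _) => // s _ _; exists s.
  have [C [m hC]] := sphere_functional_large_beta hp ha0 ha1 hth q0 htau.
  apply: (@squeeze_cvge _ _ _ _ (fun=> s%:E) _ (fun beta => (s + C / (beta - m))%:E)).
  + near=> beta; apply/andP; split.
      by rewrite -sE; apply: SigF; near: beta; exact: nbhs_pinfty_gt.
    apply: ge_ereal_sup => _ [u us <-].
    apply: le_trans (hC beta _ u us) _.
      by near: beta; apply: nbhs_pinfty_gt; exact: num_real.
    rewrite EFinD -sE leeD2r//; apply: ereal_sup_ubound; by exists u.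
  + by rewrite sE; exact: cvg_cst.
  + rewrite sE; apply: cvg_EFin; first exact: nearW.
    have : s + C / (beta - m) @[beta --> +oo] --> s + C * 0; last by rewrite mulr0 addr0.
    apply: cvgD; first exact: cvg_cst.
    apply: cvgMr; apply/gtr0_cvgV0; last exact: cvg_addrr.
    by near=> beta; rewrite subr_gt0; near: beta; apply: nbhs_pinfty_gt; exact: num_real.
Unshelve. all: by end_near. Qed.
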